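(* For $i=1,\dots,N$ let $\mu_i\in\mathbb R$ and consider the disturbance regulator equations for $\varphi_i(z,t)\in\mathbb R^{n_{v_i}}$, $$\varphi_{i,t}^\top(z,t)=\lambda_i\varphi_{i,zz}^\top(z,t)-\mu_i\varphi_i^\top(z,t)-\varphi_i^\top(z,t)S_i+h_{1,i}^\top(z,t),\quad(z,t)\in(0,1)\times\mathbb R^+_{t_0},$$ $$\varphi_{i,z}^\top(0,t)=\tilde g_{2,i}^\top(t),\qquad c_i\varphi_i^\top(0,t)=-\tilde g_{4,i}^\top(t),\qquad t\in\mathbb R^+_{t_0},$$ with $h_{1,i}^\top(z,t)=k_i(z,0,t)\lambda_i\tilde g_{2,i}^\top(t)+\tilde g_{1,i}^\top(z,t)-\int_0^zk_i(z,\zeta,t)\tilde g_{1,i}^\top(\zeta,t)\,d\zeta$. A strong solution is $$\varphi_i(z,t)=\begin{bmatrix}I_{n_{v_i}}&0\end{bmatrix}\Big(\sum_{j=0}^\infty\Phi_{j,i}(z)\,\partial_t^j\begin{bmatrix}-\frac1{c_i}\tilde g_{4,i}(t)\\ \tilde g_{2,i}(t)\end{bmatrix}-\frac1{\lambda_i}\int_0^z\sum_{j=0}^\infty\Phi_{j,i}(\zeta)\begin{bmatrix}0&I_{n_{v_i}}\end{bmatrix}^\top\partial_t^jh_{1,i}(z-\zeta,t)\,d\zeta\Big)$$ with $\Phi_{j,i}(z)=\begin{bmatrix}\phi^i_{1,j}(z)&\dots&\phi^i_{2n_{v_i},j}(z)\end{bmatrix}$, $j\ge0$, whose columns result from the recursion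 $$\phi^i_{k,0}(z)=e^{A_{0,i}z}e_k,\qquad\phi^i_{k,j}(z)=\int_0^ze^{A_{0,i}(z-\zeta)}A_{1,i}\phi^i_{k,j-1}(\zeta)\,d\zeta,\quad j\ge1,$$ $k=1,\dots,2n_{v_i}$, where $e_k$ is the $k$-th unit vector of $\mathbb R^{2n_{v_i}}$ and $$A_{0,i}=\begin{bmatrix}0&I_{n_{v_i}}\\ \frac1{\lambda_i}(\mu_iI+S_i^\top)&0\end{bmatrix},\qquad A_{1,i}=\begin{bmatrix}0&0\\ \frac1{\lambda_i}I_{n_{v_i}}&0\end{bmatrix}.$$
   Context: $\mathbb R^+_{t_0}=\{t>t_0\}$, $t_0\ge0$. $G_\alpha(\mathbb R^+_{t_0})$ is the Gevrey class of order $\alpha$: $f\in C^\infty(\mathbb R^+_{t_0})$ such that, for every compact subset $K\subset\mathbb R^+_{t_0}$, there exist positive constants $M,R$ (which may depend on $K$) with $\sup_{t\in K}|f^{(j)}(t)|\le\frac{M}{R^j}(j!)^\alpha$ for all $j\in\mathbb N_0$. A product such as $C([0,1])\times G_\alpha(\mathbb R^+_{t_0})$ denotes functions of $(z,t)$ with the first regularity in $z$ and the second in $t$; $C_p$ means piecewise continuous. Standing assumptions: $\lambda_i>0$ and $c_i\neq0$ are real constants; $a_i\in C([0,1])\times G_\alpha(\mathbb R^+_{t_0})$ and $q_i\in G_\alpha(\mathbb R^+_{t_0})$ with $1\le\alpha<2$; $\tilde g_{k,i}^\top=g_{k,i}^\top P_i$ with $P_i\in\mathbb R^{m_i\times n_{v_i}}$,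 $g_{1,i}\in(C_p([0,1])\times G_\alpha(\mathbb R^+_{t_0}))^{m_i}$ and $g_{k,i}\in(G_\alpha(\mathbb R^+_{t_0}))^{m_i}$, $k=2,4$; $(P_i,S_i)$ is observable and $S_i\in\mathbb R^{n_{v_i}\times n_{v_i}}$ is diagonalizable with $\sigma(S_i)\subset j\mathbb R$. The kernel $k_i(z,\zeta,t)$ is the strong solution, which is in $G_\alpha(\mathbb R^+_{t_0})$ w.r.t. $t$, of the following equations on $\{0<\zeta<z<1\}\times\mathbb R^+_{t_0}$: $k_{i,t}=\lambda_ik_{i,zz}-\lambda_ik_{i,\zeta\zeta}-(a_i(\zeta,t)+\mu_i)k_i$, $k_{i,\zeta}(z,0,t)=q_i(t)k_i(z,0,t)$, $k_i(z,z,t)=q_i(t)-\int_0^z\frac{a_i(\zeta,t)+\mu_i}{2\lambda_i}d\zeta$. *)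

(* Defs.v *)
From HB Require Import structures.
From mathcomp Require Import all_boot all_order all_algebra.
From mathcomp Require Import all_classical all_reals all_analysis.
From mathcomp Require Import complex.
Set Implicit Arguments.
Unset Strict Implicit.
Unset Printing Implicit Defensive.
Import Order.TTheory GRing.Theory Num.Theory.
Import numFieldTopology.Exports numFieldNormedType.Exports.
Local Open Scope ring_scope.
Local Open Scope classical_set_scope.

Section Regularity.
Context {R : realType}.
Implicit Types (alpha M r : R) (K : set R).

Definition smooth_after (t0 : R) (f : R -> R) : Prop :=
  forall (j : nat) (t : R), t0 < t -> derivable (derive1n j f) t 1.

Definition gevrey_bound alpha K M r (f : R -> R) : Prop :=
  forall (j : nat) (t : R), K t ->
    `|derive1n j f t| <= M / r ^+ j * (j`!%:R `^ alpha).

Definition gevrey alpha (t0 : R) (f : R -> R) : Prop :=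
  smooth_after t0 f /\
  forall K, compact K -> K `<=` [set t | t0 < t] ->
    exists M r, [/\ 0 < M, 0 < r & gevrey_bound alpha K M r f].

(* Gevrey dependence on time of a function that also depends on a space
   variable x in D: as for a Gevrey function with values in a space of functions
   on D with the sup norm, the constants M and r depend on K but not on x. *)
Definition gevrey_on {X : Type} (D : set X) alpha (t0 : R) (F : X -> R -> R) : Prop :=
  (forall x, D x -> smooth_after t0 (F x)) /\
  forall K, compact K -> K `<=` [set t | t0 < t] ->
    exists M r, [/\ 0 < M, 0 < r &
      forall x, D x -> gevrey_bound alpha K M r (F x)].

(* Piecewise continuity on [0, 1]; the value of f at a point of discontinuity is
   arbitrary, only the one-sided limits are required to exist. *)
Definition piecewise_continuous01 {V : topologicalType} (f : R -> V) : Prop :=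
  [/\ exists s : seq R, forall z : R, 0 < z < 1 -> z \notin s ->
        {for z, continuous f},
      forall z : R, 0 <= z < 1 -> exists l : V, f x @[x --> z^'+] --> l &
      forall z : R, 0 < z <= 1 -> exists l : V, f x @[x --> z^'-] --> l].

Definition C_gevrey alpha (t0 : R) (F : R -> R -> R) : Prop :=
  (forall t : R, t0 < t -> {within `[0, 1], continuous (F^~ t)}) /\
  gevrey_on `[0, 1] alpha t0 F.

Definition Cp_gevrey alpha (t0 : R) (F : R -> R -> R) : Prop :=
  (forall t : R, t0 < t -> piecewise_continuous01 (F^~ t)) /\
  gevrey_on `[0, 1] alpha t0 F.

(* Derivative of f at x relative to D (one-sided at an end point of an
   interval D). *)
Definition quotient_within {V : normedModType R} (D : set R) (f : R -> V)
    (x : R) : set_system V :=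
  (h^-1 *: (f (x + h) - f x)) @[h --> within [set h | D (x + h)] 0^'].

Definition derivable_within {V : normedModType R} (D : set R) (f : R -> V)
  (x : R) : Prop := cvg (quotient_within D f x).

Definition derive_within {V : normedModType R} (D : set R) (f : R -> V)
  (x : R) : V := lim (quotient_within D f x).

Fixpoint differentiable_n (n : nat) (psi : R * R -> R) : Prop :=
  continuous psi /\
  if n is n'.+1 then
    (forall p v, derivable psi p v) /\
    forall v, differentiable_n n' ('D_v psi)
  else True.

Definition test_function (Omega : set (R * R)) (psi : R * R -> R) : Prop :=
  (forall n, differentiable_n n psi) /\
  exists K : set (R * R),
    [/\ compact K, K `<=` Omega & forall p, ~ K p -> psi p = 0].

End Regularity.

Section Kernel.
Context {R : realType}.

Definition triangle : set (R * R) := [set p | 0 < p.2 /\ p.2 < p.1 /\ p.1 < 1].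
Definition closed_triangle : set (R * R) :=
  [set p | 0 <= p.2 /\ p.2 <= p.1 /\ p.1 <= 1].

(* The kernel equations
     k_t = lam k_zz - lam k_zeta,zeta - (a(zeta, t) + mu) k,
     k_zeta(z, 0, t) = q(t) k(z, 0, t),
     k(z, z, t) = q(t) - int_0^z (a + mu) / (2 lam),
   for k continuous on the closed triangle and Gevrey in t. Since a is merely
   continuous in zeta, k_zz and k_zeta,zeta need not exist pointwise; these two
   terms are read as generalized derivatives, i.e. they are moved to a test
   function psi. Every solution that has k_zz and k_zeta,zeta as continuous or
   as locally integrable weak derivatives is a solution in this sense. *)
Definition kernel_solution (t0 alpha lam mu : R) (a : R -> R -> R) (q : R -> R)
    (k : R -> R -> R -> R) : Prop :=
  [/\ (forall t : R, t0 < t ->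
         {within closed_triangle, continuous (fun p => k p.1 p.2 t)}),
      gevrey_on closed_triangle alpha t0 (fun p => k p.1 p.2),
      (forall (t : R) (psi : R * R -> R), t0 < t -> test_function triangle psi ->
         \int[(@lebesgue_measure R \x @lebesgue_measure R)%E]_(p in triangle)
            (k p.1 p.2 t *
             (lam * ('D_(1, 0) ('D_(1, 0) psi)) p
              - lam * ('D_(0, 1) ('D_(0, 1) psi)) p))
         = \int[(@lebesgue_measure R \x @lebesgue_measure R)%E]_(p in triangle)
            ((derive1 (k p.1 p.2) t + (a p.2 t + mu) * k p.1 p.2 t) * psi p)),
      (forall z t : R, 0 < z < 1 -> t0 < t ->
         derivable_within `[0, z] (fun zeta => k z zeta t) 0 /\
         derive_within `[0, z] (fun zeta => k z zeta t) 0 = q t * k z 0 t) &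
      (forall z t : R, 0 < z < 1 -> t0 < t ->
         k z z t = q t -
           \int[lebesgue_measure]_(zeta in `[0, z])
              ((a zeta t + mu) / (2 * lam)))].

End Kernel.

Section Matrices.
Context {R : realType}.

Definition observable (m n : nat) (P : 'M[R]_(m, n)) (S : 'M[R]_n) : Prop :=
  \rank (\mxcol_(k < n) (P *m S ^+ k)) = n.

Definition complex_diagonalizable (n : nat) (S : 'M[R]_n) : Prop :=
  diagonalizable (map_mx (real_complex R) S).

Definition imaginary_spectrum (n : nat) (S : 'M[R]_n) : Prop :=
  forall w : R[i], eigenvalue (map_mx (real_complex R) S) w -> complex.Re w = 0.

Definition expmx (n : nat) (A : 'M[R]_n) : 'M[R]_n :=
  limn (series (fun k : nat => (k`!%:R)^-1 *: A ^+ k)).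

Definition mxint (m n : nat) (a b : R) (F : R -> 'M[R]_(m, n)) : 'M[R]_(m, n) :=
  \matrix_(i, j) \int[lebesgue_measure]_(x in `[a, b]) F x i j.

End Matrices.

Section Regulator.
Context {R : realType}.
Variables (m n : nat).

Definition gtilde (P : 'M[R]_(m, n)) (g : 'cV[R]_m) : 'cV[R]_n := (g^T *m P)^T.

Definition h1 (lam : R) (k : R -> R -> R -> R) (P : 'M[R]_(m, n))
    (g1 : R -> R -> 'cV[R]_m) (g2 : R -> 'cV[R]_m) (z t : R) : 'cV[R]_n :=
  (k z 0 t * lam) *: gtilde P (g2 t) + gtilde P (g1 z t)
  - mxint 0 z (fun zeta => k z zeta t *: gtilde P (g1 zeta t)).

(* Strong solution phi(z, t) of
     phi_t^T = lam phi_zz^T - mu phi^T - phi^T S + h^T,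
     phi_z^T(0, t) = gt2^T(t),   c phi^T(0, t) = - gt4^T(t).
   phi_z is one-sided at z = 0 and z = 1. As h(., t) may jump, phi_zz(., t) is
   piecewise continuous, and the equation holds at every z in (0, 1) at which
   h(., t) is continuous. *)
Definition strong_solution (t0 lam mu c : R) (S : 'M[R]_n)
    (h : R -> R -> 'cV[R]_n) (gt2 gt4 : R -> 'cV[R]_n)
    (phi : R -> R -> 'cV[R]_n) : Prop :=
  let phi_z z t := derive_within `[0, 1] (phi^~ t) z in
  let phi_zz z t := derive1 (phi_z^~ t) z in
  let phi_t z t := derive1 (phi z) t in
  let dom : set (R * R) := `[0, 1] `*` [set t | t0 < t] in
  [/\ (forall z t : R, 0 <= z <= 1 -> t0 < t ->
         derivable_within `[0, 1] (phi^~ t) z /\ derivable (phi z) t 1),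
      [/\ {within dom, continuous (fun p => phi p.1 p.2)},
          {within dom, continuous (fun p => phi_z p.1 p.2)} &
          {within dom, continuous (fun p => phi_t p.1 p.2)}],
      (forall t : R, t0 < t -> piecewise_continuous01 (phi_zz^~ t)),
      (forall z t : R, 0 < z < 1 -> t0 < t -> {for z, continuous (h^~ t)} ->
         derivable (phi_z^~ t) z 1 /\
         (phi_t z t)^T = lam *: (phi_zz z t)^T - mu *: (phi z t)^T
                         - (phi z t)^T *m S + (h z t)^T) &
      (forall t : R, t0 < t ->
         (phi_z 0 t)^T = (gt2 t)^T /\ c *: (phi 0 t)^T = - (gt4 t)^T)].

Definition A0 (lam mu : R) (S : 'M[R]_n) : 'M[R]_(n + n) :=
  block_mx 0 1%:M (lam^-1 *: (mu%:M + S^T)) 0.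

Definition A1 (lam : R) : 'M[R]_(n + n) :=
  block_mx 0 0 (lam^-1 *: 1%:M) 0.

Fixpoint phi_col (lam mu : R) (S : 'M[R]_n) (k : 'I_(n + n)) (j : nat) (z : R) :
    'cV[R]_(n + n) :=
  if j is j'.+1 then
    mxint 0 z (fun zeta =>
      expmx ((z - zeta) *: A0 lam mu S) *m A1 lam *m phi_col lam mu S k j' zeta)
  else expmx (z *: A0 lam mu S) *m delta_mx k 0.

Definition Phi (lam mu : R) (S : 'M[R]_n) (j : nat) (z : R) : 'M[R]_(n + n) :=
  \matrix_(a, k) phi_col lam mu S k j z a 0.

Definition boundary_term (lam mu c : R) (S : 'M[R]_n) (gt2 gt4 : R -> 'cV[R]_n)
    (z t : R) (j : nat) : 'cV[R]_(n + n) :=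
  Phi lam mu S j z *m derive1n j (fun s => col_mx (- c^-1 *: gt4 s) (gt2 s)) t.

Definition source_term (lam mu : R) (S : 'M[R]_n) (h : R -> R -> 'cV[R]_n)
    (z t zeta : R) (j : nat) : 'cV[R]_(n + n) :=
  Phi lam mu S j zeta *m (row_mx 0 1%:M)^T *m derive1n j (h (z - zeta)) t.

Definition phi_formula (lam mu c : R) (S : 'M[R]_n) (h : R -> R -> 'cV[R]_n)
    (gt2 gt4 : R -> 'cV[R]_n) (z t : R) : 'cV[R]_n :=
  row_mx 1%:M 0 *m
    (limn (series (boundary_term lam mu c S gt2 gt4 z t))
     - lam^-1 *: mxint 0 z (fun zeta =>
         limn (series (source_term lam mu S h z t zeta)))).

(* The time derivatives, the two series and the integral in phi_formula exist:
   limn, derive1n and the Lebesgue integral have default values otherwise. *)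
Definition phi_formula_defined (t0 lam mu c : R) (S : 'M[R]_n)
    (h : R -> R -> 'cV[R]_n) (gt2 gt4 : R -> 'cV[R]_n) : Prop :=
  forall z t : R, 0 <= z <= 1 -> t0 < t ->
  [/\ (forall j, derivable (derive1n j (h z)) t 1),
      (forall j, derivable
         (derive1n j (fun s => col_mx (- c^-1 *: gt4 s) (gt2 s))) t 1),
      cvgn (series (boundary_term lam mu c S gt2 gt4 z t)),
      (forall zeta : R, 0 <= zeta <= z ->
         cvgn (series (source_term lam mu S h z t zeta))) &
      forall i : 'I_(n + n), (@lebesgue_measure R).-integrable `[0, z]
        (fun zeta =>
           (limn (series (source_term lam mu S h z t zeta)) i 0)%:E)].

End Regulator.

(* Main.v *)
Require Import Defs.
From HB Require Import structures.
From mathcomp Require Import all_boot all_order all_algebra.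
From mathcomp Require Import all_classical all_reals all_analysis.
From mathcomp Require Import measurable_realfun zify ring lra.
Import Order.TTheory GRing.Theory Num.Theory.
Import numFieldTopology.Exports numFieldNormedType.Exports.
Local Open Scope ring_scope.
Local Open Scope classical_set_scope.

(* The recursion for Phi_j is the Duhamel expansion of exp (z (A0 + s A1)) in
   powers of s, so that Phi_j(z) is the sum over m of C_(m,j) z^m / m!, where
   C_(m,j) is the coefficient of s^j in (A0 + s A1)^m, and
   Phi_j' = A0 Phi_j + A1 Phi_(j-1). By the block structure C_(m,j) = 0 for
   m < 2 j - 1, hence Phi_j = O(X^j / (j!)^2) on [0, 1]. Against the bound
   M r^j (j!)^alpha on the j-th time derivative of the data this is summable
   since alpha < 2, and Y = sum_j Phi_j(z) d_t^j f satisfies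
   Y_z = A0 Y + A1 Y_t, which is the regulator equation written as a first-order
   system. The source enters through the convolution of such series over [0, z].
   All derivatives of series and integrals are obtained from remainder estimates
   |F(y) - F(x) - (y - x) F'(x)| <= C (y - x)^2, which pass to sums and integrals
   and hence require only measurability of the source in z. *)

Set Implicit Arguments.
Unset Strict Implicit.

(** * Quadratic remainders and numerical series *)

Section Remainders.
Context {R : realType}.
Implicit Types (f g : R -> R) (x y d C : R).

(** Three obstacles shape the proof. Iterated time derivatives of products, integrals and
    matrix-valued maps are hard to compute as such; so each function travels with an explicit family
    of candidates for its derivatives and a Gevrey bound, and the family is matched with [derive1n]
    afterwards. The data may jump in z: the stated formula evaluates the source at z - zeta, so that
    moving z would move the jumps through the domain of integration. After the reflection zeta -> z
    - zeta the source sits at a fixed point x, and z enters only through the analytic factor Phi_j(z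
    - x) and the upper limit; the latter contributes the integral of h over [z, z'], which is where
    continuity of h at z enters. Finally, derivatives in z are one-sided at 0 and 1: estimates that
    compare any two points of [0, 1] treat inner points and end points alike. *)

Lemma is_derive1_cvg f x d :
  h^-1 *: (f (h + x) - f x) @[h --> 0^'] --> d -> is_derive x 1 f d.
Proof.
move=> hd; have F : f^`() x = d by apply: cvg_lim hd.
have Df : derivable f x 1.
  move: hd; rewrite /derivable [X in X @ 0^'](_ : _ =
      (fun h => h^-1 *: (f (h%:A + x) - f x))) /=; last first.
    by apply/funext => i //=; rewrite [i%:A]mulr1.
  by move=> /(cvg_lim _) -> //.
by constructor; [exact: Df|rewrite -derive1E].
Qed.

Lemma is_derive_quad f x d C (e : R) : 0 < e ->
  (forall y, `|y - x| < e -> `|f y - f x - (y - x) * d| <= C * (y - x) ^+ 2) ->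
  is_derive x 1 f d.
Proof.
move=> e0 H; apply: is_derive1_cvg.
apply/cvgrPdist_le => /= eps eps0; near=> h.
have h0 : h != 0 by near: h; exact: nbhs_dnbhs_neq.
have he : `|h| < e.
  near: h; apply: dnbhs0_lt => //.
have := H (h + x); rewrite addrK => /(_ he) H1.
have hp : 0 < `|h| by rewrite normr_gt0.
rewrite -(ler_pM2l hp) -normrM mulrBr /GRing.scale/= mulVKf// distrC mulrC.
rewrite [h * d]mulrC in H1.
apply: (le_trans H1); rewrite -real_normK ?num_real// expr2 mulrA mulrC ler_pM2l//.
(* No sign of [C] is assumed; [|C| + 1] is positive and can be divided by. *)
apply: (@le_trans _ _ ((`|C| + 1) * `|h|)).
  by rewrite ler_wpM2r// (le_trans (ler_norm _))// lerDl.
rewrite -ler_pdivlMl ?ltr_wpDl//; near: h; apply: dnbhs0_le.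
by rewrite mulr_gt0// invr_gt0 ltr_wpDl.
Unshelve. all: by end_near. Qed.

Lemma is_derive_lipschitz f g (a b C : R) :
  (forall x, a <= x <= b -> is_derive x 1 f (g x)) ->
  (forall x, a <= x <= b -> `|g x| <= C) ->
  forall x y, a <= x <= b -> a <= y <= b -> `|f y - f x| <= C * `|y - x|.
Proof.
move=> df gC.
have key x y : x <= y -> a <= x <= b -> a <= y <= b -> `|f y - f x| <= C * `|y - x|.
  move=> xy /andP[ax xb] /andP[ay yb].
  have xyab z : z \in `[x, y]%R -> a <= z <= b.
    by rewrite in_itv/= => /andP[xz zy]; rewrite (le_trans ax)//= (le_trans zy).
  have cf : {within `[x, y], continuous f}.
    by apply: derivable_within_continuous => z /xyab /df [].
  have [|c cxy ->] := @MVT_segment _ f g x y xy _ cf.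
    by move=> z zxy; apply: df; apply: xyab; apply: subset_itv_oo_cc zxy.
  by rewrite normrM ler_wpM2r// gC// xyab.
move=> x y hx hy; have [xy|/ltW yx] := leP x y; first exact: key.
by rewrite distrC (distrC y); exact: key.
Qed.

(** By the mean value theorem the remainder is (g c - g x) (y - x) with c between x and y, so a
    Lipschitz bound on the derivative is enough. *)
Lemma is_derive_quad_remainder f g (a b C : R) : 0 <= C ->
  (forall x, a <= x <= b -> is_derive x 1 f (g x)) ->
  (forall x y, a <= x <= b -> a <= y <= b -> `|g y - g x| <= C * `|y - x|) ->
  forall x y, a <= x <= b -> a <= y <= b ->
    `|f y - f x - (y - x) * g x| <= C * (y - x) ^+ 2.
Proof.
move=> C0 df gC.
have mvt x y : x <= y -> a <= x <= b -> a <= y <= b ->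
    exists c, [/\ x <= c <= y, a <= c <= b & f y - f x = g c * (y - x)].
  move=> xy /andP[ax xb] /andP[ay yb].
  have xyab z : z \in `[x, y]%R -> a <= z <= b.
    by rewrite in_itv/= => /andP[xz zy]; rewrite (le_trans ax)//= (le_trans zy).
  have cf : {within `[x, y], continuous f}.
    by apply: derivable_within_continuous => z /xyab /df [].
  have [|c cxy E] := @MVT_segment _ f g x y xy _ cf.
    by move=> z zxy; apply: df; apply: xyab; apply: subset_itv_oo_cc zxy.
  by exists c; split => //; exact: xyab.
move=> x y hx hy.
suff [c [cx hc E]] : exists c, [/\ `|c - x| <= `|y - x|, a <= c <= b &
    f y - f x = g c * (y - x)].
  rewrite {}E [_ * g x]mulrC -mulrBl normrM -real_normK ?num_real// expr2 mulrA.
  by rewrite ler_wpM2r// (le_trans (gC _ _ hx hc))// ler_wpM2l.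
have [xy|/ltW yx] := leP x y.
  have [e [/andP[xc cy] hc E]] := mvt _ _ xy hx hy.
  by exists e; split => //; rewrite !ger0_norm ?subr_ge0// lerD2r.
have [e [/andP[xc cy] hc E]] := mvt _ _ yx hy hx.
exists e; split => //; first by rewrite !ler0_norm ?subr_le0// lerN2 lerD2r.
by rewrite -opprB E -mulrN opprB.
Qed.

End Remainders.

Notation sums u := (limn (series u)).

Section Series.
Context {R : realType}.
Implicit Types u v w b c : nat -> R.

Lemma series_dominated u b : (forall n, `|u n| <= b n) -> cvgn (series b) ->
  cvgn (series u) /\ `|sums u| <= sums b.
Proof.
move=> ub cb.
have cn : cvgn [normed series u].
  apply: (series_le_cvg _ _ ub cb) => n //.
  exact: le_trans (normr_ge0 _) (ub n).
split; first exact: normed_cvg.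
exact: (le_trans (lim_series_norm cn)) (lim_series_le cn cb ub).
Qed.

Lemma cvg_series_sum (I : Type) (r : seq I) (u : I -> nat -> R) :
  (forall i, cvgn (series (u i))) ->
  cvgn (series (fun n => \sum_(i <- r) u i n)) /\
  sums (fun n => \sum_(i <- r) u i n) = \sum_(i <- r) sums (u i).
Proof.
move=> cu.
suff h : series (fun n => \sum_(i <- r) u i n) @ \oo --> \sum_(i <- r) sums (u i).
  by split; [apply/cvg_ex; eexists; exact: h | exact: cvg_lim h].
rewrite [X in X @ _ --> _](_ : _ = \sum_(i <- r) series (u i)); last first.
  by apply/funext => n; rewrite fct_sumE /series/= exchange_big.
elim: r => [|i r IH]; first by rewrite !big_nil; exact: cvg_cst.
by rewrite !big_cons; apply: cvgD => //; exact: cu.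
Qed.

Lemma cvg_series_lin (x y : R) u v : cvgn (series u) -> cvgn (series v) ->
  cvgn (series (fun n => x * u n + y * v n)) /\
  sums (fun n => x * u n + y * v n) = x * sums u + y * sums v.
Proof.
move=> cu cv.
have -> : (fun n => x * u n + y * v n) = (x *: u + y *: v) by apply/funext.
have cx := @is_cvg_seriesZ R u x cu; have cy := @is_cvg_seriesZ R v y cv.
split; first exact: (@is_cvg_seriesD R).
by rewrite (@lim_seriesD R)// !(@lim_seriesZ R).
Qed.

(** Serves the terms with Phi_(j-1), which vanish for j = 0: the shift trades the lower index for
    one more time derivative. *)
Lemma series_shift1 u : u 0%N = 0 -> cvgn (series (fun n => u n.+1)) ->
  cvgn (series u) /\ sums u = sums (fun n => u n.+1).
Proof.
move=> u0 cu.
suff h : series u @ \oo --> sums (fun n => u n.+1).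
  by split; [apply/cvg_ex; eexists; exact: h | exact: cvg_lim h].
rewrite -cvg_shiftS/= (_ : (fun n => _) = series (fun n => u n.+1))//.
by apply/funext => n; rewrite /series/= big_nat_recl// u0 add0r.
Qed.

Lemma series_quad u v w c (h : R) :
  cvgn (series u) -> cvgn (series v) -> cvgn (series w) -> cvgn (series c) ->
  (forall n, `|u n - v n - h * w n| <= c n * h ^+ 2) ->
  `|sums u - sums v - h * sums w| <= sums c * h ^+ 2.
Proof.
move=> cu cv cw cc H.
have [c1 s1] := cvg_series_lin 1 (-1) cu cv.
have [c2 s2] := cvg_series_lin 1 (- h) c1 cw.
have [c3 s3] := cvg_series_lin (h ^+ 2) 0 cc cc.
rewrite s1 in s2; rewrite mul0r addr0 mulrC in s3; rewrite -s3.
have D n : `|1 * (1 * u n + -1 * v n) + - h * w n| <= h ^+ 2 * c n + 0 * c n.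
  by rewrite !mul1r mulN1r mulNr (le_trans (H n))// mul0r addr0 mulrC.
by have [_] := series_dominated D c3; rewrite s2 !mul1r mulN1r mulNr.
Qed.

End Series.

(** * Integrals of bounded measurable functions *)

Section Integral.
Context {R : realType}.
Notation mu := (@lebesgue_measure R).
Implicit Types (f g k : R -> R) (a b c z : R).

(** A class stable under sums and products and integrable on segments, wide enough for a source that
    jumps. *)
Definition bounded_measurable a b f : Prop :=
  measurable_fun `[a, b] f /\
  exists C : R, forall x, a <= x <= b -> `|f x| <= C.

Lemma bounded_measurable_sub a b c z f : c <= a -> b <= z ->
  bounded_measurable c z f -> bounded_measurable a b f.
Proof.
move=> ca bz [mf [C fC]]; split.
  apply: (measurable_funS _ _ mf) => //.
  by apply: subset_itv; rewrite bnd_simp.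
by exists C => x /andP[ax xb]; apply: fC; rewrite (le_trans ca)//= (le_trans xb).
Qed.

Lemma bounded_measurable_lin (x y : R) a b f g :
  bounded_measurable a b f -> bounded_measurable a b g ->
  bounded_measurable a b (fun t => x * f t + y * g t).
Proof.
move=> [mf [C fC]] [mg [D gD]]; split.
  by apply: measurable_funD; apply: measurable_funM => //.
exists (`|x| * C + `|y| * D) => t ht.
by rewrite (le_trans (ler_normD _ _))// !normrM lerD// ler_wpM2l// ?fC ?gD.
Qed.

Lemma bounded_measurable_sum (I : Type) (r : seq I) a b (f : I -> R -> R) :
  (forall i, bounded_measurable a b (f i)) ->
  bounded_measurable a b (fun t => \sum_(i <- r) f i t).
Proof.
move=> H; elim: r => [|i r IH].
  have -> : (fun t => \sum_(i <- [::]) f i t) = (fun=> 0).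
    by apply/funext => t; rewrite big_nil.
  by split => //; exists 0 => x _; rewrite normr0.
have -> : (fun t => \sum_(i <- i :: r) f i t) =
    (fun t => 1 * f i t + 1 * \sum_(i <- r) f i t).
  by apply/funext => t; rewrite big_cons !mul1r.
exact: bounded_measurable_lin.
Qed.

Lemma bounded_measurableM a b f g :
  bounded_measurable a b f -> bounded_measurable a b g ->
  bounded_measurable a b (fun t => f t * g t).
Proof.
move=> [mf [C fC]] [mg [D gD]]; split; first exact: measurable_funM.
by exists (C * D) => t ht; rewrite normrM ler_pM// ?fC ?gD.
Qed.

Lemma bounded_measurable_integrable a b f : bounded_measurable a b f ->
  mu.-integrable `[a, b] (EFin \o f).
Proof.
move=> [mf [C fC]]; apply: measurable_bounded_integrable => //.
  rewrite /= lebesgue_measure_itv/=.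
  by case: ifP; rewrite ?ltry// -EFinB ltry.
exists C; split; first exact: num_real.
by move=> M CM x /= hx; rewrite (le_trans (fC x _) (ltW CM)).
Qed.

Lemma Rintegral_lin (x y : R) a b f g :
  bounded_measurable a b f -> bounded_measurable a b g ->
  \int[mu]_(t in `[a, b]) (x * f t + y * g t) =
  x * \int[mu]_(t in `[a, b]) f t + y * \int[mu]_(t in `[a, b]) g t.
Proof.
move=> hf hg.
have lin0 (u : R) h : bounded_measurable a b h ->
    mu.-integrable `[a, b] (EFin \o (fun t => u * h t)).
  move=> hh; have := bounded_measurable_integrable (bounded_measurable_lin u 0 hh hh).
  by congr integrable; apply/funext => t /=; rewrite mul0r addr0.
rewrite RintegralD//; [|exact: lin0..].
by rewrite !RintegralZl//; exact: bounded_measurable_integrable.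
Qed.

Lemma Rintegral_sum (I : Type) (r : seq I) a b (f : I -> R -> R) :
  (forall i, bounded_measurable a b (f i)) ->
  \int[mu]_(t in `[a, b]) (\sum_(i <- r) f i t) =
  \sum_(i <- r) \int[mu]_(t in `[a, b]) f i t.
Proof.
move=> H; elim: r => [|i r IH].
  rewrite big_nil; under eq_Rintegral do rewrite big_nil.
  by rewrite Rintegral_cst// mul0r.
under eq_Rintegral do rewrite big_cons -[f i _]mul1r -[X in _ + X]mul1r.
rewrite Rintegral_lin//; last exact: bounded_measurable_sum.
by rewrite !mul1r IH big_cons.
Qed.

Lemma Rintegral_bound a b f (C : R) : a <= b -> measurable_fun `[a, b] f ->
  (forall x, a <= x <= b -> `|f x| <= C) ->
  `|\int[mu]_(t in `[a, b]) f t| <= C * (b - a).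
Proof.
move=> ab mf fC.
have hf : bounded_measurable a b f by split => //; exists C.
have hc : bounded_measurable a b (fun=> C) by split => //; exists `|C|.
have hn : bounded_measurable a b (fun x => `|f x|).
  split; first exact: measurableT_comp.
  by exists C => x hx; rewrite normr_id fC.
apply: (le_trans (le_normr_Rintegral _ (bounded_measurable_integrable hf))) => //.
have -> : C * (b - a) = \int[mu]_(t in `[a, b]) C.
  rewrite Rintegral_cst//= lebesgue_measure_itv/= lte_fin.
  by case: ltgtP ab => //= -> _; rewrite subrr.
apply: (le_Rintegral _ (bounded_measurable_integrable hn)
  (bounded_measurable_integrable hc)) => //.
Qed.

Lemma Rintegral_dist (a b : R) (f g : R -> R) (C : R) : a <= b ->
  bounded_measurable a b f -> bounded_measurable a b g ->
  (forall x, a <= x <= b -> `|f x - g x| <= C) ->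
  `|\int[mu]_(t in `[a, b]) f t - \int[mu]_(t in `[a, b]) g t| <= C * (b - a).
Proof.
move=> ab hf hg H; have := Rintegral_lin 1 (-1) hf hg.
rewrite mul1r mulN1r => <-; apply: Rintegral_bound => //.
  by case: (bounded_measurable_lin 1 (-1) hf hg).
by move=> x hx; rewrite mul1r mulN1r; exact: H.
Qed.

(** Differentiation under the integral sign in quantitative form; a remainder bound uniform in x
    takes the place of dominated convergence. *)
Lemma Rintegral_quad a b f g k (h C : R) : a <= b ->
  bounded_measurable a b f -> bounded_measurable a b g -> bounded_measurable a b k ->
  (forall x, a <= x <= b -> `|f x - g x - h * k x| <= C) ->
  `|\int[mu]_(t in `[a, b]) f t - \int[mu]_(t in `[a, b]) g t -
     h * \int[mu]_(t in `[a, b]) k t| <= C * (b - a).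
Proof.
move=> ab hf hg hk H.
have hfg := bounded_measurable_lin 1 (-1) hf hg.
have hfgk := bounded_measurable_lin 1 (- h) hfg hk.
have := Rintegral_lin 1 (- h) hfg hk.
rewrite (Rintegral_lin 1 (-1) hf hg) !mul1r mulN1r mulNr => <-.
apply: Rintegral_bound => //; first by case: hfgk.
by move=> x hx; rewrite !mul1r mulN1r mulNr H.
Qed.

Lemma Rintegral_cat a b c f : a <= b -> b <= c -> bounded_measurable a c f ->
  \int[mu]_(t in `[a, c]) f t =
  \int[mu]_(t in `[a, b]) f t + \int[mu]_(t in `[b, c]) f t.
Proof.
move=> ab bc hf; have ic := bounded_measurable_integrable hf.
have := @Rintegral_itvB R f (BLeft a) (BRight c) b ic.
rewrite !bnd_simp => /(_ ab bc); rewrite Rintegral_itv_obnd_cbnd; last first.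
  by apply: integrableS ic => //; apply: subset_itv; rewrite bnd_simp.
by move=> <-; ring.
Qed.

(** Lebesgue measure is determined by its values on the intervals ]a, b]; their reflections are
    half-open on the other side but have the same length. *)
Lemma lebesgue_measure_reflect z (A : set R) : measurable A ->
  pushforward mu (fun x => z - x : measurableTypeR R) A = mu A.
Proof.
have mr : measurable_fun [set: R] (fun x => z - x : measurableTypeR R).
  exact: measurable_funB.
have refl (a b x : R) : (a < z - x <= b) = (z - b <= x < z - a).
  by apply/andP/andP => -[h1 h2]; split; lra.
move=> mA; apply/esym/lebesgue_measure_unique => //= _ [[a b]] _ <-.
rewrite /pushforward [X in _ = _ X](_ : _ = `[z - b, z - a[%classic); last first.
  by apply/seteqP; split => x; rewrite /= !in_itv/=; have := refl a b x => ->.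
rewrite !lebesgue_measure_itv/= !lte_fin ltrD2l ltrN2.
by case: ifP => // _; rewrite -!EFinB; congr (_%:E); ring.
Qed.

Lemma Rintegral_reflect z f : bounded_measurable 0 z f ->
  \int[mu]_(t in `[0, z]) f (z - t) = \int[mu]_(t in `[0, z]) f t.
Proof.
move=> hf; have [mf _] := hf.
have mr : measurable_fun [set: R] (fun x => z - x : measurableTypeR R).
  exact: measurable_funB.
(* [f] is measurable on [0, z] only; its extension by zero can be composed with the reflection of
   the whole line. *)
pose g := f \_ `[0, z].
have mg : measurable_fun [set: R] g by apply/(measurable_restrictT _ _).1.
have gE t : 0 <= t <= z -> g t = f t.
  by move=> ht; rewrite /g patchE mem_set//= in_itv.
have pre : (fun x => z - x : measurableTypeR R) @^-1` `[0, z] = `[0, z]%classic.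
  by apply/seteqP; split => x /=; rewrite !in_itv/= => /andP[h1 h2]; apply/andP; split; lra.
have hr t : 0 <= t <= z -> 0 <= z - t <= z by move=> /andP[h1 h2]; lra.
have hg : bounded_measurable 0 z (fun t => g (z - t)).
  split; first by apply: measurable_funTS; exact: measurableT_comp mg mr.
  by have [_ [C fC]] := hf; exists C => t ht; rewrite gE ?fC//; exact: hr.
rewrite /Rintegral; congr fine.
transitivity (\int[mu]_(t in (fun x : R => (z - x)%R : measurableTypeR R) @^-1` `[0%R, z])
    ((EFin \o g) \o (fun x : R => (z - x)%R : measurableTypeR R)) t)%E.
  rewrite pre; apply: eq_integral => t /set_mem/=; rewrite in_itv/= => ht.
  by rewrite gE// hr.
rewrite -integral_pushforward//; last 2 first.
- exact/measurable_EFinP.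
- by rewrite pre; exact: bounded_measurable_integrable hg.
transitivity (\int[mu]_(t in `[0%R, z]) ((EFin \o g) t))%E.
  by apply: eq_measure_integral => A mA _; exact: lebesgue_measure_reflect.
by apply: eq_integral => t /set_mem/=; rewrite in_itv/= => ht; rewrite gE.
Qed.

End Integral.

(** * Families that are Gevrey in time *)

Section IsDerive.
Context {R : realType}.
Implicit Types (f g : R -> R) (t a b : R).

Lemma is_derive1M f g t a b : is_derive t 1 f a -> is_derive t 1 g b ->
  is_derive t 1 (fun x => f x * g x) (a * g t + f t * b).
Proof.
move=> hf hg; apply: (is_derive_eq (is_deriveM hf hg)).
by rewrite /GRing.scale/= addrC mulrC.
Qed.

Lemma is_derive1_lin (x y : R) f g t a b : is_derive t 1 f a -> is_derive t 1 g b ->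
  is_derive t 1 (fun s => x * f s + y * g s) (x * a + y * b).
Proof.
by move=> hf hg; exact: (is_deriveD (is_deriveZ x hf) (is_deriveZ y hg)).
Qed.

Lemma is_derive1_sum n (f : 'I_n -> R -> R) t (a : 'I_n -> R) :
  (forall i, is_derive t 1 (f i) (a i)) ->
  is_derive t 1 (fun s => \sum_(i < n) f i s) (\sum_(i < n) a i).
Proof. by move=> h; rewrite -fct_sumE; exact: is_derive_sum. Qed.

Lemma is_derive1_mx m n (f : R -> 'M[R]_(m, n)) t (d : 'M[R]_(m, n)) :
  (forall i j, is_derive t 1 (fun s => f s i j) (d i j)) -> is_derive t 1 f d.
Proof.
move=> h; have df : derivable f t 1 by apply/derivable_mxP => i j; case: (h i j).
apply: DeriveDef => //; rewrite derive_mx//.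
by apply/matrixP => i j; rewrite mxE; case: (h i j).
Qed.

(** The half-line t > t0 is open, so equality of [f] and [G 0] there passes to derivatives, whatever
    happens at or before t0. *)
Lemma is_derive1_derive1n {V : normedModType R} (t0 : R) (f : R -> V)
    (G : nat -> R -> V) :
  (forall j t, t0 < t -> is_derive t 1 (G j) (G j.+1 t)) ->
  (forall t, t0 < t -> f t = G 0%N t) ->
  forall j t, t0 < t ->
    derive1n j f t = G j t /\ is_derive t 1 (derive1n j f) (G j.+1 t).
Proof.
move=> dG f0.
have step j : (forall t, t0 < t -> derive1n j f t = G j t) ->
    forall t, t0 < t -> is_derive t 1 (derive1n j f) (G j.+1 t).
  move=> H t ht; apply: (@near_eq_is_derive _ _ _ (G j)); last exact: dG.
  by near=> s; apply/esym/H; near: s; exact: lt_nbhsr.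
elim=> [|j IH]; first by move=> t ht; split; [exact: f0 | exact: step].
have E t : t0 < t -> derive1n j.+1 f t = G j.+1 t.
  by move=> ht; rewrite derive1nS derive1E; case: (step j (fun s hs => (IH s hs).1) t ht).
by move=> t ht; split; [exact: E | exact: step].
Unshelve. all: by end_near. Qed.

End IsDerive.

Section GevreyJets.
Context {R : realType}.
Variables (alpha t0 : R).

(** [G j] stands for the j-th time derivative and is given explicitly, as the Leibniz sum for a
    product or as an integral of derivatives. Here [r] is the reciprocal of the Gevrey radius, and
    [M] and [r] may be 0, so that the zero family needs no special constants. *)
Definition gevrey_jet {X : Type} (D : set X) (G : nat -> X -> R -> R) : Prop :=
  (forall j x t, D x -> t0 < t -> is_derive t 1 (G j x) (G j.+1 x t)) /\
  forall a b, t0 < a -> exists M r, [/\ 0 <= M, 0 <= r &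
    forall j x t, D x -> a <= t <= b -> `|G j x t| <= M * r ^+ j * j`!%:R `^ alpha].

Lemma gevrey_on_jet {X : Type} (D : set X) (F : X -> R -> R) :
  gevrey_on D alpha t0 F -> gevrey_jet D (fun j x => derive1n j (F x)).
Proof.
move=> [sF bF]; split=> [j x t Dx ht|a b ha].
  by apply: DeriveDef; [exact: sF | rewrite -derive1E derive1nS].
have [||M [r [M0 r0 H]]] := bF `[a, b]%classic; first exact: segment_compact.
  by move=> t /=; rewrite in_itv/= => /andP[at_ _]; exact: lt_le_trans at_.
exists M, r^-1; split; [exact: ltW | by rewrite invr_ge0 ltW |].
by move=> j x t Dx ht; rewrite exprVn; exact: H.
Qed.

Lemma gevrey_cst_jet {X : Type} (D : set X) (f : R -> R) :
  gevrey alpha t0 f -> gevrey_jet D (fun j _ => derive1n j f).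
Proof.
move=> [sf bf]; apply: gevrey_on_jet; split=> // K cK Kt.
by have [M [r [M0 r0 H]]] := bf K cK Kt; exists M, r; split.
Qed.

Lemma gevrey_jet_comp {X Y : Type} (D : set X) (E : set Y) (h : Y -> X) G :
  (forall y, E y -> D (h y)) -> gevrey_jet D G ->
  gevrey_jet E (fun j y => G j (h y)).
Proof.
move=> hE [dG bG]; split=> [j y t Ey|a b ha]; first exact/dG/hE.
by have [M [r [M0 r0 H]]] := bG a b ha; exists M, r; split => // j y t Ey; exact/H/hE.
Qed.

Section Fixed.
Context {X : Type} (D : set X).
Implicit Types G H : nat -> X -> R -> R.

Lemma gevrey_jet_bounded G : gevrey_jet D G -> forall a b j, t0 < a ->
  exists C, 0 <= C /\ forall x t, D x -> a <= t <= b -> `|G j x t| <= C.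
Proof.
move=> [_ bG] a b j ha; have [M [r [M0 r0 H]]] := bG a b ha.
exists (M * r ^+ j * j`!%:R `^ alpha); split; last by move=> x t; exact: H.
by rewrite !mulr_ge0 ?exprn_ge0 ?powR_ge0.
Qed.

Lemma gevrey_jet_quad G : gevrey_jet D G -> forall a b j, t0 < a ->
  exists C, 0 <= C /\ forall x t t', D x -> a <= t <= b -> a <= t' <= b ->
    `|G j x t' - G j x t - (t' - t) * G j.+1 x t| <= C * (t' - t) ^+ 2.
Proof.
move=> jG a b j ha; have [C [C0 H]] := gevrey_jet_bounded jG b j.+2 ha.
exists C; split => // x t t' Dx ht ht'.
have dG i s : a <= s <= b -> is_derive s 1 (G i x) (G i.+1 x s).
  by move=> /andP[as_ _]; apply: jG.1 => //; exact: lt_le_trans as_.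
apply: (is_derive_quad_remainder C0 (dG j)) => //.
by apply: (is_derive_lipschitz (dG j.+1)) => s hs; exact: H.
Qed.

Lemma gevrey_jet_lin (x y : R) G H : gevrey_jet D G -> gevrey_jet D H ->
  gevrey_jet D (fun j z t => x * G j z t + y * H j z t).
Proof.
move=> [dG bG] [dH bH]; split=> [j z t Dz ht|a b ha].
  by apply: is_derive1_lin; [exact: dG | exact: dH].
have [M [r [M0 r0 B]]] := bG a b ha; have [M' [r' [M'0 r'0 B']]] := bH a b ha.
exists (`|x| * M + `|y| * M'), (r + r'); split.
- by rewrite addr_ge0// mulr_ge0.
- by rewrite addr_ge0.
move=> j z t Dz ht; rewrite (le_trans (ler_normD _ _))// !normrM.
rewrite [leRHS](_ : _ = `|x| * (M * (r + r') ^+ j * j`!%:R `^ alpha) +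
  `|y| * (M' * (r + r') ^+ j * j`!%:R `^ alpha)); last by ring.
rewrite lerD// ler_wpM2l//; [apply: le_trans (B j z t Dz ht) _|
  apply: le_trans (B' j z t Dz ht) _]; rewrite ler_wpM2r ?powR_ge0//;
  by rewrite ler_wpM2l// lerXn2r ?nnegrE ?addr_ge0// ?lerDl ?lerDr.
Qed.

Lemma gevrey_jet_sum (I : Type) (s : seq I) (c : I -> R) (G : I -> nat -> X -> R -> R) :
  (forall i, gevrey_jet D (G i)) ->
  gevrey_jet D (fun j x t => \sum_(i <- s) c i * G i j x t).
Proof.
move=> jG; elim: s => [|i s IH].
  split=> [j x t _ _|a b _].
    rewrite big_nil (_ : (fun _ => _) = cst 0); first exact: is_derive_cst.
    by apply/funext => u; rewrite big_nil.
  by exists 0, 0; split => // j x t _ _; rewrite big_nil normr0 !mul0r.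
have := gevrey_jet_lin (c i) 1 (jG i) IH.
congr gevrey_jet; apply/funext => j; apply/funext => x; apply/funext => t.
by rewrite big_cons mul1r.
Qed.

(** The left side is what differentiating the j-th Leibniz sum produces; Pascal's rule regroups it
    as the next one. *)
Lemma leibniz_shift (u v : nat -> R) j :
  \sum_(l < j.+1) ('C(j, l)%:R * (u l.+1 * v (j - l)%N + u l * v (j - l).+1)) =
  \sum_(l < j.+2) 'C(j.+1, l)%:R * (u l * v (j.+1 - l)%N).
Proof.
rewrite [RHS]big_ord_recl/= bin0 subn0 mul1r.
under [X in _ = _ + X]eq_bigr => l _ do
  rewrite /bump/= add1n binS natrD subSS mulrDl.
rewrite big_split/= addrA.
have -> : u 0%N * v j.+1 + \sum_(l < j.+1) 'C(j, l.+1)%:R * (u l.+1 * v (j - l)%N) =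
    \sum_(l < j.+1) 'C(j, l)%:R * (u l * v (j - l).+1).
  rewrite big_ord_recr/= bin_small// mul0r addr0 [RHS]big_ord_recl/= bin0 subn0 mul1r.
  congr (_ + _); apply: eq_bigr => l _; rewrite /bump/= add1n -subSn//.
rewrite -big_split/=; apply: eq_bigr => l _.
by rewrite mulrDr addrC.
Qed.

Hypothesis alpha_ge0 : 0 <= alpha.

(** The quotient of (i + l)! by i! l! is a binomial coefficient, hence at least 1. This is why
    products keep their Gevrey order. *)
Lemma fact_powR_mul i l : i`!%:R `^ alpha * l`!%:R `^ alpha <= (i + l)`!%:R `^ alpha :> R.
Proof.
rewrite -powRM//; apply: ge0_ler_powR => //; rewrite ?nnegrE ?mulr_ge0//.
rewrite -natrM ler_nat -(@bin_fact (i + l) i) ?leq_addr//.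
by rewrite addKn leq_pmull// bin_gt0 leq_addr.
Qed.

Lemma gevrey_jetM G H : gevrey_jet D G -> gevrey_jet D H ->
  gevrey_jet D (fun j x t => \sum_(l < j.+1) 'C(j, l)%:R * (G l x t * H (j - l)%N x t)).
Proof.
move=> [dG bG] [dH bH]; split=> [j x t Dx ht|a b ha].
  rewrite -(leibniz_shift (fun l => G l x t) (fun l => H l x t)).
  apply: is_derive1_sum => l.
  have := is_derive1_lin 'C(j, l)%:R 0
    (is_derive1M (dG l x t Dx ht) (dH (j - l)%N x t Dx ht)) (dG 0%N x t Dx ht).
  by congr is_derive; [apply/funext => s; rewrite mul0r addr0 | rewrite mul0r addr0].
have [M [r [M0 r0 B]]] := bG a b ha; have [M' [r' [M'0 r'0 B']]] := bH a b ha.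
(* By the binomial theorem the bounds of the Leibniz terms add up to (r' + r)^j. *)
exists (M * M'), (r' + r); split; [by rewrite mulr_ge0 | by rewrite addr_ge0 |].
move=> j x t Dx ht; rewrite (le_trans (ler_norm_sum _ _ _))// exprDn mulr_sumr mulr_suml.
apply: ler_sum => -[l /= lj] _; rewrite ltnS in lj.
rewrite !normrM ger0_norm//.
apply: (@le_trans _ _ ('C(j, l)%:R * ((M * r ^+ l * l`!%:R `^ alpha) *
    (M' * r' ^+ (j - l) * (j - l)`!%:R `^ alpha)))).
  by rewrite ler_wpM2l// ler_pM// ?B ?B'.
rewrite [leLHS](_ : _ = (M * M' * ('C(j, l)%:R * (r' ^+ (j - l) * r ^+ l))) *
  (l`!%:R `^ alpha * (j - l)`!%:R `^ alpha)); last by ring.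
rewrite -[X in _ <= _ * X * _]mulr_natl ler_wpM2l ?mulr_ge0 ?exprn_ge0//.
by have := fact_powR_mul l (j - l); rewrite subnKC.
Qed.

End Fixed.

(** A time derivative is the pointwise limit of difference quotients with step 1 / (n + 1), so
    measurability in x climbs from one order to the next. *)
Lemma gevrey_jet_measurable (A : set R) (G : nat -> R -> R -> R) : measurable A ->
  (forall j x t, A x -> t0 < t -> is_derive t 1 (G j x) (G j.+1 x t)) ->
  (forall t, t0 < t -> measurable_fun A (G 0%N ^~ t)) ->
  forall j t, t0 < t -> measurable_fun A (G j ^~ t).
Proof.
move=> mA dG m0; elim=> // j IH t ht.
pose q (n : nat) x := n.+1%:R * (G j x (n.+1%:R^-1 + t) - G j x t).
apply: (@measurable_fun_cvg _ _ _ _ q) => [n|x Ax].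
  apply: measurable_funM => //; apply: measurable_funB; apply: IH => //.
  by rewrite (lt_trans ht)// ltrDr invr_gt0.
have [dv <-] := dG j x t Ax ht; rewrite -derive1E.
have qE : q ^~ x = (fun h => h^-1 *: (G j x (h + t) - G j x t)) \o (fun n => n.+1%:R^-1).
  by apply/funext => n; rewrite /q/= invrK.
rewrite qE; apply: cvg_comp; last first.
  have cd : cvg (h^-1 *: (G j x (h + t) - G j x t) @[h --> 0^']).
    move: dv; rewrite /derivable [X in X @ 0^'](_ : _ =
      (fun h => h^-1 *: (G j x (h + t) - G j x t)))//.
    by apply/funext => h /=; rewrite [h%:A]mulr1.
  exact: cd.
move=> P [e /= e0 eP]; have := @cvg_harmonic R; move=> /cvgrPdist_lt /(_ e e0).
apply: filterS => n /= hn; apply: eP; last by rewrite invr_eq0.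
exact: hn.
Qed.

Notation mu := (@lebesgue_measure R).

(** The remainder bounds are uniform in x, so they survive integration; as the segment has length at
    most 1, the Gevrey constants do not change. *)
Lemma gevrey_jet_integral (G : nat -> R * R -> R -> R) :
  gevrey_jet closed_triangle G ->
  (forall z t : R, 0 <= z <= 1 -> t0 < t ->
    measurable_fun `[0, z] (fun x => G 0%N (z, x) t)) ->
  gevrey_jet `[0, 1] (fun j (z : R) t => \int[mu]_(x in `[0, z]) G j (z, x) t).
Proof.
move=> jG m0.
have bm j (z t : R) : 0 <= z <= 1 -> t0 < t -> bounded_measurable 0 z (fun x => G j (z, x) t).
  move=> hz ht; split.
    apply: (@gevrey_jet_measurable _ (fun j x t => G j (z, x) t)) => //
      [i x s /=|s]; last exact: m0.
    by rewrite in_itv/= => /andP[x0 xz]; apply: jG.1; case/andP: hz.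
  have [C [_ H]] := gevrey_jet_bounded jG t j ht.
  by exists C => x /andP[x0 xz]; apply: H; [case/andP: hz | rewrite !lexx].
split=> [j z t /=|a b ha].
  (* Half the distance to t0 keeps the window [t - e, t + e] inside t > t0, where uniform bounds are
     available. *)
  rewrite in_itv/= => hz ht; pose e := (t - t0) / 2.
  have [|C [C0 H]] := @gevrey_jet_quad _ _ _ jG (t - e) (t + e) j; first by rewrite /e; lra.
  apply: (@is_derive_quad _ _ _ _ C e) => [|s]; first by rewrite /e; lra.
  rewrite ltr_norml => hs.
  have [st st'] : t0 < s /\ t - e <= s <= t + e by rewrite /e in hs *; lra.
  have := @Rintegral_quad R 0 z (fun x => G j (z, x) s) (fun x => G j (z, x) t)
    (fun x => G j.+1 (z, x) t) (s - t) (C * (s - t) ^+ 2) _ (bm _ _ _ hz st)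
    (bm _ _ _ hz ht) (bm _ _ _ hz ht).
  rewrite subr0; case/andP: (hz) => z0 z1.
  move=> /(_ z0) H1; apply: (le_trans (H1 _)) => [x /andP[x0 xz]|].
    by apply: H => //; rewrite /e in hs *; lra.
  by rewrite ler_piMr// mulr_ge0// sqr_ge0.
have [M [r [M0 r0 H]]] := jG.2 a b ha; exists M, r; split => // j z t /=.
rewrite in_itv/= => hz ht; case/andP: (hz) => z0 z1.
have t0t : t0 < t by case/andP: ht => h _; exact: lt_le_trans h.
apply: (@le_trans _ _ ((M * r ^+ j * j`!%:R `^ alpha) * (z - 0))).
  apply: Rintegral_bound => //; first by case: (bm j z t hz t0t).
  by move=> x /andP[x0 xz]; exact: H.
by rewrite subr0 ler_piMr// !mulr_ge0 ?exprn_ge0 ?powR_ge0.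
Qed.

End GevreyJets.

Section DerivativeJet.
Context {R : realType}.

(** The way back from an explicit family to iterated derivatives; [unit] is the space variable of a
    function of time alone. *)
Lemma gevrey_jet_derive1n (alpha t0 : R) (G : nat -> unit -> R -> R) (f : R -> R) :
  gevrey_jet alpha t0 setT G -> (forall t, t0 < t -> f t = G 0%N tt t) ->
  gevrey_jet alpha t0 [set: unit] (fun j _ => derive1n j f).
Proof.
move=> [dG bG] fG.
have H := is_derive1_derive1n (t0 := t0) (G := fun j => G j tt)
  (fun j t ht => dG j tt t I ht) fG.
split=> [j x t _ ht|a b ha].
  have [_ [dv _]] := H j t ht.
  by apply: DeriveDef; [exact: dv | rewrite -derive1E derive1nS].
have [M [r [M0 r0 B]]] := bG a b ha; exists M, r; split => // j x t _ hab.
have ht : t0 < t by case/andP: hab => h _; exact: lt_le_trans h.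
by rewrite (H j t ht).1; exact: B.
Qed.

Lemma gtilde_gevrey_jet (alpha t0 : R) m n (P : 'M[R]_(m, n)) (g : R -> 'cV[R]_m) i :
  (forall l, gevrey alpha t0 (fun t => g t l 0)) ->
  gevrey_jet alpha t0 [set: unit] (fun j _ => derive1n j (fun t => gtilde P (g t) i 0)).
Proof.
move=> gg; have jg l := @gevrey_cst_jet _ _ _ _ [set: unit] _ (gg l).
apply: (gevrey_jet_derive1n (gevrey_jet_sum (index_enum _) (fun l => P l i) jg)) => t _.
by rewrite !mxE; apply: eq_bigr => l _; rewrite mxE mulrC.
Qed.

End DerivativeJet.

(** * The expansion of exp (z (A + s B)) in powers of s *)

Section FactorialSeries.
Context {R : realType}.

Lemma expR_term_le (y : R) n : 0 <= y -> y ^+ n / n`!%:R <= expR y.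
Proof.
move=> y0; have nd : nondecreasing_seq (series (exp_coeff y)).
  by apply: nondecreasing_series => i _ _; exact: exp_coeff_ge0.
apply: le_trans (nondecreasing_cvgn_le nd (is_cvg_series_exp_coeff y) n.+1).
rewrite /series/= big_nat_recr//= exp_coeffE/= mulrC ler_wpDl// sumr_ge0// => i _.
by rewrite mulr_ge0// exprn_ge0.
Qed.

Lemma geometric_half_sums (c : R) :
  cvgn (series (fun n => c * 2^-1 ^+ n)) /\ sums (fun n => c * 2^-1 ^+ n) = c * 2.
Proof.
have h : `|2^-1 : R| < 1 by rewrite ger0_norm ?invr_ge0//; lra.
split; first exact: is_cvg_geometric_series.
have := cvg_geometric_series (a := c) h; move=> /cvg_lim -> //.
by congr (_ * _); field.
Qed.

(* With y = (2 z)^(1/delta), y^n / n! <= exp y raised to the power delta gives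
   geometric decay. *)
Lemma factorial_powR_series (z delta : R) : 0 <= z -> 0 < delta ->
  cvgn (series (fun n => z ^+ n / n`!%:R `^ delta)).
Proof.
move=> z0 d0; pose y := (2 * z) `^ delta^-1.
have y0 : 0 <= y by exact: powR_ge0.
have yd : y `^ delta = 2 * z.
  by rewrite /y -powRrM mulVf ?gt_eqF// powRr1// mulr_ge0.
have ydn n : (y ^+ n) `^ delta = (2 * z) ^+ n.
  elim: n => [|n IH]; first by rewrite !expr0 powR1.
  by rewrite exprS powRM ?exprn_ge0// yd IH -exprS.
have [cg _] := geometric_half_sums (expR y `^ delta).
have f0 n : 0 < n`!%:R `^ delta :> R by rewrite powR_gt0// ltr0n fact_gt0.
apply: (series_le_cvg _ _ _ cg) => n.
- by rewrite divr_ge0 ?exprn_ge0// ltW.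
- by rewrite mulr_ge0 ?powR_ge0// exprn_ge0// invr_ge0.
have -> : z ^+ n = 2^-1 ^+ n * (y ^+ n) `^ delta.
  by rewrite ydn exprMn mulrA -exprMn mulVf// expr1n mul1r.
rewrite ler_pdivrMr// mulrAC [leRHS]mulrC ler_wpM2l ?exprn_ge0 ?invr_ge0//.
rewrite -powRM ?expR_ge0//; apply: ge0_ler_powR; rewrite ?nnegrE ?exprn_ge0 ?mulr_ge0 ?expR_ge0//.
  exact: ltW.
by rewrite -ler_pdivrMr ?ltr0n ?fact_gt0// expR_term_le.
Qed.

Lemma bin_le_expn n k : ('C(n, k) <= 2 ^ n)%N.
Proof.
elim: n k => [|n IH] [|k] //; first by rewrite bin0 expn_gt0.
by rewrite binS expnS mul2n -addnn leq_add.
Qed.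

(** Since (j + m)! <= 2^(j + m) j! m! and alpha < 2, the factor (j + m)!^alpha is at most 4^(j + m)
    (j! m!)^alpha. Against (j!)^2 there remains (4 r X)^j / (j!)^(2 - alpha), with a positive
    exponent 2 - alpha. *)
Lemma gevrey_weight_series (X r alpha : R) m : 0 <= X -> 0 <= r -> 0 <= alpha < 2 ->
  cvgn (series (fun j => X ^+ j / j`!%:R ^+ 2 *
    (r ^+ (j + m) * (j + m)`!%:R `^ alpha))).
Proof.
move=> X0 r0 /andP[a0 a2].
have d0 : 0 < 2 - alpha by rewrite subr_gt0.
have z0 : 0 <= 4 * r * X by rewrite !mulr_ge0.
(* [K] collects what depends on [m], the number of additional time derivatives. *)
pose K := (4 * r) ^+ m * m`!%:R `^ alpha.
have K0 : 0 <= K by rewrite mulr_ge0 ?powR_ge0// exprn_ge0// mulr_ge0.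
have cz := @is_cvg_seriesZ R _ K (factorial_powR_series z0 d0).
apply: (series_le_cvg _ _ _ cz) => j.
- by rewrite !mulr_ge0 ?exprn_ge0 ?powR_ge0// invr_ge0 exprn_ge0.
- rewrite /GRing.scale/=; rewrite mulr_ge0// divr_ge0 ?powR_ge0 ?exprn_ge0//.
have jf : 0 < j`!%:R :> R by rewrite ltr0n fact_gt0.
have -> : j`!%:R ^+ 2 = j`!%:R `^ alpha * j`!%:R `^ (2 - alpha) :> R.
  rewrite -powRD; last by apply/implyP => _; rewrite gt_eqF.
  by rewrite addrC subrK powR_mulrn// ltW.
have B : (j + m)`!%:R `^ alpha <= 4 ^+ (j + m) * (j`!%:R `^ alpha * m`!%:R `^ alpha) :> R.
  apply: (@le_trans _ _ ((2 ^+ (j + m)) `^ alpha * (j`!%:R `^ alpha * m`!%:R `^ alpha))).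
    rewrite -!powRM ?mulr_ge0 ?exprn_ge0//; apply: ge0_ler_powR => //;
      rewrite ?nnegrE ?mulr_ge0 ?exprn_ge0//.
    rewrite -natrX -!natrM ler_nat -(@bin_fact (j + m) j) ?leq_addr// addKn.
    by rewrite leq_mul// bin_le_expn.
  rewrite ler_wpM2r ?mulr_ge0 ?powR_ge0//.
  have -> : 4 ^+ (j + m) = (2 ^+ (j + m)) `^ 2%:R :> R.
    by rewrite powR_mulrn ?exprn_ge0// exprAC; congr (_ ^+ _); rewrite expr2 -natrM.
  by rewrite ler_powR ?exprn_ege1 ?ler1n// ltW.
have ja : 0 < j`!%:R `^ alpha :> R by rewrite powR_gt0.
have jd : 0 < j`!%:R `^ (2 - alpha) :> R by rewrite powR_gt0.
apply: (@le_trans _ _ (X ^+ j / (j`!%:R `^ alpha * j`!%:R `^ (2 - alpha)) *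
    (r ^+ (j + m) * (4 ^+ (j + m) * (j`!%:R `^ alpha * m`!%:R `^ alpha))))).
  rewrite ler_wpM2l ?divr_ge0 ?mulr_ge0 ?exprn_ge0 ?powR_ge0//.
  by rewrite ler_wpM2l ?exprn_ge0.
rewrite le_eqVlt; apply/orP; left; apply/eqP.
rewrite fctE /K /GRing.scale/= !exprMn !exprD; field.
by rewrite !gt_eqF.
Qed.

End FactorialSeries.

(** * Exponential generating functions whose first coefficients vanish *)

Section ExponentialGeneratingFunction.
Context {R : realType}.
Implicit Types (u : nat -> R) (L M z : R).

(** With the factorials split off, differentiation is the shift of [u], and geometric growth of [u],
    as for powers of a matrix, makes the series entire. *)
Definition egf u z : R := limn (pseries (fun n => u n / n`!%:R) z).

Lemma egf_cvg L M u z : 0 <= M -> (forall n, `|u n| <= L * M ^+ n) ->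
  cvgn (pseries (fun n => u n / n`!%:R) z).
Proof.
move=> M0 uM; rewrite /pseries.
have := @is_cvg_seriesZ R _ L (is_cvg_series_exp_coeff (M * `|z|)).
move=> /(series_dominated (u := fun i => u i / i`!%:R * z ^+ i)) [] // n.
rewrite fctE /GRing.scale/= exp_coeffE/= !normrM normrX normfV (ger0_norm (ler0n _ _)).
rewrite [leRHS](_ : _ = L * M ^+ n * n`!%:R^-1 * `|z| ^+ n); last by rewrite exprMn; ring.
by rewrite ler_wpM2r ?exprn_ge0// ler_wpM2r ?invr_ge0.
Qed.

Lemma egf_derive L M u z : 1 <= M -> (forall n, `|u n| <= L * M ^+ n) ->
  is_derive z 1 (egf u) (egf (u \o succn) z).
Proof.
move=> M1 uM; have M0 : 0 <= M by apply: le_trans M1.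
have L0 : 0 <= L by have := uM 0%N; rewrite expr0 mulr1; apply: le_trans.
have shift k n : `|u (n + k)%N| <= L * M ^+ k * M ^+ n.
  by rewrite (le_trans (uM _))// exprD mulrAC mulrA.
have dE (v : nat -> R) : pseries_diffs (fun n => v n / n`!%:R) =
    (fun n => v n.+1 / n`!%:R).
  apply/funext => n; rewrite /pseries_diffs factS natrM invfM mulrCA; congr (_ * _).
  by rewrite mulVKf.
(* Termwise differentiation requires convergence of the series and of its first two formal
   derivatives at a point farther out than z, here |z| + 1. *)
have := @pseries_snd_diffs R (fun n => u n / n`!%:R) (`|z| + 1) z.
rewrite !dE /egf; apply; last first.
- by rewrite [ltRHS]ger0_norm ?addr_ge0// ltrDl.
- apply: (@egf_cvg (L * M ^+ 2) M) => // n; have := shift 2 n; by rewrite addn2.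
- apply: (@egf_cvg (L * M ^+ 1) M) => // n; have := shift 1 n; by rewrite addn1.
- exact: egf_cvg uM.
Qed.

Lemma egf0 u : egf u 0 = u 0%N.
Proof.
rewrite /egf; apply: cvg_lim => //; rewrite -cvg_shiftS/=.
rewrite [X in X @ _ --> _](_ : _ = cst (u 0%N)); first exact: cvg_cst.
apply/funext => n; rewrite /pseries/series/= big_nat_recl//= expr0 mulr1 fact0 divr1.
by rewrite big1 ?addr0// => i _; rewrite expr0n/= mulr0.
Qed.

Lemma egf_sum L M (I : Type) (r : seq I) (c : I -> R) (u : I -> nat -> R) z : 0 <= M ->
  (forall i n, `|u i n| <= L * M ^+ n) ->
  egf (fun n => \sum_(i <- r) c i * u i n) z = \sum_(i <- r) c i * egf (u i) z.
Proof.
move=> M0 uM; have cu i := @egf_cvg L M (u i) z M0 (uM i).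
have cz i := @is_cvg_seriesZ R _ (c i) (cu i).
have [_ E] := cvg_series_sum r cz.
have Z i : c i * egf (u i) z = sums (c i *: (fun n => u i n / n`!%:R * z ^+ n)).
  by rewrite (@lim_seriesZ R)//; exact: cu.
under [RHS]eq_bigr do rewrite Z.
rewrite -E /egf /pseries; congr (limn (series _)); apply/funext => n.
rewrite /= !mulr_suml; apply: eq_bigr => i _.
by rewrite fctE /GRing.scale/= !mulrA.
Qed.

(* The slack n + 3 leaves room for the first two derivatives of a generating
   function whose coefficients vanish for n + 1 < 2 j. *)
Lemma egf_term_le M j n : 1 <= M -> (2 * j <= n + 3)%N ->
  M ^+ n / n`!%:R <= (48 * expR (4 * M)) * ((4 * M) ^+ 2) ^+ j / j`!%:R ^+ 2 * 2^-1 ^+ n.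
Proof.
move=> M1 jn; pose i := (n + 3 - 2 * j)%N.
have nE : (n + 3 = i + 2 * j)%N by rewrite subnK.
have f0 k : 0 < k`!%:R :> R by rewrite ltr0n fact_gt0.
have M0 : 0 < M by exact: lt_le_trans M1.
(* 48 = 3! * 2^3: the quotient (n + 3)! / n! is 3! times a binomial coefficient, which is at most
   2^(n + 3). *)
have fn : ((n + 3)`! <= 48 * 2 ^ n * n`!)%N.
  rewrite -(@bin_fact (n + 3) 3) ?leq_addl// addnK mulnA leq_mul2r; apply/orP; right.
  by rewrite (_ : (48 * 2 ^ n = 2 ^ (n + 3) * 6)%N) ?leq_mul ?bin_le_expn// expnD; lia.
have fi : (j`! ^ 2 * i`! <= (n + 3)`!)%N.
  rewrite nE -(@bin_fact (i + 2 * j) i) ?leq_addr// addKn.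
  apply: (@leq_trans (i`! * (2 * j)`!)); last by rewrite leq_pmull// bin_gt0 leq_addr.
  rewrite mulnC leq_mul// -(@bin_fact (2 * j) j); last by lia.
  by rewrite mul2n -addnn addKn -mulnn leq_pmull// bin_gt0 leq_addr.
have y0 : 0 < 4 * M by rewrite mulr_gt0.
have y1 : 1 <= 4 * M by lra.
(* Of the factor 4^n, one 2^n pays for passing from n! to (n + 3)!, the other for the geometric
   factor 2^-n. *)
have s1 : M ^+ n / n`!%:R <= 48 * (4 * M) ^+ n / (n + 3)`!%:R * 2^-1 ^+ n.
  have -> : 48 * (4 * M) ^+ n / (n + 3)`!%:R * 2^-1 ^+ n =
      M ^+ n * ((48 * 2 ^ n)%:R / (n + 3)`!%:R).
    have -> : 4 * M = 2 * (2 * M) by ring.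
    by rewrite natrM natrX !exprMn exprVn; field; rewrite expf_neq0//= gt_eqF.
  rewrite ler_wpM2l ?exprn_ge0 ?(ltW M0)// ler_pdivlMr// mulrC ler_pdivrMr//.
  by rewrite -natrM ler_nat.
apply: (le_trans s1); rewrite ler_wpM2r ?exprn_ge0 ?invr_ge0//.
apply: (@le_trans _ _ (48 * (4 * M) ^+ (n + 3) / (j`! ^ 2 * i`!)%:R)).
  apply: ler_pM; rewrite ?mulr_ge0 ?exprn_ge0 ?invr_ge0 ?ler_wpM2l ?(ltW y0)//.
    by rewrite ler_weXn2l// leq_addr.
  by rewrite lef_pV2 ?posrE ?ltr0n ?muln_gt0 ?expn_gt0 ?fact_gt0// ler_nat.
have E := expR_term_le i (ltW y0).
rewrite nE exprD natrM natrX -exprM.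
rewrite [leLHS](_ : _ = 48 * ((4 * M) ^+ (2 * j) / j`!%:R ^+ 2) *
    ((4 * M) ^+ i / i`!%:R)); last first.
  by field; rewrite !gt_eqF.
rewrite [leRHS](_ : _ = 48 * ((4 * M) ^+ (2 * j) / j`!%:R ^+ 2) * expR (4 * M)); last by ring.
by rewrite ler_wpM2l// mulr_ge0// divr_ge0 ?exprn_ge0 ?(ltW y0).
Qed.

(** Every surviving term carries the same factor (4 M)^(2 j) / (j!)^2, and the remaining 2^-n sum to
    2, whence 96 = 2 * 48. *)
Lemma egf_bound L M u j z : 1 <= M -> (forall n, `|u n| <= L * M ^+ n) ->
  (forall n, (n + 3 < 2 * j)%N -> u n = 0) -> `|z| <= 1 ->
  `|egf u z| <= (L * (96 * expR (4 * M))) * (((4 * M) ^+ 2) ^+ j / j`!%:R ^+ 2).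
Proof.
move=> M1 uM u0 z1.
have L0 : 0 <= L by have := uM 0%N; rewrite expr0 mulr1; apply: le_trans.
have M0 : 0 <= M by apply: le_trans M1.
pose c := L * (48 * expR (4 * M) * ((4 * M) ^+ 2) ^+ j / j`!%:R ^+ 2).
have [cg sg] := geometric_half_sums c.
have D n : `|u n / n`!%:R * z ^+ n| <= c * 2^-1 ^+ n.
  rewrite normrM normrX -[leRHS]mulr1 ler_pM ?exprn_ge0 ?exprn_ile1//.
  have [nj|jn] := ltnP (n + 3) (2 * j).
    rewrite u0// mul0r normr0 mulr_ge0 ?exprn_ge0 ?invr_ge0//.
    by rewrite !mulr_ge0 ?expR_ge0 ?exprn_ge0 ?invr_ge0 ?exprn_ge0 ?mulr_ge0.
  rewrite normrM normfV (ger0_norm (ler0n _ _)).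
  apply: (@le_trans _ _ (L * (M ^+ n / n`!%:R))).
    by rewrite mulrA ler_wpM2r ?invr_ge0.
  by rewrite /c -[leRHS]mulrA ler_wpM2l// egf_term_le.
have [_ H] := series_dominated D cg.
apply: (le_trans H); rewrite sg /c le_eqVlt; apply/orP; left; apply/eqP; ring.
Qed.

End ExponentialGeneratingFunction.

Section MatrixSeries.
Context {R : realType}.

Lemma cvg_mx_entries {T : Type} {m n : nat} (F : set_system T) {FF : Filter F}
    (f : T -> 'M[R]_(m, n)) (l : 'M[R]_(m, n)) :
  (forall i j, (fun x => f x i j) @ F --> l i j) -> f @ F --> l.
Proof.
move=> h; apply/cvgrPdist_le => /= e e0; near=> x.
rewrite /Num.Def.normr/= mx_normrE (bigmax_le _ (ltW e0))//= => i _; rewrite !mxE/=.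
move: i; near: x; apply: filter_forall => /= i.
exact: ((cvgrPdist_le _ _).1 (h i.1 i.2)).
Unshelve. all: by end_near. Qed.

Lemma cvg_series_mx m n (u : nat -> 'M[R]_(m, n)) :
  (forall i j, cvgn (series (fun p => u p i j))) ->
  cvgn (series u) /\ forall i j, limn (series u) i j = sums (fun p => u p i j).
Proof.
move=> cu; pose l : 'M[R]_(m, n) := \matrix_(i, j) sums (fun p => u p i j).
suff h : series u @ \oo --> l.
  split; first by apply/cvg_ex; eexists; exact: h.
  by move=> i j; rewrite (cvg_lim _ h)// mxE.
apply: cvg_mx_entries => i j; rewrite mxE.
rewrite [X in X @ _ --> _](_ : _ = series (fun p => u p i j)); first exact: cu.
by apply/funext => p; rewrite /series/= summxE.
Qed.

End MatrixSeries.

(** * Coefficients of the powers of A + s B and the Duhamel recursion *)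

Section Dyson.
Context {R : realType}.
Variables (d : nat) (A B : 'M[R]_d).

(** The coefficient of s^j in (A + s B)^n, by splitting off the leftmost factor. *)
Fixpoint dyson (n j : nat) : 'M[R]_d :=
  if n is n'.+1 then
    A *m dyson n' j + (if j is j'.+1 then B *m dyson n' j' else 0)
  else if j is 0%N then 1%:M else 0.

(** Dominates each row sum of |A| + |B|, so that a further factor A + s B costs one power; the
    summand 1 makes the powers nondecreasing in the exponent. *)
Definition dyson_radius : R := 1 + \sum_a \sum_b (`|A a b| + `|B a b|).

Lemma dyson_radius_ge1 : 1 <= dyson_radius.
Proof. by rewrite lerDl sumr_ge0// => i _; rewrite sumr_ge0. Qed.

Lemma dyson_le n j a k : `|dyson n j a k| <= 1 * dyson_radius ^+ n.
Proof.
rewrite mul1r; have M1 := dyson_radius_ge1; have M0 : 0 <= dyson_radius by apply: le_trans M1.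
elim: n j a k => [|n IH] j a k.
  by rewrite expr0; case: j => [|j]; rewrite mxE ?normr0//; case: eqP; rewrite ?normr1 ?normr0.
have sumle : \sum_b (`|A a b| + `|B a b|) <= dyson_radius.
  rewrite /dyson_radius ler_wpDl// [leRHS](bigD1 a)//= lerDl sumr_ge0// => i _.
  by rewrite sumr_ge0.
rewrite exprS; apply: le_trans (ler_wpM2r _ sumle); last by rewrite exprn_ge0.
rewrite mulr_suml /= !mxE (le_trans (ler_normD _ _))//.
under [leRHS]eq_bigr do rewrite mulrDl.
rewrite big_split/= lerD//.
  rewrite (le_trans (ler_norm_sum _ _ _))// ler_sum// => b _.
  by rewrite normrM ler_wpM2l.
case: j => [|j].
  by rewrite mxE normr0 sumr_ge0// => b _; rewrite mulr_ge0// exprn_ge0.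
rewrite mxE (le_trans (ler_norm_sum _ _ _))// ler_sum// => b _.
by rewrite normrM ler_wpM2l.
Qed.

Lemma dyson0_expr n : dyson n 0 = A ^+ n.
Proof. by elim: n => [|n IH]; rewrite ?expr0//= IH addr0 exprS. Qed.

Definition dyson_fun j a k (z : R) : R := egf (fun n => dyson n j a k) z.

(** The convention Phi_(-1) = 0, which spares the derivative formula a case distinction. *)
Definition dyson_prev j a k (z : R) : R := if j is j'.+1 then dyson_fun j' a k z else 0.

Definition dyson_deriv j a k (z : R) : R :=
  \sum_b A a b * dyson_fun j b k z + \sum_b B a b * dyson_prev j b k z.

Lemma dyson_derivE j a k z : dyson_deriv j a k z = egf (fun n => dyson n.+1 j a k) z.
Proof.
have M0 : 0 <= dyson_radius by apply: le_trans dyson_radius_ge1.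
rewrite /dyson_deriv.
(* Indexing by a disjoint sum merges the products with A and with B into one finite linear
   combination. *)
pose c (i : 'I_d + 'I_d) := match i with inl b => A a b | inr b => B a b end.
pose u (i : 'I_d + 'I_d) n := match i with inl b => dyson n j b k
  | inr b => if j is j'.+1 then dyson n j' b k else 0 end.
have uM i n : `|u i n| <= 1 * dyson_radius ^+ n.
  case: i => b; first exact: dyson_le.
  by rewrite /u; case: (j) => [|j']; [rewrite normr0 mul1r exprn_ge0|exact: dyson_le].
have := @egf_sum R 1 dyson_radius _ (index_enum _) c u z M0 uM.
rewrite [RHS]big_sumType/= => H.
rewrite [RHS](_ : _ = egf (fun n => \sum_i c i * u i n) z); last first.
  congr egf; apply/funext => n; rewrite big_sumType/= mxE; congr (_ + _); first by rewrite mxE.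
  by case: (j) => [|j']; rewrite mxE// big1// => b _; rewrite mulr0.
rewrite H; congr (_ + _); apply: eq_bigr => b _; congr (_ * _).
rewrite /u /dyson_prev; case: (j) => // .
rewrite /egf /pseries (_ : (fun _ => _) = (fun=> 0)); last by apply/funext => n; rewrite !mul0r.
apply/esym/cvg_lim => //; rewrite (_ : series _ = cst 0); first exact: cvg_cst.
by apply/funext => n; rewrite /series/= big1.
Qed.

Lemma dyson_fun_derive j a k (z : R) :
  is_derive z 1 (dyson_fun j a k) (dyson_deriv j a k z).
Proof.
rewrite dyson_derivE.
exact: (egf_derive z dyson_radius_ge1 (fun n => dyson_le n j a k)).
Qed.

(** A commutes with its powers. In the Duhamel integral the exponential is the left factor, so its A
    must come out on the right, next to Phi_(j+1). *)
Lemma dyson_fun0_derive_right a k (z : R) :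
  is_derive z 1 (dyson_fun 0 a k) (\sum_b A b k * dyson_fun 0 a b z).
Proof.
have M0 : 0 <= dyson_radius by apply: le_trans dyson_radius_ge1.
have := egf_derive z dyson_radius_ge1 (fun n => dyson_le n 0 a k).
rewrite [X in is_derive _ _ _ X -> _](_ : _ = egf (fun n => \sum_b A b k * dyson n 0 a b) z).
  by rewrite (@egf_sum R 1 dyson_radius)// => i n; exact: dyson_le.
congr egf; apply/funext => n; rewrite /comp dyson0_expr exprSr mxE.
by apply: eq_bigr => b _; rewrite dyson0_expr mulrC.
Qed.

Lemma dyson_fun_at0 j a k : dyson_fun j a k 0 = ((j == 0%N) && (a == k))%:R.
Proof. by rewrite /dyson_fun egf0/=; case: j => [|j]; rewrite mxE. Qed.

Lemma expmx_dyson z a k : expmx (z *: A) a k = dyson_fun 0 a k z.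
Proof.
have M0 : 0 <= dyson_radius by apply: le_trans dyson_radius_ge1.
have E n : (n`!%:R^-1 *: (z *: A) ^+ n) = (n`!%:R^-1 * z ^+ n) *: dyson n 0.
  rewrite dyson0_expr -scalerA; congr (_ *: _).
  elim: n => [|n IH]; first by rewrite !expr0 scale1r.
  by rewrite !exprS IH; rewrite -[LHS]/(_ *m _) -scalemxAl -scalemxAr scalerA.
have cE (i b : 'I_d) : (fun n => (n`!%:R^-1 *: (z *: A) ^+ n) i b) =
    (fun n => dyson n 0 i b / n`!%:R * z ^+ n).
  by apply/funext => n; rewrite E mxE mulrC mulrA.
have [|_ ->] := @cvg_series_mx R d d (fun n => n`!%:R^-1 *: (z *: A) ^+ n).
  by move=> i b; rewrite cE; exact: (@egf_cvg R 1 dyson_radius _ z M0 (fun n => dyson_le n 0 i b)).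
by rewrite cE.
Qed.

Notation mu := (@lebesgue_measure R).

Lemma dyson_fun_continuous j a k : continuous (dyson_fun j a k).
Proof.
move=> z; have [dz _] := dyson_fun_derive j a k z.
exact/differentiable_continuous/derivable1_diffP.
Qed.

(** The integrand is the derivative of exp ((z - x) A) Phi_(j+1)(x), in which the two terms with A
    cancel. This primitive vanishes at x = 0, because Phi_(j+1)(0) = 0, and equals Phi_(j+1)(z) at x
    = z. *)
Lemma dyson_fun_rec j a k z : 0 <= z ->
  \int[mu]_(x in `[0, z])
    (\sum_c (\sum_b dyson_fun 0 a b (z - x) * B b c) * dyson_fun j c k x) =
  dyson_fun j.+1 a k z.
Proof.
move=> z0.
pose F x := \sum_b dyson_fun 0 a b (z - x) * dyson_fun j.+1 b k x.
pose f x := \sum_c (\sum_b dyson_fun 0 a b (z - x) * B b c) * dyson_fun j c k x.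
have dr b (x : R) : is_derive x 1 (fun y => dyson_fun 0 a b (z - y))
    (- \sum_c A c b * dyson_fun 0 a c (z - x)).
  have dl : is_derive x 1 (fun y => z - y) (-1).
    have := is_derive1_lin z (-1) (is_derive_cst (1 : R) x (1 : R)) (is_derive_id x (1 : R)).
    rewrite mulr0 add0r mulr1; congr is_derive; apply/funext => y /=.
    by rewrite mulr1 mulN1r.
  have := @is_derive1_comp R (dyson_fun 0 a b) (fun y => z - y) x _ _
    (dyson_fun0_derive_right a b (z - x)) dl.
  by rewrite mulrN1.
have dF (x : R) : is_derive x 1 F (f x).
  have := is_derive1_sum (fun b => is_derive1M (dr b x) (dyson_fun_derive j.+1 b k x)).
  congr is_derive; rewrite big_split/= /f /dyson_deriv/=.
  under [X in _ + X]eq_bigr do rewrite mulrDr.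
  rewrite big_split/= addrA [X in X + _](_ : _ = 0) ?add0r; last first.
    apply/eqP; rewrite addrC addr_eq0; apply/eqP.
    under [LHS]eq_bigr do rewrite mulr_sumr.
    rewrite exchange_big/= -sumrN; apply: eq_bigr => b _.
    by rewrite mulNr opprK mulr_suml; apply: eq_bigr => c _; ring.
  under [LHS]eq_bigr do rewrite mulr_sumr.
  rewrite exchange_big/=; apply: eq_bigr => c _; rewrite mulr_suml.
  by apply: eq_bigr => b _; rewrite mulrA.
have cont (g : R -> R) (x dg : R) : is_derive x 1 g dg -> {for x, continuous (g : R -> R)}.
  by move=> [h _]; exact/differentiable_continuous/derivable1_diffP.
have cf x : {for x, continuous f}.
  have h := is_derive1_sum (fun c => is_derive1M (is_derive1_sum (fun b =>
    is_derive1M (dr b x) (is_derive_cst (B b c) x (1 : R)))) (dyson_fun_derive j c k x)).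
  exact: (cont _ _ _ h).
have F0 : F 0 = 0.
  by rewrite /F big1// => b _; rewrite dyson_fun_at0 mulr0.
have Fz : F z = dyson_fun j.+1 a k z.
  rewrite /F (bigD1 a)//= subrr dyson_fun_at0 !eqxx/= mul1r big1 ?addr0// => b ba.
  by rewrite dyson_fun_at0/= eq_sym (negbTE ba) mul0r.
(* The fundamental theorem needs a nondegenerate interval, so z = 0 is treated apart. *)
move: z0; rewrite le_eqVlt => /predU1P[ze|z0].
  by rewrite -Fz -ze F0 set_itv1 Rintegral_set1.
rewrite /Rintegral (@continuous_FTC2 _ f F)//.
- by rewrite F0 Fz -EFinB/= subr0.
- by apply: continuous_subspaceT => x; exact: cf.
- by split=> [x _||]; [case: (dF x)|apply: cvg_at_right_filter; exact: cont (dF _)|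
    apply: cvg_at_left_filter; exact: cont (dF _)].
- by move=> x _; rewrite derive1E; case: (dF x).
Qed.

End Dyson.

(** * Vanishing coefficients from the block structure, and the resulting decay *)

Section BlockDyson.
Context {R : realType}.
Variables (n : nat) (P Q : 'M[R]_n).
Let A : 'M[R]_(n + n) := block_mx 0 1%:M P 0.
Let B : 'M[R]_(n + n) := block_mx 0 0 Q 0.

(* The only nonzero block of B is the lower left one, so that two factors B in
   a nonzero product are separated by a factor A: s^j needs 2 j - 1 factors. *)
Lemma block_dyson_eq0 m j : (m.+1 < 2 * j)%N -> dyson A B m j = 0.
Proof.
have AC (C : 'M[R]_(n + n)) : A *m C = col_mx (dsubmx C) (P *m usubmx C).
  by rewrite -{1}[C]vsubmxK mul_block_col !mul0mx mul1mx add0r addr0.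
have BC (C : 'M[R]_(n + n)) : B *m C = col_mx 0 (Q *m usubmx C).
  by rewrite -{1}[C]vsubmxK mul_block_col !mul0mx !addr0.
(* The row blocks are out of phase: A lifts the lower rows to the top, while new lower rows come
   from the upper ones. The upper block therefore vanishes for one more exponent, and the induction
   has to carry both ranges. *)
suff H i : ((i < 2 * j)%N -> usubmx (dyson A B i j) = 0) /\
    ((i.+1 < 2 * j)%N -> dsubmx (dyson A B i j) = 0).
  move=> mj; have [hu hd] := H m.
  by rewrite -[LHS]vsubmxK hu ?(ltnW mj)// hd// col_mx0.
elim: i j {m} => [|m IH] [|j] //=.
  by split=> _; apply/matrixP => a b; rewrite !mxE.
have [u1 d1] := IH j.+1; have [u0 d0] := IH j.
rewrite AC BC add_col_mx col_mxKu col_mxKd addr0; split=> h.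
  by apply: d1.
by rewrite u1 ?u0 ?mulmx0 ?addr0//; lia.
Qed.

End BlockDyson.

Section DysonBounds.
Context {R : realType}.
Variables (d : nat) (A B : 'M[R]_d).
Hypothesis dyson_eq0 : forall n j, (n.+1 < 2 * j)%N -> dyson A B n j = 0.

(** The first two z-derivatives are generating functions of the coefficients shifted by 1 and 2,
    which satisfy the same bound; the second one controls the remainder. *)
Lemma dyson_fun_bounds : exists K X : R, [/\ 0 <= K, 0 <= X,
  forall j a k z, 0 <= z <= 1 -> `|dyson_fun A B j a k z| <= K * (X ^+ j / j`!%:R ^+ 2) &
  forall j a k z z', 0 <= z <= 1 -> 0 <= z' <= 1 ->
    `|dyson_fun A B j a k z' - dyson_fun A B j a k z - (z' - z) * dyson_deriv A B j a k z|
      <= K * (X ^+ j / j`!%:R ^+ 2) * (z' - z) ^+ 2].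
Proof.
have M1 := dyson_radius_ge1 A B; set M := dyson_radius A B in M1 *.
have M0 : 0 <= M by apply: le_trans M1.
have shift l j a k p : (l <= 2)%N -> `|dyson A B (p + l)%N j a k| <= M ^+ 2 * M ^+ p.
  move=> l2; rewrite (le_trans (dyson_le A B (p + l)%N j a k))// mul1r -exprD.
  by rewrite ler_weXn2l// addnC leq_add2r.
(* For l <= 2 the inequality p + 3 < 2 j implies p + l + 1 < 2 j, so the shifted coefficients vanish
   as well. *)
have bnd l j a k z : (l <= 2)%N -> 0 <= z <= 1 ->
    `|egf (fun p => dyson A B (p + l)%N j a k) z| <=
    M ^+ 2 * (96 * expR (4 * M)) * (((4 * M) ^+ 2) ^+ j / j`!%:R ^+ 2).
  move=> l2 /andP[z0 z1]; apply: (egf_bound M1) => [p|p pj|]; first exact: shift.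
    by rewrite dyson_eq0 ?mxE//; lia.
  by rewrite ger0_norm.
pose K := M ^+ 2 * (96 * expR (4 * M)); pose X := (4 * M) ^+ 2.
have K0 : 0 <= K by rewrite mulr_ge0 ?exprn_ge0// mulr_ge0// expR_ge0.
have X0 : 0 <= X by rewrite exprn_ge0// mulr_ge0.
exists K, X; split => // [j a k z hz|j a k z z' hz hz'].
  have := bnd 0%N j a k z isT hz; rewrite /dyson_fun.
  have -> : (fun p => dyson A B (p + 0) j a k) = (fun p => dyson A B p j a k).
    by apply/funext => p; rewrite addn0.
  exact.
have W0 : 0 <= K * (X ^+ j / j`!%:R ^+ 2).
  by rewrite mulr_ge0// divr_ge0 ?exprn_ge0 ?mulr_ge0//.
apply: (is_derive_quad_remainder W0 _ _ hz hz') => [x _|]; first exact: dyson_fun_derive.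
pose g l := egf (fun p => dyson A B (p + l)%N j a k).
have dE x : dyson_deriv A B j a k x = g 1%N x.
  by rewrite dyson_derivE /g; under [in RHS]eq_fun do rewrite addn1.
move=> x y hx hy; rewrite !dE; apply: (@is_derive_lipschitz _ (g 1%N) (g 2%N) 0 1 _ _ _ x y hx hy).
  move=> u hu; rewrite /g.
  have -> : (fun p => dyson A B (p + 2) j a k) =
      (fun p => dyson A B (p + 1) j a k) \o succn by apply/funext => p /=; rewrite addn2 addn1.
  by apply: (egf_derive u M1 (L := M ^+ 2)) => p; exact: shift.
by move=> u hu; exact: bnd.
Qed.

End DysonBounds.

Section PhiDyson.
Context {R : realType}.
Variables (n : nat) (lam mu : R) (S : 'M[R]_n).

Lemma A0A1_dyson_eq0 m j : (m.+1 < 2 * j)%N ->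
  dyson (A0 lam mu S) (A1 n lam) m j = 0.
Proof. exact: block_dyson_eq0. Qed.

(** For negative z the integral over [[0, z]] is one over the empty set and has the value 0, hence
    the restriction on z. *)
Lemma phi_col_dyson k j z a : 0 <= z ->
  phi_col lam mu S k j z a 0 = dyson_fun (A0 lam mu S) (A1 n lam) j a k z.
Proof.
elim: j z a => [|j IH] z a z0 /=.
  rewrite mxE (bigD1 k)//= big1 => [|b bk].
    by rewrite addr0 mxE !eqxx mulr1 (expmx_dyson _ (A1 n lam)).
  by rewrite mxE (negbTE bk) mulr0.
rewrite mxE -dyson_fun_rec//; apply: eq_Rintegral => x /set_mem/=.
rewrite in_itv/= => /andP[x0 xz]; rewrite mxE; apply: eq_bigr => c _.
rewrite mxE IH//; congr (_ * _); apply: eq_bigr => b _.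
by rewrite (expmx_dyson _ (A1 n lam)).
Qed.

Lemma Phi_dyson j z a k : 0 <= z ->
  Phi lam mu S j z a k = dyson_fun (A0 lam mu S) (A1 n lam) j a k z.
Proof. by move=> z0; rewrite mxE phi_col_dyson. Qed.

End PhiDyson.

(** * The series over time derivatives *)

Section DysonSeries.
Context {R : realType}.
Variables (d : nat) (A B : 'M[R]_d) (alpha t0 : R) (X : Type) (D : set X).
Variable f : 'I_d -> nat -> X -> R -> R.
Hypothesis dyson_eq0 : forall n j, (n.+1 < 2 * j)%N -> dyson A B n j = 0.
Hypothesis alpha_bounds : 0 <= alpha < 2.
Hypothesis f_jet : forall k, gevrey_jet alpha t0 D (f k).

(** The offset [m] counts additional time derivatives: differentiating the series in time replaces m
    by m + 1. *)
Definition dyson_term m a s x t j : R :=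
  \sum_k dyson_fun A B j a k s * f k (j + m)%N x t.

Definition dyson_series m a s x t : R := sums (dyson_term m a s x t).

Definition dyson_series_deriv m a s x t : R :=
  \sum_b A a b * dyson_series m b s x t + \sum_b B a b * dyson_series m.+1 b s x t.

Lemma gevrey_jet_common_bound a b : t0 < a -> exists M r, [/\ 0 <= M, 0 <= r &
  forall k j x t, D x -> a <= t <= b -> `|f k j x t| <= M * (r ^+ j * j`!%:R `^ alpha)].
Proof.
move=> ha; have H k := (f_jet k).2 a b ha.
pose M k := sval (cid (H k)); have H1 k := svalP (cid (H k)).
pose r k := sval (cid (H1 k)); have H2 k : [/\ 0 <= M k, 0 <= r k &
  forall j x t, D x -> a <= t <= b -> `|f k j x t| <= M k * r k ^+ j * j`!%:R `^ alpha].
  exact: svalP (cid (H1 k)).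
have sum_le (g : 'I_d -> R) k : (forall i, 0 <= g i) -> g k <= \sum_i g i.
  by move=> g0; rewrite (bigD1 k)//= lerDl sumr_ge0.
have M0 k : 0 <= M k by case: (H2 k).
have r0 k : 0 <= r k by case: (H2 k).
exists (\sum_k M k), (\sum_k r k); split; [by rewrite sumr_ge0..|].
move=> k j x t Dx ht; have [_ _ h] := H2 k; apply: (le_trans (h j x t Dx ht)).
rewrite -mulrA ler_pM ?mulr_ge0 ?exprn_ge0 ?powR_ge0// ?sum_le//.
by rewrite ler_wpM2r ?powR_ge0// lerXn2r ?nnegrE ?sumr_ge0// sum_le.
Qed.

(** A single summable majorant for the values and for the remainders in space and in time, so that
    each passes to the sum by comparison. *)
Lemma dyson_term_majorant a b m : t0 < a -> exists w : nat -> R,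
  [/\ forall j, 0 <= w j, cvgn (series w),
   forall i s x t j, 0 <= s <= 1 -> D x -> a <= t <= b ->
     `|dyson_term m i s x t j| <= w j,
   forall i s s' x t j, 0 <= s <= 1 -> 0 <= s' <= 1 -> D x -> a <= t <= b ->
     `|dyson_term m i s' x t j - dyson_term m i s x t j -
       (s' - s) * \sum_k dyson_deriv A B j i k s * f k (j + m)%N x t|
     <= w j * (s' - s) ^+ 2 &
   forall i s x t t' j, 0 <= s <= 1 -> D x -> a <= t <= b -> a <= t' <= b ->
     `|dyson_term m i s x t' j - dyson_term m i s x t j -
       (t' - t) * dyson_term m.+1 i s x t j| <= w j * (t' - t) ^+ 2].
Proof.
move=> ha; have [M [r [M0 r0 fM]]] := gevrey_jet_common_bound b ha.
have [K [Y [K0 Y0 pK pQ]]] := dyson_fun_bounds dyson_eq0.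
pose w0 p j := Y ^+ j / j`!%:R ^+ 2 * (r ^+ (j + p) * (j + p)`!%:R `^ alpha).
have w00 p j : 0 <= w0 p j.
  by rewrite mulr_ge0// ?divr_ge0 ?mulr_ge0 ?exprn_ge0 ?powR_ge0.
pose C := d%:R * (K * M); have C0 : 0 <= C by rewrite !mulr_ge0.
have key p j (u v : 'I_d -> R) (h : R) :
    (forall k, `|u k| <= K * (Y ^+ j / j`!%:R ^+ 2) * `|h|) ->
    (forall k, `|v k| <= M * (r ^+ (j + p) * (j + p)`!%:R `^ alpha)) ->
    `|\sum_k u k * v k| <= C * w0 p j * `|h|.
  move=> hu hv; rewrite (le_trans (ler_norm_sum _ _ _))//.
  apply: (@le_trans _ _ (\sum_(k < d) K * M * w0 p j * `|h|)).
    apply: ler_sum => k _; rewrite normrM.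
    apply: (le_trans (ler_pM _ _ (hu k) (hv k))) => //.
    by rewrite le_eqVlt; apply/orP; left; apply/eqP; rewrite /w0; ring.
  by rewrite sumr_const card_ord -mulr_natl /C !mulrA.
have cw p : cvgn (series (fun j => C * w0 p j)).
  have G := @gevrey_weight_series R Y r alpha p Y0 r0 alpha_bounds.
  have [+ _] := cvg_series_lin C 0 G G.
  by congr (cvgn (series _)); apply/funext => j; rewrite mul0r addr0.
(* The weight for m serves the values and the space remainder; the time remainder involves two more
   time derivatives. *)
pose w j := 1 * (C * w0 m j) + 1 * (C * w0 m.+2 j).
have w1 j : C * w0 m j <= w j by rewrite /w !mul1r lerDl mulr_ge0.
have w2 j : C * w0 m.+2 j <= w j by rewrite /w !mul1r lerDr mulr_ge0.
exists w; split.
- by move=> j; rewrite (le_trans _ (w1 j))// mulr_ge0.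
- exact: (cvg_series_lin 1 1 (cw m) (cw m.+2)).1.
- move=> i s x t j hs Dx ht; apply: le_trans (w1 j).
  rewrite -[leRHS]mulr1 -[1]normr1; apply: key => // k.
    by rewrite normr1 mulr1 pK.
  exact: fM.
- move=> i s s' x t j hs hs' Dx ht; apply: le_trans (ler_wpM2r (sqr_ge0 _) (w1 j)).
  rewrite mulr_sumr /dyson_term -!sumrB -[X in _ * X]ger0_norm ?sqr_ge0//.
  under eq_bigr do rewrite mulrA -!mulrBl.
  by apply: key => // k; [rewrite (ger0_norm (sqr_ge0 _)) pQ | exact: fM].
- move=> i s x t t' j hs Dx ht ht'; apply: le_trans (ler_wpM2r (sqr_ge0 _) (w2 j)).
  rewrite mulr_sumr /dyson_term -!sumrB.
  (* The square moves to the first factor, so that the second is bounded by a second time derivative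
     as [key] requires; for t' = t the quotient has the value 0. *)
  rewrite (eq_bigr (fun k => (dyson_fun A B j i k s * (t' - t) ^+ 2) *
     ((f k (j + m)%N x t' - f k (j + m)%N x t - (t' - t) * f k (j + m).+1 x t) /
      (t' - t) ^+ 2))); last first.
    move=> k _; have [->|nz] := eqVneq t' t.
      by rewrite addnS !subrr expr0n/= !(mul0r, mulr0, subrr).
    by rewrite addnS; field; rewrite subr_eq0.
  rewrite -[X in _ <= _ * X]ger0_norm ?sqr_ge0//.
  apply: key => // k; first by rewrite normrM ler_wpM2r// pK.
  have [tt|nz] := eqVneq t' t.
    by rewrite tt !subrr !mul0r subrr mul0r normr0 mulr_ge0// mulr_ge0 ?exprn_ge0 ?powR_ge0.
  have sq : 0 < (t' - t) ^+ 2 by rewrite exprn_even_gt0//= subr_eq0.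
  rewrite normrM normfV (gtr0_norm sq) ler_pdivrMr//.
  have dG q u : a <= u <= b -> is_derive u 1 (f k q x) (f k q.+1 x u).
    by move=> /andP[au _]; apply: (f_jet k).1 => //; exact: lt_le_trans au.
  have B0 : 0 <= M * (r ^+ (j + m.+2) * (j + m.+2)`!%:R `^ alpha).
    by rewrite mulr_ge0// mulr_ge0 ?exprn_ge0 ?powR_ge0.
  apply: (is_derive_quad_remainder B0 (dG (j + m)%N) _ ht ht').
  apply: (is_derive_lipschitz (dG (j + m).+1)) => u hu.
  by have := fM k (j + m.+2)%N x u Dx hu; rewrite !addnS.
Qed.

Lemma dyson_series_cvg m i s x t : 0 <= s <= 1 -> D x -> t0 < t ->
  cvgn (series (dyson_term m i s x t)).
Proof.
move=> hs Dx ht; have [w [_ cw H _ _]] := dyson_term_majorant t m ht.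
by apply: (series_dominated _ cw).1 => j; apply: H; rewrite ?lexx.
Qed.

Lemma dyson_series_bounded a b m : t0 < a -> exists C, 0 <= C /\
  forall i s x t, 0 <= s <= 1 -> D x -> a <= t <= b -> `|dyson_series m i s x t| <= C.
Proof.
move=> ha; have [w [w0 cw H _ _]] := dyson_term_majorant b m ha.
exists (sums w); split.
  by rewrite limr_ge//; apply: nearW => p; rewrite /series/= sumr_ge0.
by move=> i s x t hs Dx ht; apply: (series_dominated _ cw).2 => j; exact: H.
Qed.

(** In the part of Phi_j' with B, shifting the index turns Phi_(j-1) d_t^j into Phi_j d_t^(j+1):
    this is how the time derivative enters the first-order system. *)
Lemma dyson_series_derivE m i s x t : 0 <= s <= 1 -> D x -> t0 < t ->
  let u j := \sum_k dyson_deriv A B j i k s * f k (j + m)%N x t in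
  cvgn (series u) /\ sums u = dyson_series_deriv m i s x t.
Proof.
move=> hs Dx ht u.
pose p b j := \sum_k dyson_prev A B j b k s * f k (j + m)%N x t.
have pS b : cvgn (series (p b)) /\ sums (p b) = dyson_series m.+1 b s x t.
  have E : (fun j => p b j.+1) = dyson_term m.+1 b s x t.
    by apply/funext => j; apply: eq_bigr => k _; rewrite /= addnS.
  have [||c1 c2] := @series_shift1 _ (p b).
  - by rewrite /p big1// => k _; rewrite mul0r.
  - by rewrite E; exact: dyson_series_cvg.
  - by split=> //; rewrite c2 E.
pose c (q : 'I_d + 'I_d) := match q with inl b => A i b | inr b => B i b end.
pose g (q : 'I_d + 'I_d) := match q with inl b => dyson_term m b s x t | inr b => p b end.
have cg q : cvgn (series (g q)).
  by case: q => b /=; [exact: dyson_series_cvg | exact: (pS b).1].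
have cz q := @is_cvg_seriesZ R _ (c q) (cg q).
have [h1 h2] := cvg_series_sum (index_enum _) cz.
have E : u = (fun j => \sum_q (c q *: g q) j).
  apply/funext => j; rewrite big_sumType/= /u /dyson_deriv.
  under [LHS]eq_bigr do rewrite /dyson_deriv mulrDl !mulr_suml.
  rewrite big_split/= exchange_big [X in _ + X]exchange_big/=; congr (_ + _);
    by apply: eq_bigr => b _; rewrite fctE /GRing.scale/= mulr_sumr;
      apply: eq_bigr => k _; rewrite mulrA.
rewrite E; split; first exact: h1.
rewrite h2 big_sumType/=; congr (_ + _); apply: eq_bigr => b _.
  by rewrite (@lim_seriesZ R)//; exact: dyson_series_cvg.
by have [h3 <-] := pS b; rewrite (@lim_seriesZ R _ _ h3).
Qed.

Lemma dyson_series_quad_space a b m : t0 < a -> exists C, 0 <= C /\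
  forall i s s' x t, 0 <= s <= 1 -> 0 <= s' <= 1 -> D x -> a <= t <= b ->
    `|dyson_series m i s' x t - dyson_series m i s x t -
      (s' - s) * dyson_series_deriv m i s x t| <= C * (s' - s) ^+ 2.
Proof.
move=> ha; have [w [w0 cw _ H _]] := dyson_term_majorant b m ha.
exists (sums w); split.
  by rewrite limr_ge//; apply: nearW => p; rewrite /series/= sumr_ge0.
move=> i s s' x t hs hs' Dx ht.
have t0t : t0 < t by case/andP: ht => h _; exact: lt_le_trans h.
have [c1 <-] := dyson_series_derivE m i hs Dx t0t.
apply: series_quad => //; try exact: dyson_series_cvg.
by move=> j; exact: H.
Qed.

Lemma dyson_series_quad_time a b m : t0 < a -> exists C, 0 <= C /\
  forall i s x t t', 0 <= s <= 1 -> D x -> a <= t <= b -> a <= t' <= b ->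
    `|dyson_series m i s x t' - dyson_series m i s x t -
      (t' - t) * dyson_series m.+1 i s x t| <= C * (t' - t) ^+ 2.
Proof.
move=> ha; have [w [w0 cw _ _ H]] := dyson_term_majorant b m ha.
exists (sums w); split.
  by rewrite limr_ge//; apply: nearW => p; rewrite /series/= sumr_ge0.
move=> i s x t t' hs Dx ht ht'.
have gt_t0 u : a <= u <= b -> t0 < u by case/andP => h _; exact: lt_le_trans h.
apply: series_quad => //; try by apply: dyson_series_cvg => //; exact: gt_t0.
by move=> j; exact: H.
Qed.

Lemma dyson_series_at0 m i x t : dyson_series m i 0 x t = f i m x t.
Proof.
rewrite /dyson_series; apply: cvg_lim => //; rewrite -cvg_shiftS/=.
rewrite [X in X @ _ --> _](_ : _ = cst (f i m x t)); first exact: cvg_cst.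
apply/funext => p; rewrite /series/= big_nat_recl//= [X in _ + X]big1 ?addr0.
  rewrite /dyson_term (bigD1 i)//= dyson_fun_at0 !eqxx/= mul1r big1 ?addr0// => k ki.
  by rewrite dyson_fun_at0 eq_sym (negbTE ki) andbF mul0r.
by move=> j _; rewrite /dyson_term big1// => k _; rewrite dyson_fun_at0 mul0r.
Qed.

End DysonSeries.

Section DysonSeriesMeasurable.
Context {R : realType}.
Variables (d : nat) (A B : 'M[R]_d) (alpha t0 : R) (D : set R).
Variable f : 'I_d -> nat -> R -> R -> R.
Hypothesis dyson_eq0 : forall n j, (n.+1 < 2 * j)%N -> dyson A B n j = 0.
Hypothesis alpha_bounds : 0 <= alpha < 2.
Hypothesis f_jet : forall k, gevrey_jet alpha t0 D (f k).

(** The maps [s] and [g] are kept general because the integrand occurs both with arguments (z - x,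
    x) and, reflected, with (x, z - x). *)
Lemma dyson_series_measurable (E : set R) (s g : R -> R) m i t : measurable E -> t0 < t ->
  measurable_fun E s -> (forall x, E x -> 0 <= s x <= 1 /\ D (g x)) ->
  (forall k j, measurable_fun E (fun x => f k j (g x) t)) ->
  measurable_fun E (fun x => dyson_series A B f m i (s x) (g x) t).
Proof.
move=> mE ht ms hE mf.
pose q (p : nat) x := series (dyson_term A B f m i (s x) (g x) t) p.
apply: (@measurable_fun_cvg _ _ _ _ q) => [p|x Ex]; last first.
  have [hs hg] := hE x Ex.
  exact: (dyson_series_cvg dyson_eq0 alpha_bounds f_jet).
rewrite /q /series/=; apply: measurable_sum => j; apply: measurable_sum => k.
apply: measurable_funM => //; apply: measurableT_comp => //.
by apply: continuous_measurable_fun; exact: dyson_fun_continuous.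
Qed.

End DysonSeriesMeasurable.

(** * Convolution of the series with a source that may jump in space *)

Section DysonConvolution.
Context {R : realType}.
Variables (d : nat) (A B : 'M[R]_d) (alpha t0 : R).
Variable f : 'I_d -> nat -> R -> R -> R.
Hypothesis dyson_eq0 : forall n j, (n.+1 < 2 * j)%N -> dyson A B n j = 0.
Hypothesis alpha_bounds : 0 <= alpha < 2.
Hypothesis f_jet : forall k, gevrey_jet alpha t0 `[0, 1] (f k).
Hypothesis f_measurable : forall k t, t0 < t ->
  measurable_fun (`[0, 1]%classic : set R) (f k 0%N ^~ t).

Notation mu := (@lebesgue_measure R).
Notation V := (dyson_series A B f).
Notation V' := (dyson_series_deriv A B f).

Lemma mem01 (x : R) : 0 <= x <= 1 -> `[0, 1]%classic x.
Proof. by rewrite /= in_itv. Qed.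

Lemma jet_bounded_measurable k j t : t0 < t -> bounded_measurable 0 1 (f k j ^~ t).
Proof.
move=> ht; split.
  apply: (gevrey_jet_measurable (G := f k) _ _ (f_measurable k) j ht) => //.
  by move=> i x s hx hs; apply: (f_jet k).1.
have [C [_ H]] := gevrey_jet_bounded (f_jet k) t j ht.
by exists C => x hx; apply: H; [exact: mem01 | rewrite !lexx].
Qed.

Lemma dyson_series_bounded_measurable m i u v z t : 0 <= u -> v <= z -> z <= 1 -> t0 < t ->
  bounded_measurable u v (fun x => V m i (z - x) x t).
Proof.
move=> u0 vz z1 ht; split.
  apply: (dyson_series_measurable dyson_eq0 alpha_bounds f_jet) => //.
  - exact: measurable_funB.
  - by move=> x /=; rewrite !in_itv/= => /andP[ux xv]; split; apply/andP; split; lra.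
  - move=> k j; apply: measurable_funS (jet_bounded_measurable k j ht).1 => //.
    by apply: subset_itv; rewrite bnd_simp// (le_trans vz).
have [C [_ H]] := dyson_series_bounded dyson_eq0 alpha_bounds f_jet t m ht.
exists C => x /andP[ux xv]; apply: H; rewrite ?lexx//; first by apply/andP; split; lra.
by apply: mem01; apply/andP; split; lra.
Qed.

Lemma dyson_series_deriv_bounded_measurable m i u v z t : 0 <= u -> v <= z -> z <= 1 -> t0 < t ->
  bounded_measurable u v (fun x => V' m i (z - x) x t).
Proof.
move=> u0 vz z1 ht.
have cst_bm (c : R) : bounded_measurable u v (fun=> c) by split => //; exists `|c|.
have S (a : 'I_d -> R) p : bounded_measurable u v (fun x => \sum_b a b * V p b (z - x) x t).
  apply: bounded_measurable_sum => b; apply: bounded_measurableM => //.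
  exact: dyson_series_bounded_measurable.
have := bounded_measurable_lin 1 1 (S (A i) m) (S (B i) m.+1).
by congr bounded_measurable; apply/funext => x; rewrite !mul1r.
Qed.

Lemma sum_coef_bound (C : 'M[R]_d) i (v : 'I_d -> R) (K : R) :
  (forall b, `|v b| <= K) -> `|\sum_b C i b * v b| <= (\sum_a \sum_b `|C a b|) * K.
Proof.
move=> vK; rewrite (le_trans (ler_norm_sum _ _ _))//.
apply: (@le_trans _ _ ((\sum_b `|C i b|) * K)).
  by rewrite mulr_suml ler_sum// => b _; rewrite normrM ler_wpM2l.
case: d C i v vK => [|d'] C i v vK; first by case: i.
have K0 : 0 <= K by apply: le_trans (vK ord0).
rewrite ler_wpM2r// [leRHS](bigD1 i)//= lerDl sumr_ge0// => a _.
by rewrite sumr_ge0.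
Qed.

Lemma dyson_series_deriv_bounded a b m : t0 < a -> exists C, 0 <= C /\
  forall i (s x t : R), 0 <= s <= 1 -> 0 <= x <= 1 -> a <= t <= b -> `|V' m i s x t| <= C.
Proof.
move=> ha; have bd p := dyson_series_bounded dyson_eq0 alpha_bounds f_jet b p ha.
have [C [C0 HC]] := bd m; have [C' [C'0 HC']] := bd m.+1.
exists ((\sum_i \sum_j `|A i j|) * C + (\sum_i \sum_j `|B i j|) * C'); split.
  by rewrite addr_ge0// mulr_ge0// sumr_ge0// => i _; rewrite sumr_ge0.
move=> i s x t hs /mem01 hx ht; rewrite (le_trans (ler_normD _ _))//.
by rewrite lerD// sum_coef_bound// => j; [exact: HC | exact: HC'].
Qed.

Definition dyson_conv m i z t : R := \int[mu]_(x in `[0, z]) V m i (z - x) x t.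
Notation W := dyson_conv.

(** The part of the z-derivative that comes from the integrand; the moving end point adds V(0, z),
    the source itself. *)
Definition dyson_conv_deriv m i z t : R :=
  \sum_b A i b * W m b z t + \sum_b B i b * W m.+1 b z t.
Notation W' := dyson_conv_deriv.

Lemma dyson_conv_derivE m i z t : 0 <= z <= 1 -> t0 < t ->
  \int[mu]_(x in `[0, z]) V' m i (z - x) x t = W' m i z t.
Proof.
move=> /andP[z0 z1] ht.
have bm p b : bounded_measurable 0 z (fun x => V p b (z - x) x t).
  exact: dyson_series_bounded_measurable.
have cst_bm (c : R) : bounded_measurable 0 z (fun=> c) by split => //; exists `|c|.
have bmc c p b : bounded_measurable 0 z (fun x => c * V p b (z - x) x t).
  exact: bounded_measurableM.
have S (a : 'I_d -> R) p : bounded_measurable 0 z (fun x => \sum_b a b * V p b (z - x) x t).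
  exact: bounded_measurable_sum.
have E (a : 'I_d -> R) p : \int[mu]_(x in `[0, z]) (\sum_b a b * V p b (z - x) x t) =
    \sum_b a b * W p b z t.
  rewrite Rintegral_sum//; apply: eq_bigr => b _.
  by rewrite RintegralZl//; exact: bounded_measurable_integrable.
have := Rintegral_lin 1 1 (S (A i) m) (S (B i) m.+1).
rewrite !E !mul1r /dyson_conv_deriv => <-; apply: eq_Rintegral => x _.
by rewrite !mul1r.
Qed.

Lemma dyson_conv_bounded a b m : t0 < a -> exists C, 0 <= C /\
  forall i (z t : R), 0 <= z <= 1 -> a <= t <= b -> `|W m i z t| <= C.
Proof.
move=> ha; have [C [C0 H]] := dyson_series_bounded dyson_eq0 alpha_bounds f_jet b m ha.
exists C; split => // i z t /andP[z0 z1] ht.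
have t0t : t0 < t by case/andP: ht => h _; exact: lt_le_trans h.
apply: (@le_trans _ _ (C * (z - 0))); last by rewrite subr0 ler_piMr.
apply: Rintegral_bound => //; first exact: (dyson_series_bounded_measurable m i _ _ _ t0t).1.
move=> x /andP[x0 xz]; apply: H => //; first by apply/andP; split; lra.
by apply: mem01; apply/andP; split; lra.
Qed.

Lemma dyson_conv_quad_time a b m : t0 < a -> exists C, 0 <= C /\
  forall i (z t t' : R), 0 <= z <= 1 -> a <= t <= b -> a <= t' <= b ->
    `|W m i z t' - W m i z t - (t' - t) * W m.+1 i z t| <= C * (t' - t) ^+ 2.
Proof.
move=> ha; have [C [C0 H]] := dyson_series_quad_time dyson_eq0 alpha_bounds f_jet b m ha.
exists C; split => // i z t t' /andP[z0 z1] ht ht'.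
have gt_t0 u : a <= u <= b -> t0 < u by case/andP => h _; exact: lt_le_trans h.
apply: (@le_trans _ _ (C * (t' - t) ^+ 2 * (z - 0))); last first.
  by rewrite subr0 ler_piMr// mulr_ge0// sqr_ge0.
apply: Rintegral_quad => //; try by apply: dyson_series_bounded_measurable => //; exact: gt_t0.
move=> x /andP[x0 xz]; apply: H => //; first by apply/andP; split; lra.
by apply: mem01; apply/andP; split; lra.
Qed.

(** On [0, z] the space remainder is integrated. On [z, z'] the series differs from its value [f] at
    zero argument by at most (C + K) (z' - z), and the interval has length z' - z. The integral of
    [f] is left as it stands because [f] may jump. *)
Lemma dyson_conv_step a b m : t0 < a -> exists C, 0 <= C /\
  forall i (z z' t : R), 0 <= z -> z <= z' -> z' <= 1 -> a <= t <= b ->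
    `|W m i z' t - W m i z t - (z' - z) * W' m i z t -
      \int[mu]_(x in `[z, z']) f i m x t| <= C * (z' - z) ^+ 2.
Proof.
move=> ha.
have [C [C0 HC]] := dyson_series_quad_space dyson_eq0 alpha_bounds f_jet b m ha.
have [K [K0 HK]] := dyson_series_deriv_bounded b m ha.
exists (C + (C + K)); split; first by rewrite !addr_ge0.
move=> i z z' t z0 zz' z'1 ht; have z1 : z <= 1 by apply: le_trans z'1.
have t0t : t0 < t by case/andP: ht => h _; exact: lt_le_trans h.
pose I1 := \int[mu]_(x in `[0, z]) V m i (z' - x) x t.
pose I2 := \int[mu]_(x in `[z, z']) V m i (z' - x) x t.
have E : W m i z' t = I1 + I2.
  by apply: Rintegral_cat => //; exact: dyson_series_bounded_measurable.
have h1 : `|I1 - W m i z t - (z' - z) * W' m i z t| <= C * (z' - z) ^+ 2.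
  rewrite -dyson_conv_derivE ?z0//.
  apply: (@le_trans _ _ (C * (z' - z) ^+ 2 * (z - 0))); last first.
    by rewrite subr0 ler_piMr// mulr_ge0// sqr_ge0.
  apply: Rintegral_quad => //;
    [exact: dyson_series_bounded_measurable..|exact: dyson_series_deriv_bounded_measurable|].
  move=> x /andP[x0 xz].
  have hx : 0 <= x <= 1 by apply/andP; split; lra.
  have s1 : 0 <= z - x <= 1 by apply/andP; split; lra.
  have s2 : 0 <= z' - x <= 1 by apply/andP; split; lra.
  have := HC i (z - x) (z' - x) x t s1 s2 (mem01 hx) ht.
  by rewrite opprB addrA subrK.
have h2 : `|I2 - \int[mu]_(x in `[z, z']) f i m x t| <= (C + K) * (z' - z) ^+ 2.
  have bf : bounded_measurable z z' (f i m ^~ t).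
    by apply: bounded_measurable_sub (jet_bounded_measurable i m t0t).
  have bV : bounded_measurable z z' (fun x => V m i (z' - x) x t).
    exact: dyson_series_bounded_measurable.
  rewrite expr2 mulrA; apply: Rintegral_dist => // x /andP[zx xz'].
  have hx : 0 <= x <= 1 by apply/andP; split; lra.
  have hs : 0 <= z' - x <= 1 by apply/andP; split; lra.
  have h0 : 0 <= z - z <= 1 by apply/andP; split; lra.
  rewrite subrr in h0; have := HC i 0 (z' - x) x t h0 hs (mem01 hx) ht.
  rewrite dyson_series_at0 subr0 => q.
  have k := HK i 0 x t h0 hx ht.
  have s0 : 0 <= z' - x by lra.
  rewrite -[X in `|X|](subrK ((z' - x) * V' m i 0 x t)) (le_trans (ler_normD _ _))//.
  rewrite [leRHS]mulrDl lerD//.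
    apply: (le_trans q); rewrite ler_wpM2l// expr2; apply: (@le_trans _ _ ((z' - x) * 1)).
      by rewrite ler_wpM2l//; lra.
    by lra.
  by rewrite normrM (ger0_norm s0) mulrC ler_pM//; lra.
rewrite [leRHS]mulrDl E; apply: le_trans (lerD h1 h2); apply: le_trans (ler_normD _ _).
by rewrite le_eqVlt; apply/orP; left; apply/eqP; congr `|_|; ring.
Qed.

Lemma dyson_conv_lipschitz a b m : t0 < a -> exists C, 0 <= C /\
  forall i (z z' t : R), 0 <= z <= 1 -> 0 <= z' <= 1 -> a <= t <= b ->
    `|W m i z' t - W m i z t| <= C * `|z' - z|.
Proof.
move=> ha; have [C [C0 HC]] := dyson_conv_step b m ha.
have [C1 [C10 H1]] := dyson_conv_bounded b m ha.
have [C2 [C20 H2]] := dyson_conv_bounded b m.+1 ha.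
have [M [r [M0 r0 HM]]] := gevrey_jet_common_bound f_jet b ha.
pose F := M * (r ^+ m * m`!%:R `^ alpha).
have F0 : 0 <= F by rewrite !mulr_ge0 ?exprn_ge0 ?powR_ge0.
pose K := (\sum_i \sum_j `|A i j|) * C1 + (\sum_i \sum_j `|B i j|) * C2.
have K0 : 0 <= K.
  by rewrite addr_ge0// mulr_ge0// sumr_ge0// => i _; rewrite sumr_ge0.
exists (C + K + F); split; first by rewrite addr_ge0// addr_ge0.
move=> i; have key (z z' t : R) : 0 <= z -> z <= z' -> z' <= 1 -> a <= t <= b ->
    `|W m i z' t - W m i z t| <= (C + K + F) * (z' - z).
  move=> z0 zz' z'1 ht; have t0t : t0 < t by case/andP: ht => h _; exact: lt_le_trans h.
  have h := HC i z z' t z0 zz' z'1 ht.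
  have hz : 0 <= z <= 1 by rewrite z0 (le_trans zz' z'1).
  have hW : `|W' m i z t| <= K.
    rewrite (le_trans (ler_normD _ _))// lerD// sum_coef_bound// => j; [exact: H1|exact: H2].
  have hI : `|\int[mu]_(x in `[z, z']) f i m x t| <= F * (z' - z).
    apply: Rintegral_bound => //.
      by apply: (bounded_measurable_sub z0 z'1 (jet_bounded_measurable i m t0t)).1.
    by move=> x /andP[zx xz']; apply: HM => //; apply: mem01; apply/andP; split; lra.
  have s0 : 0 <= z' - z by lra.
  rewrite -[X in `|X|](subrK ((z' - z) * W' m i z t)).
  rewrite -[X in `|X + _|](subrK (\int[mu]_(x in `[z, z']) f i m x t)).
  rewrite (le_trans (ler_normD _ _))//.
  rewrite [leRHS](_ : _ = (C * (z' - z) + F * (z' - z)) + (z' - z) * K); last by ring.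
  rewrite lerD//; last by rewrite normrM (ger0_norm s0) ler_wpM2l.
  rewrite (le_trans (ler_normD _ _))// lerD// (le_trans h)// ler_wpM2l// expr2.
  by rewrite ler_piMr//; lra.
move=> z z' t /andP[z0 z1] /andP[z'0 z'1] ht.
have [zz'|/ltW zz'] := leP z z'.
  by rewrite [X in _ * X]ger0_norm ?subr_ge0// key.
by rewrite distrC [X in _ * X]distrC [X in _ * X]ger0_norm ?subr_ge0// key.
Qed.

(* The case c = e = 0 applies to the components without source, and e -> 0 to the
   others at points where the source is continuous. *)
Lemma dyson_conv_increment a b m : t0 < a -> exists C, 0 <= C /\
  forall i (z z' t c e : R), 0 <= z <= 1 -> 0 <= z' <= 1 -> a <= t <= b ->
    (forall x, Num.min z z' <= x <= Num.max z z' -> `|f i m x t - c| <= e) ->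
    `|W m i z' t - W m i z t - (z' - z) * (W' m i z t + c)| <=
      C * (z' - z) ^+ 2 + e * `|z' - z|.
Proof.
move=> ha; have [C [C0 HC]] := dyson_conv_step b m ha.
have [C1 [C10 H1]] := dyson_conv_lipschitz b m ha.
have [C2 [C20 H2]] := dyson_conv_lipschitz b m.+1 ha.
pose K := (\sum_i \sum_j `|A i j|) * C1 + (\sum_i \sum_j `|B i j|) * C2.
have K0 : 0 <= K.
  by rewrite addr_ge0// mulr_ge0// sumr_ge0// => i _; rewrite sumr_ge0.
exists (C + K); split; first by rewrite addr_ge0.
move=> i; have hI (z z' t c e : R) : 0 <= z -> z <= z' -> z' <= 1 -> a <= t <= b ->
    (forall x, z <= x <= z' -> `|f i m x t - c| <= e) ->
    `|\int[mu]_(x in `[z, z']) f i m x t - (z' - z) * c| <= e * (z' - z).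
  move=> z0 zz' z'1 ht H; have t0t : t0 < t by case/andP: ht => h _; exact: lt_le_trans h.
  have bf : bounded_measurable z z' (f i m ^~ t).
    by apply: bounded_measurable_sub (jet_bounded_measurable i m t0t).
  have bc u : bounded_measurable z z' (fun=> u : R) by split => //; exists `|u|.
  have -> : (z' - z) * c = \int[mu]_(x in `[z, z']) c.
    rewrite Rintegral_cst//= lebesgue_measure_itv/= lte_fin mulrC.
    by case: ltgtP zz' => //= -> _; rewrite subrr.
  exact: Rintegral_dist.
have hW' (z z' t : R) : 0 <= z <= 1 -> 0 <= z' <= 1 -> a <= t <= b ->
    `|W' m i z' t - W' m i z t| <= K * `|z' - z|.
  move=> hz hz' ht; rewrite /dyson_conv_deriv.
  rewrite [X in `|X|](_ : _ = \sum_b A i b * (W m b z' t - W m b z t) +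
    \sum_b B i b * (W m.+1 b z' t - W m.+1 b z t)); last first.
    under [X in _ = X + _]eq_bigr do rewrite mulrBr.
    under [X in _ = _ + X]eq_bigr do rewrite mulrBr.
    by rewrite !sumrB opprD addrACA.
  rewrite mulrDl (le_trans (ler_normD _ _))// -!mulrA.
  by rewrite lerD// sum_coef_bound// => j; [exact: H1|exact: H2].
have alg1 (p p' r s v u : R) :
    p' - p - r * (s + v) = (p' - p - r * s - u) + (u - r * v) by ring.
have alg2 (p p' r r' s s' v u : R) :
    (r' - r) * (s + v) - (p' - p) =
    (p - p' - (r - r') * s' - u) + (u - (r - r') * v) + (r - r') * (s' - s) by ring.
move=> z z' t c e /andP[z0 z1] /andP[z'0 z'1] ht H.
have [zz'|/ltW zz'] := leP z z'.
  rewrite (min_idPl zz') (max_idPr zz') in H.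
  have h := HC i z z' t z0 zz' z'1 ht; have h' := hI z z' t c e z0 zz' z'1 ht H.
  rewrite [X in e * X]ger0_norm ?subr_ge0//.
  apply: (@le_trans _ _ (C * (z' - z) ^+ 2 + e * (z' - z))).
    apply: le_trans (lerD h h'); apply: le_trans (ler_normD _ _).
    by rewrite -alg1.
  by rewrite lerD2r ler_wpM2r ?sqr_ge0// lerDl.
(* Going left, the estimate starts at z' and yields W' there; its Lipschitz bound brings W' back to
   z at the cost K (z' - z)^2. *)
rewrite (min_idPr zz') (max_idPl zz') in H.
have h := HC i z' z t z'0 zz' z1 ht; have h' := hI z' z t c e z'0 zz' z1 ht H.
have h2 := hW' z z' t _ _ ht; rewrite z0 z1 z'0 z'1 in h2; have {}h2 := h2 isT isT.
have s0 : 0 <= z - z' by lra.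
rewrite distrC [X in e * X]distrC (ger0_norm s0).
have h3 : `|(z - z') * (W' m i z' t - W' m i z t)| <= K * (z' - z) ^+ 2.
  rewrite normrM (ger0_norm s0) (le_trans (ler_wpM2l s0 h2))//.
  by rewrite distrC (ger0_norm s0) mulrCA -expr2 -[in leRHS]sqrrN opprB.
have -> : (C + K) * (z' - z) ^+ 2 + e * (z - z') =
    C * (z - z') ^+ 2 + e * (z - z') + K * (z' - z) ^+ 2.
  by rewrite -sqrrN opprB mulrDl addrAC.
apply: le_trans (lerD (lerD h h') h3).
apply: le_trans (lerD (ler_normD _ _) (lexx _)); apply: le_trans (ler_normD _ _).
by rewrite -alg2.
Qed.

End DysonConvolution.

(** * Regularity of the source *)

Section PiecewiseContinuous.
Context {R : realType}.
Implicit Types (z : R) (s : seq R).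

Lemma punctured_avoid s z : exists2 e : R, 0 < e &
  forall x, `|x - z| < e -> x != z -> x \notin s.
Proof.
elim: s => [|a s [e e0 He]]; first by exists 1.
have [az|az] := eqVneq a z.
  exists e => // x xe xz; rewrite in_cons negb_or az xz/=; exact: He.
exists (Num.min e `|a - z|); first by rewrite lt_min e0 normr_gt0 subr_eq0.
move=> x; rewrite lt_min => /andP[xe xa] xz; rewrite in_cons negb_or He// andbT.
by apply/eqP => xE; rewrite xE ltxx in xa.
Qed.

Lemma near_dist (e z : R) : 0 < e -> \forall x \near z, `|x - z| < e.
Proof. by move=> e0; exists e => // x /=; rewrite distrC. Qed.

Lemma near_right_dist (e z : R) : 0 < e -> \forall x \near z^'+, `|x - z| < e.
Proof. by move=> e0; exists e => // x /=; rewrite distrC. Qed.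

Lemma near_left_dist (e z : R) : 0 < e -> \forall x \near z^'-, `|x - z| < e.
Proof. by move=> e0; exists e => // x /=; rewrite distrC. Qed.

(** A one-sided limit ignores the point itself, and near it the finite set [s] is avoided. Needed
    for phi_zz, which is identified only where the source is continuous. *)
Lemma piecewise_continuous_eq_off {V : topologicalType} (f g : R -> V) s :
  piecewise_continuous01 f ->
  (forall z, 0 < z < 1 -> z \notin s -> g z = f z) -> piecewise_continuous01 g.
Proof.
move=> [[s' cf] fr fl] gf; split.
- exists (s' ++ s) => z hz; rewrite mem_cat negb_or => /andP[zs' zs].
  have [e e0 He] := punctured_avoid s z; case/andP: (hz) => z0 z1.
  suff E : \forall x \near z, g x = f x.
    rewrite /prop_for /continuous_at (gf z hz zs).
    by apply: cvg_trans (cf z hz zs'); apply: near_eq_cvg; near do apply/esym.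
  near=> x; apply: gf; first by apply/andP; split; near: x; [exact: lt_nbhsr|exact: lt_nbhsl].
  have [->//|xz] := eqVneq x z; apply: He => //; near: x; exact: near_dist.
- move=> z hz; have [l hl] := fr z hz; exists l; apply: cvg_trans hl.
  have [e e0 He] := punctured_avoid s z; case/andP: (hz) => z0 z1.
  apply: near_eq_cvg; near=> x; apply/esym; apply: gf.
    apply/andP; split; last by near: x; exact: nbhs_right_lt.
    by apply: (le_lt_trans z0); near: x; exact: nbhs_right_gt.
  apply: He; first by near: x; exact: near_right_dist.
  by near: x; exact: nbhs_right_neq.
- move=> z hz; have [l hl] := fl z hz; exists l; apply: cvg_trans hl.
  have [e e0 He] := punctured_avoid s z; case/andP: (hz) => z0 z1.
  apply: near_eq_cvg; near=> x; apply/esym; apply: gf.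
    apply/andP; split; first by near: x; exact: nbhs_left_gt.
    by apply: lt_le_trans z1; near: x; exact: nbhs_left_lt.
  apply: He; first by near: x; exact: near_left_dist.
  by near: x; exact: nbhs_left_neq.
Unshelve. all: by end_near. Qed.

Lemma piecewise_continuous_lin (x y : R) (f g : R -> R) :
  piecewise_continuous01 f -> piecewise_continuous01 g ->
  piecewise_continuous01 (fun z => x * f z + y * g z).
Proof.
move=> [[s cf] fr fl] [[s' cg] gr gl]; split.
- exists (s ++ s') => z hz; rewrite mem_cat negb_or => /andP[zs zs'].
  apply: cvgD; apply: cvgMr; [exact: cf|exact: cg].
- move=> z hz; have [l hl] := fr z hz; have [l' hl'] := gr z hz.
  by exists (x * l + y * l'); apply: cvgD; apply: cvgMr.
- move=> z hz; have [l hl] := fl z hz; have [l' hl'] := gl z hz.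
  by exists (x * l + y * l'); apply: cvgD; apply: cvgMr.
Qed.

Lemma piecewise_continuous_mx m n (f : R -> 'M[R]_(m, n)) :
  (forall i j, piecewise_continuous01 (fun z => f z i j)) -> piecewise_continuous01 f.
Proof.
move=> H.
pose s i j := sval (cid (let: And3 h _ _ := H i j in h)).
have hs i j z : 0 < z < 1 -> z \notin s i j -> {for z, continuous (fun z => f z i j)}.
  exact: (svalP (cid (let: And3 h _ _ := H i j in h))).
split.
- exists (flatten [seq s p.1 p.2 | p <- enum {: 'I_m * 'I_n}]) => z hz zs.
  apply: cvg_mx_entries => i j; apply: hs => //; apply: contra zs => zs.
  by apply/flattenP; exists (s i j) => //; apply/mapP; exists (i, j); rewrite ?mem_enum.
- move=> z hz; have h i j : exists l : R, f x i j @[x --> z^'+] --> l.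
    by case: (H i j) => _ h _; exact: (h z hz).
  exists (\matrix_(i, j) sval (cid (h i j))).
  by apply: cvg_mx_entries => i j; rewrite mxE; exact: (svalP (cid (h i j))).
- move=> z hz; have h i j : exists l : R, f x i j @[x --> z^'-] --> l.
    by case: (H i j) => _ _ h; exact: (h z hz).
  exists (\matrix_(i, j) sval (cid (h i j))).
  by apply: cvg_mx_entries => i j; rewrite mxE; exact: (svalP (cid (h i j))).
Qed.

Lemma finite_measurable_fun s (f : R -> R) :
  measurable [set` s] /\ measurable_fun [set` s] f.
Proof.
elim: s => [|x s [ms mf]].
  by rewrite classical_sets.set_nil; split; [exact: measurable0 | exact: measurable_fun_set0].
rewrite (_ : [set` x :: s] = [set x] `|` [set` s]); last first.
  apply/seteqP; split => y /=; rewrite in_cons.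
    by move=> /predU1P.
  by move=> /predU1P.
split; first exact: measurableU.
by apply/measurable_funU => //; split => //; exact: measurable_fun_set1.
Qed.

(** The interval is covered by an open set of continuity points and a finite set, to which the two
    end points are added. *)
Lemma piecewise_continuous_measurable (f : R -> R) :
  piecewise_continuous01 f -> measurable_fun (`[0, 1]%classic : set R) f.
Proof.
move=> [[s cf] _ _]; pose E : set R := [set z | 0 < z < 1 /\ z \notin s].
have oE : open E.
  rewrite openE => z [hz zs]; case/andP: (hz) => z0 z1.
  have [e e0 He] := punctured_avoid s z; rewrite /interior; near=> x; split.
    by apply/andP; split; near: x; [exact: lt_nbhsr|exact: lt_nbhsl].
  have [->//|xz] := eqVneq x z; apply: He => //; near: x; exact: near_dist.
have [mF mfF] := finite_measurable_fun [:: 0, 1 & s] f.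
have mE : measurable_fun E f.
  by apply: open_continuous_measurable_fun => // z /set_mem[hz zs]; exact: cf.
have mEF : measurable_fun (E `|` [set` [:: 0, 1 & s]]) f.
  by apply/measurable_funU => //; exact: open_measurable.
apply: measurable_funS mEF; first by apply: measurableU => //; exact: open_measurable.
move=> z /=; rewrite in_itv/= => /andP[z0 z1].
have [zF|zF] := boolP (z \in [:: 0, 1 & s]); [by right|left].
move: zF; rewrite !in_cons !negb_or => /and3P[n0 n1 ns].
by split => //; rewrite !lt_neqAle z0 z1 n1 eq_sym n0.
Unshelve. all: by end_near. Qed.

Definition uniformly_continuous01 (f : R -> R) : Prop :=
  forall e : R, 0 < e -> exists2 d : R, 0 < d & forall z z', 0 <= z <= 1 -> 0 <= z' <= 1 ->
    `|z' - z| < d -> `|f z' - f z| <= e.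

Lemma uniformly_continuous01_piecewise (f : R -> R) :
  uniformly_continuous01 f -> piecewise_continuous01 f.
Proof.
move=> uf; split.
- exists [::] => z hz _; case/andP: (hz) => z0 z1; apply/cvgrPdist_le => e e0.
  have [d d0 H] := uf e e0; near=> x; rewrite distrC; apply: H.
  + by rewrite !ltW.
  + by apply/andP; split; apply: ltW; near: x; [exact: lt_nbhsr|exact: lt_nbhsl].
  + by near: x; exact: near_dist.
- move=> z hz; case/andP: (hz) => z0 z1; exists (f z); apply/cvgrPdist_le => e e0.
  have [d d0 H] := uf e e0; near=> x; rewrite distrC; apply: H.
  + by rewrite z0 ltW.
  + apply/andP; split; apply: ltW; last by near: x; exact: nbhs_right_lt.
    by apply: (le_lt_trans z0); near: x; exact: nbhs_right_gt.
  + by near: x; exact: near_right_dist.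
- move=> z hz; case/andP: (hz) => z0 z1; exists (f z); apply/cvgrPdist_le => e e0.
  have [d d0 H] := uf e e0; near=> x; rewrite distrC; apply: H.
  + by rewrite z1 ltW.
  + apply/andP; split; apply: ltW; first by near: x; exact: nbhs_left_gt.
    by apply: lt_le_trans z1; near: x; exact: nbhs_left_lt.
  + by near: x; exact: near_left_dist.
Unshelve. all: by end_near. Qed.

Lemma closed_triangle_compact : compact (@closed_triangle R).
Proof.
have c1 : continuous (fun p : R * R => p.1 - p.2).
  by move=> p; apply: cvgB; [exact: cvg_fst|exact: cvg_snd].
apply: (subclosed_compact (B := (`[0, 1]%classic `*` `[0, 1]%classic : set (R * R)))) => /=.
- rewrite [closed_triangle](_ : _ = [set p | 0 <= p.2] `&`
      ([set p | 0 <= p.1 - p.2] `&` [set p | p.1 <= 1])).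
    apply: closedI; first by apply: (preimage_closed _ (@closed_ge R 0)) => p _; exact: cvg_snd.
    apply: closedI; first by apply: (preimage_closed _ (@closed_ge R 0)) => p _; exact: c1.
    by apply: (preimage_closed _ (@closed_le R 1)) => p _; exact: cvg_fst.
  by apply/seteqP; split => p /=; rewrite subr_ge0.
- by apply: compact_setX; exact: segment_compact.
- move=> [x y] [/= h1 [h2 h3]]; split => /=; rewrite in_itv/=; apply/andP; split; lra.
Qed.

(** Heine-Cantor, with compactness used as near covering. Uniformity is needed because a change of z
    moves a whole row x -> k(z, x, t) at once. *)
Lemma continuous_closed_triangle_uniform (f : R * R -> R) :
  {within closed_triangle, continuous f} ->
  forall e : R, 0 < e -> exists2 d : R, 0 < d & forall p q,
    closed_triangle p -> closed_triangle q ->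
    `|q.1 - p.1| < d -> `|q.2 - p.2| < d -> `|f q - f p| <= e.
Proof.
move=> /subspace_continuousP cf e e0.
have /compact_near_coveringP/near_covering_withinP cpt := closed_triangle_compact.
pose P (d : R) (p : R * R) := forall q, closed_triangle q ->
  `|q.1 - p.1| < d -> `|q.2 - p.2| < d -> `|f q - f p| <= e.
have near_P : \forall d \near 0^'+, closed_triangle `<=` P d.
  apply: cpt => p0 Kp0.
  have e2 : 0 < e / 2 by rewrite divr_gt0.
  have := (cvgrPdist_le _ _).1 (cf p0 Kp0) _ e2.
  rewrite near_withinE => near_p0; have /nbhs_ballP[r /= r0 Hr] : nbhs p0 [set x |
    closed_triangle x -> `|f p0 - f x| <= e / 2] by exact: near_p0.
  have r2 : 0 < r / 2 by rewrite divr_gt0.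
  near=> p d => Kp q Kq q1 q2.
  have dr : d < r / 2 by near: d; exact: nbhs_right_lt.
  have [b1 b2] : ball p0 (r / 2) p by near: p; exact: nbhsx_ballx.
  rewrite /ball/= in b1 b2.
  have hp : `|f p0 - f p| <= e / 2.
    have rr : r / 2 <= r by lra.
    by apply: (Hr p) => //; split; rewrite /ball/=; [exact: lt_le_trans b1 rr|
      exact: lt_le_trans b2 rr].
  have hq : `|f p0 - f q| <= e / 2.
    apply: (Hr q) => //; split; rewrite /ball/=.
      rewrite (_ : p0.1 - q.1 = (p0.1 - p.1) - (q.1 - p.1)); last by ring.
      by rewrite (le_lt_trans (ler_normB _ _))// (splitr r) ltrD// (lt_trans q1).
    rewrite (_ : p0.2 - q.2 = (p0.2 - p.2) - (q.2 - p.2)); last by ring.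
    by rewrite (le_lt_trans (ler_normB _ _))// (splitr r) ltrD// (lt_trans q2).
  rewrite (_ : f q - f p = (f p0 - f p) - (f p0 - f q)); last by ring.
  by rewrite (le_trans (ler_normB _ _))// (splitr e) lerD.
have [d [d0 H]] : exists d : R, 0 < d /\ closed_triangle `<=` P d.
  near (0 : R)^'+ => d; exists d; split; first by near: d; exact: nbhs_right_gt.
  by near: d.
by exists d => // p q Kp Kq; apply: H.
Unshelve. all: by end_near. Qed.

End PiecewiseContinuous.

(** * The source: regularity in time, jumps in space *)

Section Source.
Context {R : realType}.
Variables (alpha t0 lam : R).
Variable K : nat -> R * R -> R -> R.
Variables G E : nat -> R -> R -> R.
Hypothesis alpha_ge0 : 0 <= alpha.
Hypothesis K_jet : gevrey_jet alpha t0 closed_triangle K.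
Hypothesis G_jet : gevrey_jet alpha t0 `[0, 1] G.
Hypothesis E_jet : gevrey_jet alpha t0 `[0, 1] E.
Hypothesis K_continuous : forall t, t0 < t -> {within closed_triangle, continuous (K 0%N ^~ t)}.
Hypothesis G_piecewise : forall t, t0 < t -> piecewise_continuous01 (G 0%N ^~ t).
Hypothesis E_cst : forall z z' t, E 0%N z t = E 0%N z' t.
Notation mu := (@lebesgue_measure R).

(** A component of [h1], with [G] and [E] in the place of the components of the transformed g1 and
    g2. [E] has a dummy space variable so that it can be multiplied with k(z, 0, t) as a family on
    [0, 1]. *)
Definition source z t : R :=
  K 0%N (z, 0) t * lam * E 0%N z t + G 0%N z t -
  \int[mu]_(x in `[0, z]) (K 0%N (z, x) t * G 0%N x t).

Lemma kernel_row_bounded_measurable z t : 0 <= z <= 1 -> t0 < t ->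
  bounded_measurable 0 z (fun x => K 0%N (z, x) t).
Proof.
move=> /andP[z0 z1] ht; split.
  apply: subspace_continuous_measurable_fun => //.
  apply/subspace_continuousP => x /=; rewrite in_itv/= => /andP[x0 xz].
  apply/cvgrPdist_le => e e0.
  have [d d0 H] := continuous_closed_triangle_uniform (K_continuous ht) e0.
  rewrite near_withinE; near=> y; have yd : `|y - x| < d by near: y; exact: near_dist.
  rewrite /= in_itv/= => /andP[y0 yz].
  by rewrite distrC; apply: H => //=; rewrite subrr normr0.
have [C [_ H]] := gevrey_jet_bounded K_jet t 0 ht.
by exists C => x /andP[x0 xz]; apply: H => //; rewrite !lexx.
Unshelve. all: by end_near. Qed.

Lemma G_bounded_measurable t : t0 < t -> bounded_measurable 0 1 (G 0%N ^~ t).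
Proof.
move=> ht; split; first exact: piecewise_continuous_measurable (G_piecewise ht).
have [C [_ H]] := gevrey_jet_bounded G_jet t 0 ht.
by exists C => x hx; apply: H; rewrite ?lexx// /= in_itv.
Qed.

Lemma source_jet : exists H, gevrey_jet alpha t0 `[0, 1] H /\
  forall z t, 0 <= z <= 1 -> t0 < t -> H 0%N z t = source z t.
Proof.
have kz : gevrey_jet alpha t0 `[0, 1] (fun j z => K j (z, 0 : R)).
  apply: (gevrey_jet_comp (h := fun z => (z, 0)) _ K_jet) => z /=.
  by rewrite in_itv/= => /andP[z0 z1].
have Gx : gevrey_jet alpha t0 closed_triangle (fun j (p : R * R) => G j p.2).
  apply: (gevrey_jet_comp (h := snd) _ G_jet) => -[z x] [/= x0 [xz z1]].
  by rewrite in_itv/= x0 (le_trans xz).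
have KE := gevrey_jetM alpha_ge0 kz E_jet.
have KG := gevrey_jetM alpha_ge0 K_jet Gx.
have e1 (u : R) : 'C(0, 0)%:R * u = u by rewrite mul1r.
have I_jet : gevrey_jet alpha t0 `[0, 1] (fun j (z : R) t => \int[mu]_(x in `[0, z])
    (\sum_(l < j.+1) 'C(j, l)%:R * (K l (z, x) t * G (j - l)%N x t))).
  apply: (gevrey_jet_integral KG) => z t hz ht.
  suff : measurable_fun `[0, z] (fun x => K 0%N (z, x) t * G 0%N x t).
    by congr measurable_fun; apply/funext => x; rewrite big_ord1 e1.
  apply: measurable_funM; first exact: (kernel_row_bounded_measurable hz ht).1.
  by case/andP: hz => z0 z1; apply: (bounded_measurable_sub _ z1 (G_bounded_measurable ht)).1.
eexists; split.
  exact: (gevrey_jet_lin 1 (-1) (gevrey_jet_lin lam 1 KE G_jet) I_jet).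
move=> z t hz ht /=; rewrite /source !big_ord1 !e1 ?mul1r mulN1r [lam * _]mulrCA mulrA.
congr (_ - _).
by apply: eq_Rintegral => x _; rewrite big_ord1 e1.
Qed.

(** Both the kernel row and the upper limit move with z; each gets e / 2, the row by uniform
    continuity and the limit by the bound C D of the integrand. Jumps of [G] are smoothed out by the
    integral. *)
Lemma kernel_integral_uniform t : t0 < t ->
  uniformly_continuous01 (fun z => \int[mu]_(x in `[0, z]) (K 0%N (z, x) t * G 0%N x t)).
Proof.
move=> ht e e0.
have [C [C0 HC]] := gevrey_jet_bounded K_jet t 0 ht.
have [D [D0 HD]] := gevrey_jet_bounded G_jet t 0 ht.
have Kb z x : 0 <= x -> x <= z -> z <= 1 -> `|K 0%N (z, x) t| <= C.
  by move=> x0 xz z1; apply: HC => //; rewrite !lexx.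
have Gb x : 0 <= x <= 1 -> `|G 0%N x t| <= D.
  by move=> hx; apply: HD; rewrite ?lexx// /= in_itv.
have e2 : 0 < e / 2 / (D + 1) by rewrite divr_gt0// ?divr_gt0// ltr_wpDl.
have [d d0 Hd] := continuous_closed_triangle_uniform (K_continuous ht) e2.
have CD : 0 < C * D + 1 by rewrite ltr_wpDl// mulr_ge0.
have e3 : 0 < e / 2 / (C * D + 1) by rewrite divr_gt0// divr_gt0.
exists (Num.min d (e / 2 / (C * D + 1))); first by rewrite lt_min d0.
have key z z' : 0 <= z -> z <= z' -> z' <= 1 -> z' - z < d -> z' - z < e / 2 / (C * D + 1) ->
    `|\int[mu]_(x in `[0, z']) (K 0%N (z', x) t * G 0%N x t) -
      \int[mu]_(x in `[0, z]) (K 0%N (z, x) t * G 0%N x t)| <= e.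
  move=> z0 zz' z'1 h1 h2; have z1 : z <= 1 by apply: le_trans z'1.
  have bm u v w : 0 <= u -> v <= w -> 0 <= w -> w <= 1 ->
      bounded_measurable u v (fun x => K 0%N (w, x) t * G 0%N x t).
    move=> u0 vw w0 w1; apply: bounded_measurableM.
      by apply: (bounded_measurable_sub u0 vw); apply: kernel_row_bounded_measurable; rewrite ?w0.
    by apply: (bounded_measurable_sub u0 (le_trans vw w1)); exact: G_bounded_measurable.
  have z'0 : 0 <= z' by apply: le_trans zz'.
  rewrite (@Rintegral_cat R 0 z z')//; last exact: bm.
  rewrite addrAC (splitr e) (le_trans (ler_normD _ _))// lerD//.
    apply: (@le_trans _ _ (e / 2 / (D + 1) * D * (z - 0))).
      apply: Rintegral_dist => //; [exact: bm|exact: bm|].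
      move=> x /andP[x0 xz]; rewrite -mulrBl normrM ler_pM//.
        apply: Hd => //=; try by split => //; split => //; exact: le_trans zz'.
          by rewrite ger0_norm// subr_ge0.
        by rewrite subrr normr0.
      by apply: Gb; rewrite x0 (le_trans xz).
    rewrite subr0; apply: (@le_trans _ _ (e / 2 / (D + 1) * D)).
      by rewrite ler_piMr// mulr_ge0// ltW.
    rewrite -mulrA ler_piMr//; first by rewrite divr_ge0// ltW.
    by rewrite mulrC ler_pdivrMr ?ltr_wpDl// mul1r lerDl.
  apply: (@le_trans _ _ (C * D * (z' - z))).
    apply: Rintegral_bound => //; first exact: (bm z z' z' _ _ _ _).1.
    move=> x /andP[x0 xz]; rewrite normrM ler_pM//.
      by apply: Kb => //; exact: le_trans x0.
    by apply: Gb; rewrite (le_trans z0 x0) (le_trans xz).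
  apply: (@le_trans _ _ ((C * D + 1) * (z' - z))).
    by rewrite ler_wpM2r ?subr_ge0// lerDl.
  by rewrite mulrC -ler_pdivlMr// ltW.
move=> z z' /andP[z0 z1] /andP[z'0 z'1]; rewrite lt_min => /andP[h1 h2].
have [zz'|/ltW zz'] := leP z z'.
  by apply: key => //; rewrite ger0_norm ?subr_ge0// in h1 h2.
by rewrite distrC; apply: key => //; rewrite distrC ger0_norm ?subr_ge0// in h1 h2.
Qed.

Lemma source_piecewise t : t0 < t -> piecewise_continuous01 (source ^~ t).
Proof.
move=> ht.
have k0 : piecewise_continuous01 (fun z => K 0%N (z, 0) t).
  apply: uniformly_continuous01_piecewise => e e0.
  have [d d0 H] := continuous_closed_triangle_uniform (K_continuous ht) e0.
  exists d => // z z' /andP[z0 z1] /andP[z'0 z'1] h; apply: H => //=.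
  by rewrite subrr normr0.
have i0 := uniformly_continuous01_piecewise (kernel_integral_uniform ht).
have := piecewise_continuous_lin 1 (-1)
  (piecewise_continuous_lin (lam * E 0%N 0 t) 1 k0 (G_piecewise ht)) i0.
congr piecewise_continuous01; apply/funext => z.
by rewrite /source !mul1r mulN1r (E_cst z 0) -[K _ _ _ * _ * _]mulrA [K _ _ _ * _]mulrC.
Qed.

End Source.

(** * The strong solution *)

Section Solution.
Context {R : realType}.
Variables (n : nat) (alpha t0 lam mu : R) (S : 'M[R]_n).
Variables (bd : 'I_(n + n) -> nat -> unit -> R -> R) (src : 'I_n -> nat -> R -> R -> R).
Hypothesis alpha_bounds : 0 <= alpha < 2.
Hypothesis lam_gt0 : 0 < lam.
Hypothesis bd_jet : forall k, gevrey_jet alpha t0 setT (bd k).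
Hypothesis src_jet : forall i, gevrey_jet alpha t0 `[0, 1] (src i).
Hypothesis src_measurable : forall i t, t0 < t ->
  measurable_fun (`[0, 1]%classic : set R) (src i 0%N ^~ t).

Let A := A0 lam mu S.
Let B := A1 n lam.

(** The state holds phi in its upper and phi_z in its lower half; the row sums here and below turn
    the first-order system back into the second-order equation. *)
Lemma A0_row_top (v : 'I_(n + n) -> R) i : \sum_b A (lshift n i) b * v b = v (rshift n i).
Proof.
rewrite big_split_ord/= [X in X + _]big1 => [|j _].
  rewrite add0r (bigD1 i)//= /A /A0 block_mxEur mxE eqxx mul1r big1 ?addr0// => j ji.
  by rewrite block_mxEur mxE eq_sym (negbTE ji) mul0r.
by rewrite /A /A0 block_mxEul mxE mul0r.
Qed.

Lemma A0_row_bottom (v : 'I_(n + n) -> R) i : \sum_b A (rshift n i) b * v b =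
  lam^-1 * (mu * v (lshift n i) + \sum_j S j i * v (lshift n j)).
Proof.
rewrite big_split_ord/= [X in _ + X]big1 => [|j _]; last first.
  by rewrite /A /A0 block_mxEdr mxE mul0r.
rewrite addr0 mulrDr mulr_sumr.
rewrite (eq_bigr (fun j => lam^-1 * ((mu%:M : 'M[R]_n) i j * v (lshift n j)) +
    lam^-1 * (S j i * v (lshift n j)))) => [|j _]; last first.
  by rewrite /A /A0 block_mxEdl !mxE -mulrDr -mulrDl mulrA.
rewrite big_split/=; congr (_ + _).
rewrite (bigD1 i)//= mxE eqxx mulr1n big1 ?addr0// => j ji.
by rewrite mxE eq_sym (negbTE ji) mulr0n mul0r mulr0.
Qed.

Lemma A1_row_top (v : 'I_(n + n) -> R) i : \sum_b B (lshift n i) b * v b = 0.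
Proof.
rewrite big_split_ord/= !big1 ?addr0// => j _; rewrite /B /A1.
  by rewrite block_mxEur mxE mul0r.
by rewrite block_mxEul mxE mul0r.
Qed.

Lemma A1_row_bottom (v : 'I_(n + n) -> R) i :
  \sum_b B (rshift n i) b * v b = lam^-1 * v (lshift n i).
Proof.
rewrite big_split_ord/= [X in _ + X]big1 => [|j _]; last first.
  by rewrite /B /A1 block_mxEdr mxE mul0r.
rewrite addr0 (bigD1 i)//= /B /A1 block_mxEdl !mxE eqxx mulr1 big1 ?addr0// => j ji.
by rewrite block_mxEdl !mxE eq_sym (negbTE ji) mulr0 mul0r.
Qed.

Definition src_col (k : 'I_(n + n)) : nat -> R -> R -> R :=
  match fintype.split k with inl _ => fun _ _ _ => 0 | inr i => src i end.

Lemma src_col_top i : src_col (lshift n i) = fun _ _ _ => 0.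
Proof. by rewrite /src_col; case: split_ordP => // j /eqP; rewrite eq_lrshift. Qed.

Lemma src_col_bottom i : src_col (rshift n i) = src i.
Proof.
rewrite /src_col; case: split_ordP => [j /eqP|j /eqP].
  by rewrite eq_rlshift.
by rewrite eq_rshift => /eqP ->.
Qed.

Lemma src_col_jet k : gevrey_jet alpha t0 `[0, 1] (src_col k).
Proof.
rewrite /src_col; case: fintype.split => [_|i]; last exact: src_jet.
split=> [j x t _ _|a b _]; first exact: is_derive_cst.
by exists 0, 0; split => // j x t _ _; rewrite normr0 !mul0r.
Qed.

Lemma src_col_measurable k t : t0 < t ->
  measurable_fun (`[0, 1]%classic : set R) (src_col k 0%N ^~ t).
Proof. by move=> ht; rewrite /src_col; case: fintype.split => // i; exact: src_measurable. Qed.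

Let dyson_AB_eq0 := @A0A1_dyson_eq0 R n lam mu S.

(** The m-th time derivative of the state (phi, phi_z). Solving the equation for phi_zz leaves the
    source -h / lam in the lower half. *)
Definition solution m a z t : R :=
  dyson_series A B bd m a z tt t - lam^-1 * dyson_conv A B src_col m a z t.

Lemma solution_quad_time a b m : t0 < a -> exists C, 0 <= C /\
  forall i (z t t' : R), 0 <= z <= 1 -> a <= t <= b -> a <= t' <= b ->
    `|solution m i z t' - solution m i z t - (t' - t) * solution m.+1 i z t|
      <= C * (t' - t) ^+ 2.
Proof.
move=> ha.
have [C [C0 HC]] := dyson_series_quad_time dyson_AB_eq0 alpha_bounds bd_jet b m ha.
have [D [D0 HD]] := dyson_conv_quad_time dyson_AB_eq0 alpha_bounds src_col_jet
  src_col_measurable b m ha.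
have l0 : 0 <= lam^-1 by rewrite invr_ge0 ltW.
exists (C + lam^-1 * D); split; first by rewrite addr_ge0// mulr_ge0.
move=> i z t t' hz ht ht'.
have alg (l p p' q q' h p1 q1 : R) : (p' - l * q') - (p - l * q) - h * (p1 - l * q1) =
  (p' - p - h * p1) - l * (q' - q - h * q1) by ring.
rewrite /solution alg (le_trans (ler_normB _ _))// [leRHS]mulrDl lerD//; first exact: HC.
by rewrite normrM (ger0_norm l0) -mulrA ler_wpM2l// HD.
Qed.

Lemma solution_is_derive_time m i (z t : R) : 0 <= z <= 1 -> t0 < t ->
  is_derive t 1 (solution m i z) (solution m.+1 i z t).
Proof.
move=> hz ht; pose e := (t - t0) / 2.
have ta : t0 < t - e by rewrite /e; lra.
have [C [C0 H]] := solution_quad_time (t + e) m ta.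
apply: (@is_derive_quad _ _ _ _ C e) => [|s]; first by rewrite /e; lra.
rewrite ltr_norml => hs; apply: H => //; rewrite /e in hs *; apply/andP; split; lra.
Qed.

Lemma solution_increment a b m : t0 < a -> exists C, 0 <= C /\
  forall i (z z' t c e : R), 0 <= z <= 1 -> 0 <= z' <= 1 -> a <= t <= b ->
    (forall x, Num.min z z' <= x <= Num.max z z' -> `|src_col i m x t - c| <= e) ->
    `|solution m i z' t - solution m i z t - (z' - z) *
      (\sum_b A i b * solution m b z t + \sum_b B i b * solution m.+1 b z t - lam^-1 * c)| <=
    C * (z' - z) ^+ 2 + lam^-1 * e * `|z' - z|.
Proof.
move=> ha.
have [C [C0 HC]] := dyson_series_quad_space dyson_AB_eq0 alpha_bounds bd_jet b m ha.
have [D [D0 HD]] := dyson_conv_increment dyson_AB_eq0 alpha_bounds src_col_jet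
  src_col_measurable b m ha.
have l0 : 0 <= lam^-1 by rewrite invr_ge0 ltW.
exists (C + lam^-1 * D); split; first by rewrite addr_ge0// mulr_ge0.
move=> i z z' t c e hz hz' ht hs.
have h1 := HC i z z' tt t hz hz' I ht; have h2 := HD i z z' t c e hz hz' ht hs.
have E (M : 'M[R]_(n + n)) p : \sum_b M i b * solution p b z t =
    \sum_b M i b * dyson_series A B bd p b z tt t -
    lam^-1 * \sum_b M i b * dyson_conv A B src_col p b z t.
  rewrite mulr_sumr -sumrB; apply: eq_bigr => j _.
  by rewrite /solution mulrBr [X in _ - X]mulrCA.
rewrite !E /solution.
have alg (l p p' q q' h s1 s2 r1 r2 u : R) :
  (p' - l * q') - (p - l * q) - h * ((s1 - l * r1) + (s2 - l * r2) - l * u) =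
  (p' - p - h * (s1 + s2)) - l * (q' - q - h * (r1 + r2 + u)) by ring.
rewrite alg (le_trans (ler_normB _ _))//.
rewrite [(C + _) * _]mulrDl -[leRHS]addrA; apply: lerD; first exact: h1.
by rewrite normrM (ger0_norm l0) -!mulrA -mulrDr ler_wpM2l.
Qed.

Lemma solution_bounded a b m : t0 < a -> exists C, 0 <= C /\
  forall i (z t : R), 0 <= z <= 1 -> a <= t <= b -> `|solution m i z t| <= C.
Proof.
move=> ha.
have [C [C0 HC]] := dyson_series_bounded dyson_AB_eq0 alpha_bounds bd_jet b m ha.
have [D [D0 HD]] := dyson_conv_bounded dyson_AB_eq0 alpha_bounds src_col_jet
  src_col_measurable b m ha.
have l0 : 0 <= lam^-1 by rewrite invr_ge0 ltW.
exists (C + lam^-1 * D); split; first by rewrite addr_ge0// mulr_ge0.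
move=> i z t hz ht; rewrite /solution (le_trans (ler_normB _ _))// lerD//; first exact: HC.
by rewrite normrM (ger0_norm l0) ler_wpM2l// HD.
Qed.

(** The increment estimate with c = 0 and e a bound of the source is insensitive to jumps. *)
Lemma solution_lipschitz a b m : t0 < a -> exists C, 0 <= C /\
  forall i (z z' t : R), 0 <= z <= 1 -> 0 <= z' <= 1 -> a <= t <= b ->
    `|solution m i z' t - solution m i z t| <= C * `|z' - z|.
Proof.
move=> ha; have [C [C0 HC]] := solution_increment b m ha.
have [M [r [M0 r0 HM]]] := gevrey_jet_common_bound src_col_jet b ha.
pose e := M * (r ^+ m * m`!%:R `^ alpha).
have e0 : 0 <= e by rewrite !mulr_ge0 ?exprn_ge0 ?powR_ge0.
have [C1 [C10 H1]] := solution_bounded b m ha.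
have [C2 [C20 H2]] := solution_bounded b m.+1 ha.
have l0 : 0 <= lam^-1 by rewrite invr_ge0 ltW.
pose K := (\sum_i \sum_j `|A i j|) * C1 + (\sum_i \sum_j `|B i j|) * C2.
have K0 : 0 <= K.
  by rewrite addr_ge0// mulr_ge0// sumr_ge0// => i _; rewrite sumr_ge0.
exists (C + lam^-1 * e + K); split; first by rewrite addr_ge0// addr_ge0// mulr_ge0.
move=> i z z' t hz hz' ht.
have hx x : Num.min z z' <= x <= Num.max z z' -> `|src_col i m x t - 0| <= e.
  move=> /andP[x1 x2]; rewrite subr0; apply: HM => //; apply: mem01.
  case/andP: hz => z0 z1; case/andP: hz' => z'0 z'1; apply/andP; split.
    by apply: le_trans x1; rewrite le_min z0.
  by apply: (le_trans x2); rewrite ge_max z1.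
have := HC i z z' t 0 e hz hz' ht hx; rewrite mulr0 subr0 => h.
set d := \sum_b A i b * _ + _ in h.
have hd : `|d| <= K.
  by rewrite (le_trans (ler_normD _ _))// lerD// sum_coef_bound// => j; [exact: H1|exact: H2].
have z1 : `|z' - z| <= 1.
  case/andP: hz => z0 z1; case/andP: hz' => z'0 z'1.
  by rewrite ler_norml lerBrDr lerBlDr (le_trans _ z'0) ?(le_trans z'1) ?lerDl// addrC subr_le0.
rewrite -[X in `|X|](subrK ((z' - z) * d)) (le_trans (ler_normD _ _))//.
rewrite [leRHS]mulrDl lerD//; last by rewrite normrM mulrC ler_wpM2r.
apply: (le_trans h); rewrite [leRHS]mulrDl lerD// ler_wpM2l//.
by rewrite -real_normK ?num_real// expr2 ler_piMr.
Qed.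

(** Joint continuity from a Lipschitz constant in z that is uniform for times near t, and continuity
    in t at the fixed z. *)
Lemma solution_continuous m i (z t : R) : 0 <= z <= 1 -> t0 < t ->
  forall e : R, 0 < e -> exists2 d : R, 0 < d & forall z' t', 0 <= z' <= 1 -> t0 < t' ->
    `|z' - z| < d -> `|t' - t| < d -> `|solution m i z' t' - solution m i z t| <= e.
Proof.
move=> hz ht e e0; pose r := (t - t0) / 2.
have r0 : 0 < r by rewrite /r; lra.
have ta : t0 < t - r by rewrite /r; lra.
have [C [C0 HC]] := solution_lipschitz (t + r) m ta.
have C1 : 0 < C + 1 by rewrite ltr_wpDl.
have [dt _] := solution_is_derive_time m i hz ht.
have ct : {for t, continuous (solution m i z)}.
  exact/differentiable_continuous/derivable1_diffP.
have e2 : 0 < e / 2 by rewrite divr_gt0.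
have ct2 := (cvgrPdist_le _ _).1 ct _ e2.
have /nbhs_ballP[d /= d0 Hd] : nbhs t [set s | `|solution m i z t - solution m i z s| <= e / 2].
  exact: ct2.
exists (Num.min (Num.min d r) (e / 2 / (C + 1))); first by rewrite !lt_min d0 r0 divr_gt0.
move=> z' t' hz' ht'; rewrite !lt_min => /andP[_ z3] /andP[/andP[t1 t2] _].
have ht2 : t - r <= t' <= t + r.
  by move: t2; rewrite ltr_norml => /andP[? ?]; apply/andP; split; lra.
have h1 : `|solution m i z' t' - solution m i z t'| <= e / 2.
  apply: (le_trans (HC i z z' t' hz hz' ht2)).
  apply: (@le_trans _ _ ((C + 1) * `|z' - z|)); first by rewrite ler_wpM2r// lerDl.
  by rewrite mulrC -ler_pdivlMr// ltW.
have h2 : `|solution m i z t' - solution m i z t| <= e / 2.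
  by rewrite distrC; apply: Hd; rewrite /ball/= distrC.
by rewrite (splitr e) -(subrKA (solution m i z t')) (le_trans (ler_normD _ _))// lerD.
Qed.

Lemma solution_at0 i (t : R) : solution 0 i 0 t = bd i 0%N tt t.
Proof.
rewrite /solution dyson_series_at0 /dyson_conv set_itv1 Rintegral_set1.
by rewrite mulr0 subr0.
Qed.

End Solution.

(** * Derivatives relative to the unit interval *)

Section WithinUnitInterval.
Context {R : realType}.

(** A source that is merely continuous at a point contributes o(|y - x|), not a quadratic error. *)
Lemma is_derive_little_o (f : R -> R) (x d C : R) : 0 <= C ->
  (forall e : R, 0 < e -> exists2 r : R, 0 < r & forall y, `|y - x| < r ->
    `|f y - f x - (y - x) * d| <= C * (y - x) ^+ 2 + e * `|y - x|) ->
  is_derive x 1 f d.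
Proof.
move=> C0 H; apply: is_derive1_cvg; apply/cvgrPdist_le => /= eps eps0.
have e2 : 0 < eps / 2 by rewrite divr_gt0.
have C1 : 0 < C + 1 by rewrite ltr_wpDl.
have [r r0 Hr] := H _ e2; near=> h.
have h0 : h != 0 by near: h; exact: nbhs_dnbhs_neq.
have hr : `|h| < r by near: h; exact: dnbhs0_lt.
have hC : `|h| <= eps / 2 / (C + 1) by near: h; apply: dnbhs0_le; rewrite divr_gt0.
have := Hr (h + x); rewrite addrK => /(_ hr) H1.
have hp : 0 < `|h| by rewrite normr_gt0.
rewrite -(ler_pM2l hp) -normrM mulrBr /GRing.scale/= mulVKf// distrC.
apply: (le_trans H1); rewrite -real_normK ?num_real// expr2 mulrA -mulrDl mulrC ler_pM2l//.
rewrite [leRHS]splitr lerD2r; apply: (@le_trans _ _ ((C + 1) * `|h|)).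
  by rewrite ler_wpM2r// lerDl.
by rewrite mulrC -ler_pdivlMr.
Unshelve. all: by end_near. Qed.

(** Uniqueness of the relative derivative rests on this: from the left half one can step to the
    right, otherwise to the left. *)
Lemma within_unit_proper (z : R) : 0 <= z <= 1 ->
  ProperFilter (within [set h : R | `[0, 1]%classic (z + h)] 0^').
Proof.
move=> /andP[z0 z1]; apply: Build_ProperFilter_ex => P.
rewrite /within/= => /nbhs_ballP[e /= e0 He].
pose g : R := Num.min (e / 2) (1 / 2).
have g0 : 0 < g by rewrite lt_min !divr_gt0.
have ge : g < e by rewrite gt_min; apply/orP; left; lra.
have g1 : g <= 1 / 2 by rewrite ge_min lexx orbT.
have [zh|zh] := leP z (1 / 2).
  exists g; apply: He; rewrite /ball/= ?sub0r ?normrN ?gtr0_norm ?gt_eqF//.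
  by rewrite in_itv/=; apply/andP; split; lra.
exists (- g); apply: He; rewrite /ball/= ?sub0r ?opprK ?gtr0_norm ?oppr_eq0 ?gt_eqF//.
by rewrite in_itv/=; apply/andP; split; lra.
Qed.

Lemma derive_within_quad m n (f : R -> 'M[R]_(m, n)) (d : 'M[R]_(m, n)) (z C : R) :
  0 <= z <= 1 ->
  (forall i j z', 0 <= z' <= 1 ->
    `|f z' i j - f z i j - (z' - z) * d i j| <= C * (z' - z) ^+ 2) ->
  derivable_within `[0, 1] f z /\ derive_within `[0, 1] f z = d.
Proof.
move=> hz H; have pF := within_unit_proper hz.
suff h : quotient_within `[0, 1] f z --> d.
  by split; [apply/cvg_ex; exists d | apply: cvg_lim h].
apply: cvg_mx_entries => i j; apply/cvgrPdist_le => eps eps0.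
rewrite near_withinE; near=> h => hz'.
have h0 : h != 0 by near: h; exact: nbhs_dnbhs_neq.
have C1 : 0 < `|C| + 1 by rewrite ltr_wpDl.
have hC : `|h| <= eps / (`|C| + 1) by near: h; apply: dnbhs0_le; rewrite divr_gt0.
have z01 : 0 <= z + h <= 1 by move: hz'; rewrite /= in_itv.
have zh : z + h - z = h by rewrite addrAC subrr add0r.
have := H i j _ z01; rewrite zh => H1.
have hp : 0 < `|h| by rewrite normr_gt0.
rewrite !mxE -(ler_pM2l hp) -normrM mulrBr mulVKf// distrC.
apply: (le_trans H1); rewrite -real_normK ?num_real// expr2 mulrA mulrC ler_pM2l//.
apply: (@le_trans _ _ ((`|C| + 1) * `|h|)).
  by rewrite ler_wpM2r// (le_trans (ler_norm _))// lerDl.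
by rewrite mulrC -ler_pdivlMr.
Unshelve. all: by end_near. Qed.

Lemma piecewise_continuous_sum (I : Type) (r : seq I) (x : I -> R) (f : I -> R -> R) :
  (forall i, piecewise_continuous01 (f i)) ->
  piecewise_continuous01 (fun z => \sum_(i <- r) x i * f i z).
Proof.
move=> H; elim: r => [|i r IH].
  have c0 : uniformly_continuous01 (fun=> 0 : R).
    by move=> e e0; exists 1 => // z z' _ _ _; rewrite subrr normr0 ltW.
  have := uniformly_continuous01_piecewise c0.
  by congr piecewise_continuous01; apply/funext => z; rewrite big_nil.
have := piecewise_continuous_lin (x i) 1 (H i) IH.
by congr piecewise_continuous01; apply/funext => z; rewrite big_cons mul1r.
Qed.

End WithinUnitInterval.

(** * Identification of the stated formula with the series solution *)

Section Formula.
Context {R : realType}.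
Variables (n : nat) (alpha t0 lam mu c : R) (S : 'M[R]_n).
Variables (h : R -> R -> 'cV[R]_n) (gt2 gt4 : R -> 'cV[R]_n).
Variable src : 'I_n -> nat -> R -> R -> R.
Hypothesis alpha_bounds : 0 <= alpha < 2.
Hypothesis gt2_jet : forall i,
  gevrey_jet alpha t0 [set: unit] (fun j _ => derive1n j (fun t => gt2 t i 0)).
Hypothesis gt4_jet : forall i,
  gevrey_jet alpha t0 [set: unit] (fun j _ => derive1n j (fun t => gt4 t i 0)).
Hypothesis src_jet : forall i, gevrey_jet alpha t0 `[0, 1] (src i).
Hypothesis srcE : forall i z t, 0 <= z <= 1 -> t0 < t -> src i 0%N z t = h z t i 0.
Hypothesis h_piecewise : forall i t, t0 < t -> piecewise_continuous01 (fun z => h z t i 0).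

Let A := A0 lam mu S.
Let B := A1 n lam.
Let dyson_AB_eq0 := @A0A1_dyson_eq0 R n lam mu S.

Definition boundary_jet (k : 'I_(n + n)) (j : nat) (_ : unit) (t : R) : R :=
  match fintype.split k with
  | inl i => - c^-1 * derive1n j (fun t => gt4 t i 0) t
  | inr i => derive1n j (fun t => gt2 t i 0) t
  end.

Lemma boundary_jetP k : gevrey_jet alpha t0 setT (boundary_jet k).
Proof.
rewrite /boundary_jet; case: fintype.split => i; last first.
  exact: gt2_jet.
have := gevrey_jet_lin (- c^-1) 0 (gt4_jet i) (gt4_jet i).
by congr gevrey_jet; apply/funext => j; apply/funext => x; apply/funext => t;
  rewrite mul0r addr0.
Qed.

Lemma derive1n_boundary j t : t0 < t ->
  let f s := col_mx (- c^-1 *: gt4 s) (gt2 s) in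
  derive1n j f t = \col_k boundary_jet k j tt t /\
  is_derive t 1 (derive1n j f) (\col_k boundary_jet k j.+1 tt t).
Proof.
move=> ht f; apply: (is_derive1_derive1n (t0 := t0)
  (G := fun j t => \col_k boundary_jet k j tt t)) => // [i s hs|s hs].
  apply: is_derive1_mx => a b; rewrite mxE.
  rewrite (_ : (fun _ => _) = boundary_jet a i tt); last by apply/funext => u; rewrite mxE.
  exact: (boundary_jetP a).1.
apply/matrixP => a b; rewrite ord1 !mxE /boundary_jet.
by case: fintype.split => i; rewrite ?mxE.
Qed.

Lemma derive1n_h j z t : 0 <= z <= 1 -> t0 < t ->
  derive1n j (h z) t = \col_i src i j z t /\
  is_derive t 1 (derive1n j (h z)) (\col_i src i j.+1 z t).
Proof.
move=> hz ht; apply: (is_derive1_derive1n (t0 := t0)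
  (G := fun j t => \col_i src i j z t)) => // [i s hs|s hs].
  apply: is_derive1_mx => a b; rewrite mxE.
  rewrite (_ : (fun _ => _) = src a i z); last by apply/funext => u; rewrite mxE.
  exact: (src_jet a).1 (mem01 hz) hs.
by apply/matrixP => a b; rewrite ord1 mxE srcE.
Qed.

Lemma src0_measurable i t : t0 < t ->
  measurable_fun (`[0, 1]%classic : set R) (src i 0%N ^~ t).
Proof.
move=> ht; apply: eq_measurable_fun (piecewise_continuous_measurable (h_piecewise i ht)).
by move=> z /set_mem/=; rewrite in_itv/= => hz; rewrite srcE.
Qed.

Notation sc := (src_col src).
Notation V := (dyson_series A B sc 0).

Lemma boundary_termE z t j a : 0 <= z -> t0 < t ->
  boundary_term lam mu c S gt2 gt4 z t j a 0 = dyson_term A B boundary_jet 0 a z tt t j.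
Proof.
move=> z0 ht; rewrite /boundary_term (derive1n_boundary j ht).1 mxE.
by apply: eq_bigr => k _; rewrite Phi_dyson// mxE addn0.
Qed.

Lemma source_termE z t x j a : 0 <= x <= z -> z <= 1 -> t0 < t ->
  source_term lam mu S h z t x j a 0 = dyson_term A B sc 0 a x (z - x) t j.
Proof.
move=> /andP[x0 xz] z1 ht; have hx : 0 <= z - x <= 1 by apply/andP; split; lra.
rewrite /source_term (derive1n_h j hx ht).1 -mulmxA tr_row_mx trmx0 trmx1.
rewrite mul_col_mx mul0mx mul1mx mxE; apply: eq_bigr => k _.
rewrite Phi_dyson// addn0 mxE /src_col.
by case: fintype.split => i; rewrite mxE.
Qed.

Lemma boundary_series z t : 0 <= z <= 1 -> t0 < t ->
  cvgn (series (boundary_term lam mu c S gt2 gt4 z t)) /\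
  forall a, limn (series (boundary_term lam mu c S gt2 gt4 z t)) a 0 =
    dyson_series A B boundary_jet 0 a z tt t.
Proof.
move=> hz ht; case/andP: (hz) => z0 z1.
have E a : (fun j => boundary_term lam mu c S gt2 gt4 z t j a 0) =
    dyson_term A B boundary_jet 0 a z tt t.
  by apply/funext => j; rewrite boundary_termE.
have [|h1 h2] := @cvg_series_mx _ _ _ (boundary_term lam mu c S gt2 gt4 z t).
  move=> a b; rewrite ord1 E.
  exact: (dyson_series_cvg dyson_AB_eq0 alpha_bounds boundary_jetP).
by split => // a; rewrite h2 E.
Qed.

Lemma source_series z t x : 0 <= x <= z -> z <= 1 -> t0 < t ->
  cvgn (series (source_term lam mu S h z t x)) /\
  forall a, limn (series (source_term lam mu S h z t x)) a 0 = V a x (z - x) t.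
Proof.
move=> hx z1 ht; have [x0 xz] := andP hx.
have E a : (fun j => source_term lam mu S h z t x j a 0) = dyson_term A B sc 0 a x (z - x) t.
  by apply/funext => j; rewrite source_termE.
have [|h1 h2] := @cvg_series_mx _ _ _ (source_term lam mu S h z t x).
  move=> a b; rewrite ord1 E.
  apply: (dyson_series_cvg dyson_AB_eq0 alpha_bounds (src_col_jet src_jet)) => //.
    by apply/andP; split; lra.
  by apply: mem01; apply/andP; split; lra.
by split => // a; rewrite h2 E.
Qed.

Lemma source_bounded_measurable z t a : 0 <= z <= 1 -> t0 < t ->
  bounded_measurable 0 z (fun x => V a (z - x) x t).
Proof.
move=> /andP[z0 z1] ht.
by apply: (dyson_series_bounded_measurable dyson_AB_eq0 alpha_bounds (src_col_jet src_jet)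
  (src_col_measurable src0_measurable)).
Qed.

Lemma reflected_source_bounded_measurable z t a : 0 <= z <= 1 -> t0 < t ->
  bounded_measurable 0 z (fun x => V a x (z - x) t).
Proof.
move=> /andP[z0 z1] ht; split.
  apply: (dyson_series_measurable dyson_AB_eq0 alpha_bounds (src_col_jet src_jet)) => //.
    move=> x /=; rewrite !in_itv/= => /andP[x0 xz]; split; apply/andP; split; lra.
  move=> k j.
  have [m1 _] := jet_bounded_measurable (src_col_jet src_jet)
    (src_col_measurable src0_measurable) k j ht.
  suff : measurable_fun `[0, z] ((sc k j ^~ t) \o (fun x => z - x)) by [].
  apply: (measurable_comp _ _ m1) => //.
    by move=> _ [x /= + <-]; rewrite !in_itv/= => /andP[x0 xz]; apply/andP; split; lra.
  exact: measurable_funB.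
have [C [_ H]] := dyson_series_bounded dyson_AB_eq0 alpha_bounds (src_col_jet src_jet) t 0 ht.
exists C => x /andP[x0 xz]; apply: H; rewrite ?lexx//; first by apply/andP; split; lra.
by apply: mem01; apply/andP; split; lra.
Qed.

Lemma formula_defined : phi_formula_defined t0 lam mu c S h gt2 gt4.
Proof.
move=> z t hz ht; case/andP: (hz) => z0 z1; split.
- by move=> j; case: (derive1n_h j hz ht).2.
- by move=> j; case: (derive1n_boundary j ht).2.
- exact: (boundary_series hz ht).1.
- by move=> x hx; exact: (source_series hx z1 ht).1.
- move=> a; apply: eq_integrable (bounded_measurable_integrable
    (reflected_source_bounded_measurable a hz ht)) => //.
  move=> x /set_mem/=; rewrite in_itv/= => hx.
  by rewrite (source_series hx z1 ht).2.
Qed.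

Notation sol := (solution lam mu S boundary_jet src).
Notation phi := (phi_formula lam mu c S h gt2 gt4).

Lemma phi_formula_solution z t i : 0 <= z <= 1 -> t0 < t ->
  phi z t i 0 = sol 0 (lshift n i) z t.
Proof.
move=> hz ht; case/andP: (hz) => z0 z1; rewrite /phi_formula.
set X := _ - _; rewrite -[X]vsubmxK mul_row_col mul1mx mul0mx addr0 mxE /X !mxE.
rewrite (boundary_series hz ht).2 /solution /dyson_conv; congr (_ - _ * _).
rewrite -(Rintegral_reflect (source_bounded_measurable _ hz ht)).
apply: eq_Rintegral => x /set_mem/=; rewrite in_itv/= => hx.
by rewrite (source_series hx z1 ht).2 subKr.
Qed.

End Formula.

(* [sol m] stands for the m-th time derivative of the first-order system's state;
   it is kept abstract because unification would otherwise unfold the series. *)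
Section Strong.
Context {R : realType}.
Variables (n : nat) (t0 lam mu c : R) (S : 'M[R]_n).
Variables (h : R -> R -> 'cV[R]_n) (gt2 gt4 : R -> 'cV[R]_n) (phi : R -> R -> 'cV[R]_n).
Variable sol : nat -> 'I_(n + n) -> R -> R -> R.
Hypothesis lam_gt0 : 0 < lam.
Hypothesis c_neq0 : c != 0.
Hypothesis h_piecewise : forall i t, t0 < t -> piecewise_continuous01 (fun z => h z t i 0).
Hypothesis phiE : forall i z t, 0 <= z <= 1 -> t0 < t -> phi z t i 0 = sol 0 (lshift n i) z t.
Hypothesis sol_top : forall t, t0 < t -> exists C, 0 <= C /\
  forall i (z z' : R), 0 <= z <= 1 -> 0 <= z' <= 1 ->
  `|sol 0 (lshift n i) z' t - sol 0 (lshift n i) z t - (z' - z) * sol 0 (rshift n i) z t|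
    <= C * (z' - z) ^+ 2.
Hypothesis sol_bottom : forall t, t0 < t -> exists C, 0 <= C /\
  forall i (z z' v e : R), 0 <= z <= 1 -> 0 <= z' <= 1 ->
  (forall x, Num.min z z' <= x <= Num.max z z' -> `|h x t i 0 - v| <= e) ->
  `|sol 0 (rshift n i) z' t - sol 0 (rshift n i) z t - (z' - z) *
     (lam^-1 * (mu * sol 0 (lshift n i) z t + \sum_j S j i * sol 0 (lshift n j) z t)
      + lam^-1 * sol 1 (lshift n i) z t - lam^-1 * v)|
    <= C * (z' - z) ^+ 2 + lam^-1 * e * `|z' - z|.
Hypothesis sol_is_derive : forall i (z t : R), 0 <= z <= 1 -> t0 < t ->
  is_derive t 1 (sol 0 i z) (sol 1 i z t).
Hypothesis sol_continuous : forall m i (z t : R), 0 <= z <= 1 -> t0 < t ->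
  forall e : R, 0 < e -> exists2 d : R, 0 < d & forall z' t', 0 <= z' <= 1 -> t0 < t' ->
    `|z' - z| < d -> `|t' - t| < d -> `|sol m i z' t' - sol m i z t| <= e.
Hypothesis sol_lipschitz : forall m t, t0 < t -> exists C, 0 <= C /\
  forall i (z z' : R), 0 <= z <= 1 -> 0 <= z' <= 1 ->
    `|sol m i z' t - sol m i z t| <= C * `|z' - z|.
Hypothesis sol_top0 : forall i t, t0 < t -> sol 0 (lshift n i) 0 t = - c^-1 * gt4 t i 0.
Hypothesis sol_bottom0 : forall i t, t0 < t -> sol 0 (rshift n i) 0 t = gt2 t i 0.

Let phi_z z t := derive_within `[0, 1] (phi ^~ t) z.

Lemma phi_derive_within z t : 0 <= z <= 1 -> t0 < t ->
  derivable_within `[0, 1] (phi ^~ t) z /\ phi_z z t = \col_i sol 0 (rshift n i) z t.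
Proof.
move=> hz ht.
have [C [C0 HC]] := sol_top ht.
apply: (derive_within_quad (C := C) hz) => i j z' hz'.
by rewrite (ord1 j) !phiE// mxE; exact: HC.
Qed.

Lemma phi_is_derive_time z t : 0 <= z <= 1 -> t0 < t ->
  is_derive t 1 (phi z) (\col_i sol 1 (lshift n i) z t).
Proof.
move=> hz ht; apply: is_derive1_mx => i j; rewrite ord1 mxE.
apply: (@near_eq_is_derive _ _ _ (sol 0 (lshift n i) z)).
  by near=> s; rewrite phiE//; near: s; exact: lt_nbhsr.
exact: sol_is_derive.
Unshelve. all: by end_near. Qed.

(** Treats phi, phi_z and phi_t together: the upper half with m = 0, the lower half with m = 0, and
    the upper half with m = 1. *)
Lemma continuous_of_solution (f : R -> R -> 'cV[R]_n) m (s : 'I_n -> 'I_(n + n)) :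
  (forall i z t, 0 <= z <= 1 -> t0 < t -> f z t i 0 = sol m (s i) z t) ->
  {within `[0, 1] `*` [set t | t0 < t], continuous (fun p : R * R => f p.1 p.2)}.
Proof.
move=> fE; apply/subspace_continuousP => -[z t] [/=]; rewrite in_itv/= => hz ht.
apply: cvg_mx_entries => i j; rewrite ord1; apply/cvgrPdist_le => e e0.
have [d d0 H] := sol_continuous m (s i) hz ht e0.
rewrite near_withinE.
have nb : nbhs (z, t) [set p : R * R | `|p.1 - z| < d /\ `|p.2 - t| < d].
  by apply/nbhs_ballP; exists d => // p [/= p1 p2]; split; rewrite distrC.
apply: filterS nb => -[z' t'] [/= h1 h2] [/=]; rewrite in_itv/= => hz' ht'.
by rewrite !fE// distrC; exact: H.
Qed.

Definition phi_zz_formula z t : 'cV[R]_n := \col_i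
  (lam^-1 * (mu * sol 0 (lshift n i) z t + \sum_j S j i * sol 0 (lshift n j) z t)
   + lam^-1 * sol 1 (lshift n i) z t - lam^-1 * h z t i 0).

Lemma phi_z_is_derive z t : 0 < z < 1 -> t0 < t -> {for z, continuous (h ^~ t)} ->
  is_derive z 1 (phi_z ^~ t) (phi_zz_formula z t).
Proof.
move=> hz ht ch; case/andP: (hz) => z0 z1.
have hz' : 0 <= z <= 1 by rewrite !ltW.
apply: is_derive1_mx => i j; rewrite ord1 mxE.
apply: (@near_eq_is_derive _ _ _ (fun z => sol 0 (rshift n i) z t)).
  near=> y; rewrite (phi_derive_within _ ht).2 ?mxE//.
  by apply/andP; split; apply: ltW; near: y; [exact: lt_nbhsr|exact: lt_nbhsl].
have [C [C0 HC]] := sol_bottom ht.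
apply: (is_derive_little_o C0) => e e0.
(* The tolerance [lam * e] for the source cancels the factor [lam^-1] with which it enters. *)
have le0 : 0 < lam * e by rewrite mulr_gt0.
have chi : (fun y => h y t i 0) @ z --> h z t i 0.
  exact: (cvg_comp (h ^~ t) (fun M : 'cV[R]_n => M i 0) ch (@coord_continuous _ _ _ i 0 _)).
have /nbhs_ballP[r /= r0 Hr] : nbhs z [set y | `|h z t i 0 - h y t i 0| <= lam * e].
  exact: ((cvgrPdist_le _ _).1 chi _ le0).
(* Besides continuity of the source within [r], the radius must keep y inside [0, 1]. *)
exists (Num.min r (Num.min z (1 - z))); first by rewrite !lt_min r0 z0 subr_gt0.
move=> y; rewrite !lt_min => /andP[yr /andP[yz yz1]].
have hy : 0 <= y <= 1.
  by move: yz yz1; rewrite !ltr_norml => /andP[? ?] /andP[? ?]; apply/andP; split; lra.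
have hs x : Num.min z y <= x <= Num.max z y ->
    `|h x t i 0 - h z t i 0| <= lam * e.
  move=> hx; have [hx1 xr] : 0 <= x <= 1 /\ `|z - x| < r.
    have [zy|yz2] := leP z y; move: hx.
      rewrite (min_idPl zy) (max_idPr zy) => /andP[x1 x2].
      move: yr; rewrite ger0_norm ?subr_ge0// => yr.
      case/andP: hy => y0 y1; split; first by rewrite (le_trans (ltW z0) x1) (le_trans x2 y1).
      by rewrite ler0_norm ?subr_le0// opprB (le_lt_trans _ yr)// lerD2r.
    rewrite (min_idPr (ltW yz2)) (max_idPl (ltW yz2)) => /andP[x1 x2].
    move: yr; rewrite ler0_norm ?subr_le0 ?(ltW yz2)// => yr.
    case/andP: hy => y0 y1; split; first by rewrite (le_trans y0 x1) (le_trans x2 (ltW z1)).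
    by rewrite ger0_norm ?subr_ge0// (le_lt_trans _ yr)// opprB lerD2l lerN2.
  by rewrite distrC; exact: Hr.
have := HC i z y (h z t i 0) (lam * e) hz' hy hs.
by rewrite (mulrA lam^-1 lam) mulVf ?gt_eqF// mul1r.
Unshelve. all: by end_near. Qed.

Lemma sol_piecewise m i t : t0 < t -> piecewise_continuous01 (fun z => sol m i z t).
Proof.
move=> ht; apply: uniformly_continuous01_piecewise => e e0.
have [C [C0 HC]] := sol_lipschitz m ht.
have C1 : 0 < C + 1 by rewrite ltr_wpDl.
exists (e / (C + 1)); first by rewrite divr_gt0.
move=> z z' hz hz' hd.
apply: (le_trans (HC i z z' hz hz')).
apply: (@le_trans _ _ ((C + 1) * `|z' - z|)); first by rewrite ler_wpM2r// lerDl.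
by rewrite mulrC -ler_pdivlMr// ltW.
Qed.

Lemma phi_zz_formula_piecewise t : t0 < t -> piecewise_continuous01 (phi_zz_formula ^~ t).
Proof.
move=> ht; apply: piecewise_continuous_mx => i j.
have s1 := piecewise_continuous_sum (index_enum 'I_n) (fun j => S j i)
  (fun j => sol_piecewise 0 (lshift n j) ht).
have s2 := piecewise_continuous_lin (lam^-1 * mu) lam^-1 (sol_piecewise 0 (lshift n i) ht) s1.
have s3 := piecewise_continuous_lin 1 lam^-1 s2 (sol_piecewise 1 (lshift n i) ht).
have := piecewise_continuous_lin 1 (- lam^-1) s3 (h_piecewise i ht).
by congr piecewise_continuous01; apply/funext => z; rewrite mxE !mul1r mulNr mulrDr mulrA.
Qed.

Lemma strong_solution_of_system : strong_solution t0 lam mu c S h gt2 gt4 phi.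
Proof.
split.
- move=> z t hz ht; split; first exact: (phi_derive_within hz ht).1.
  by case: (phi_is_derive_time hz ht).
- split.
  + apply: (continuous_of_solution (f := phi) (m := 0) (s := @lshift n n)) => i z t hz ht.
    exact: phiE.
  + apply: (continuous_of_solution (f := phi_z) (m := 0) (s := @rshift n n)) => i z t hz ht.
    by rewrite (phi_derive_within hz ht).2 mxE.
  + apply: (continuous_of_solution (f := fun z t => derive1 (phi z) t) (m := 1)
      (s := @lshift n n)) => i z t hz ht.
    by rewrite derive1E; case: (phi_is_derive_time hz ht) => _ ->; rewrite mxE.
- move=> t ht.
  (* At the finitely many points of [s] the derivative of phi_z may fail to exist, and phi_zz may
     then have any value. *)
  have [[s cs] _ _] : piecewise_continuous01 (h ^~ t).
    by apply: piecewise_continuous_mx => i j; rewrite ord1; exact: h_piecewise.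
  apply: (piecewise_continuous_eq_off (s := s) (phi_zz_formula_piecewise ht)) => z hz zs.
  by rewrite derive1E; case: (phi_z_is_derive hz ht (cs z hz zs)).
- move=> z t hz ht ch; have hz' : 0 <= z <= 1 by case/andP: hz => ? ?; rewrite !ltW.
  have dz := phi_z_is_derive hz ht ch.
  split; first by case: dz.
  have -> : derive1 (phi z) t = \col_i sol 1 (lshift n i) z t.
    by rewrite derive1E; case: (phi_is_derive_time hz' ht).
  rewrite (_ : derive1 _ z = phi_zz_formula z t); last by rewrite derive1E; case: dz.
  apply/rowP => i; rewrite !mxE phiE//.
  rewrite [X in _ = _ - _ - X + _](_ : _ = \sum_j S j i * sol 0 (lshift n j) z t); last first.
    by apply: eq_bigr => j _; rewrite mxE phiE// mulrC.
  by field; rewrite gt_eqF.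
- move=> t ht; have le01 (x : R) : x = 0 -> 0 <= x <= 1 by move=> ->; rewrite lexx ler01.
  have h0 := le01 0 erefl.
  split.
    by rewrite -/(phi_z 0 t) (phi_derive_within h0 ht).2; apply/rowP => i; rewrite !mxE sol_bottom0.
  by apply/rowP => i; rewrite !mxE phiE// sol_top0// mulNr mulrN mulrA mulfV// mul1r.
Qed.

End Strong.

Section Regulator.
Context {R : realType}.
Variables (n : nat) (alpha t0 lam mu c : R) (S : 'M[R]_n).
Variables (h : R -> R -> 'cV[R]_n) (gt2 gt4 : R -> 'cV[R]_n).
Variable src : 'I_n -> nat -> R -> R -> R.
Hypothesis alpha_bounds : 0 <= alpha < 2.
Hypothesis lam_gt0 : 0 < lam.
Hypothesis c_neq0 : c != 0.
Hypothesis gt2_jet : forall i,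
  gevrey_jet alpha t0 [set: unit] (fun j _ => derive1n j (fun t => gt2 t i 0)).
Hypothesis gt4_jet : forall i,
  gevrey_jet alpha t0 [set: unit] (fun j _ => derive1n j (fun t => gt4 t i 0)).
Hypothesis src_jet : forall i, gevrey_jet alpha t0 `[0, 1] (src i).
Hypothesis srcE : forall i z t, 0 <= z <= 1 -> t0 < t -> src i 0%N z t = h z t i 0.
Hypothesis h_piecewise : forall i t, t0 < t -> piecewise_continuous01 (fun z => h z t i 0).

Lemma phi_formula_strong_solution :
  strong_solution t0 lam mu c S h gt2 gt4 (phi_formula lam mu c S h gt2 gt4).
Proof.
have bd_jet := boundary_jetP c gt2_jet gt4_jet.
have src_meas := src0_measurable srcE h_piecewise.
have le_refl (t : R) : t <= t <= t by rewrite lexx.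
have inc := solution_increment mu S alpha_bounds lam_gt0 bd_jet src_jet src_meas.
apply: (@strong_solution_of_system R n t0 lam mu c S h gt2 gt4 _
  (solution lam mu S (boundary_jet c gt2 gt4) src)) => //.
- move=> i z t hz ht.
  exact: (phi_formula_solution lam mu c S alpha_bounds gt2_jet gt4_jet
    src_jet srcE h_piecewise i hz ht).
- move=> t ht; have [C [C0 HC]] := inc t t 0%N ht.
  exists C; split => // i z z' hz hz'.
  have hs x : Num.min z z' <= x <= Num.max z z' ->
      `|src_col src (lshift n i) 0 x t - 0| <= 0.
    by move=> _; rewrite src_col_top subrr normr0.
  have simpl (p q r l w x : R) : `|p - q - x * (r + 0 - l * 0)| <= C * w + l * 0 * `|x| ->
      `|p - q - x * r| <= C * w.
    by rewrite addr0 mulr0 subr0 mul0r addr0.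
  have := HC (lshift n i) z z' t 0 0 hz hz' (le_refl t) hs.
  by rewrite A0_row_top A1_row_top => /simpl.
- move=> t ht; have [C [C0 HC]] := inc t t 0%N ht.
  exists C; split => // i z z' v e hz hz' hs.
  have hs' x : Num.min z z' <= x <= Num.max z z' ->
      `|src_col src (rshift n i) 0 x t - v| <= e.
    move=> hx; rewrite src_col_bottom srcE//; first exact: hs.
    case/andP: hx => x1 x2; case/andP: hz => z0 z1; case/andP: hz' => z'0 z'1.
    by rewrite (le_trans _ x1) ?le_min ?z0// (le_trans x2)// ge_max z1.
  have := HC (rshift n i) z z' t v e hz hz' (le_refl t) hs'.
  by rewrite A0_row_bottom A1_row_bottom.
- move=> i z t hz ht.
  exact: (solution_is_derive_time mu S alpha_bounds lam_gt0 bd_jet src_jet src_meas 0%N i hz ht).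
- move=> m i z t hz ht e e0.
  exact: (solution_continuous mu S alpha_bounds lam_gt0 bd_jet src_jet src_meas m i hz ht e0).
- move=> m t ht; have [C [C0 HC]] :=
    solution_lipschitz mu S alpha_bounds lam_gt0 bd_jet src_jet src_meas t m ht.
  by exists C; split => // i z z' hz hz'; exact: HC.
- move=> i t ht; rewrite solution_at0 /boundary_jet.
  case: fintype.split_ordP => [j /eqP|j /eqP]; last by rewrite eq_lrshift.
  by rewrite eq_lshift => /eqP <-.
- move=> i t ht; rewrite solution_at0 /boundary_jet.
  case: fintype.split_ordP => [j /eqP|j /eqP]; first by rewrite eq_rlshift.
  by rewrite eq_rshift => /eqP <-.
Qed.

End Regulator.

(** * Application to the kernel and the disturbance inputs *)

Unset Implicit Arguments.
Set Strict Implicit.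

Theorem lemma3 (R : realType) (t0 alpha : R) (N : nat) (m nv : 'I_N -> nat)
  (lam c mu : 'I_N -> R)
  (a : 'I_N -> R -> R -> R) (q : 'I_N -> R -> R)
  (P : forall i, 'M[R]_(m i, nv i)) (S : forall i, 'M[R]_(nv i))
  (g1 : forall i, R -> R -> 'cV[R]_(m i))
  (g2 g4 : forall i, R -> 'cV[R]_(m i))
  (k : 'I_N -> R -> R -> R -> R)
  (t0_ge0 : 0 <= t0) (alpha_bounds : 1 <= alpha < 2)
  (lam_gt0 : forall i, 0 < lam i) (c_neq0 : forall i, c i != 0)
  (a_reg : forall i, C_gevrey alpha t0 (a i))
  (q_reg : forall i, gevrey alpha t0 (q i))
  (g1_reg : forall i (l : 'I_(m i)),
     Cp_gevrey alpha t0 (fun z t => g1 i z t l 0))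
  (g2_reg : forall i (l : 'I_(m i)), gevrey alpha t0 (fun t => g2 i t l 0))
  (g4_reg : forall i (l : 'I_(m i)), gevrey alpha t0 (fun t => g4 i t l 0))
  (obs : forall i, observable (P i) (S i))
  (S_diag : forall i, complex_diagonalizable (S i))
  (S_spec : forall i, imaginary_spectrum (S i))
  (k_sol : forall i,
     kernel_solution t0 alpha (lam i) (mu i) (a i) (q i) (k i)) :
  forall i : 'I_N,
    let h := h1 (lam i) (k i) (P i) (g1 i) (g2 i) in
    let gt2 := fun t => gtilde (P i) (g2 i t) in
    let gt4 := fun t => gtilde (P i) (g4 i t) in
    phi_formula_defined t0 (lam i) (mu i) (c i) (S i) h gt2 gt4 /\
    strong_solution t0 (lam i) (mu i) (c i) (S i) h gt2 gt4
      (phi_formula (lam i) (mu i) (c i) (S i) h gt2 gt4).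
Proof.
move=> i h gt2 gt4.
have al0 : 0 <= alpha by case/andP: alpha_bounds => a1 _; exact: le_trans a1.
have al : 0 <= alpha < 2 by rewrite al0; case/andP: alpha_bounds.
have [k_cont k_gev _ _ _] := k_sol i.
pose K j (p : R * R) := derive1n j (k i p.1 p.2).
(* Component b of the transformed input combines the components of the input with column b of P, and
   so do its time derivatives. *)
pose G b j (z t : R) := \sum_l P i l b * derive1n j (fun s => g1 i z s l 0) t.
pose E b j (z t : R) := \sum_l P i l b * derive1n j (fun s => g2 i s l 0) t.
have K_jet : gevrey_jet alpha t0 closed_triangle K by exact: (gevrey_on_jet k_gev).
have G_jet b : gevrey_jet alpha t0 `[0, 1] (G b).
  exact: (gevrey_jet_sum _ (fun l => P i l b) (fun l => gevrey_on_jet (g1_reg i l).2)).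
have E_jet b : gevrey_jet alpha t0 `[0, 1] (E b).
  exact: (gevrey_jet_sum _ (fun l => P i l b) (fun l => gevrey_cst_jet _ (g2_reg i l))).
have G_pc b t : t0 < t -> piecewise_continuous01 (G b 0%N ^~ t).
  by move=> ht; apply: piecewise_continuous_sum => l; exact: (g1_reg i l).1.
have gE m' n' (Q : 'M[R]_(m', n')) (g : 'cV[R]_m') b : gtilde Q g b 0 = \sum_l Q l b * g l 0.
  by rewrite !mxE; apply: eq_bigr => l _; rewrite mxE mulrC.
have hE b z t : source (lam i) K (G b) (E b) z t = h z t b 0.
  rewrite /source /h /h1 !mxE; congr (_ * _ + _ - _).
  - by apply: eq_bigr => l _; rewrite mxE mulrC.
  - by apply: eq_bigr => l _; rewrite mxE mulrC.
  - by apply: eq_Rintegral => x _; rewrite [in RHS]mxE gE.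
have E_cst b z z' t : E b 0%N z t = E b 0%N z' t by [].
have src_ex b := source_jet (lam i) al0 K_jet (G_jet b) (E_jet b) k_cont (G_pc b).
(* The derivative family of the source is known only to exist; one is chosen for each component. *)
pose src b := sval (cid (src_ex b)).
have src_jet b : gevrey_jet alpha t0 `[0, 1] (src b) := (svalP (cid (src_ex b))).1.
have srcE b z t : 0 <= z <= 1 -> t0 < t -> src b 0%N z t = h z t b 0.
  by move=> hz ht; rewrite -hE; exact: (svalP (cid (src_ex b))).2.
have h_pc b t : t0 < t -> piecewise_continuous01 (fun z => h z t b 0).
  move=> ht; have := source_piecewise (lam i) K_jet (G_jet b) k_cont (G_pc b) (E_cst b) ht.
  by congr piecewise_continuous01; apply/funext => z; exact: hE.
have gt2_jet b := gtilde_gevrey_jet (P i) b (g2_reg i).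
have gt4_jet b := gtilde_gevrey_jet (P i) b (g4_reg i).
split.
  exact: (formula_defined _ _ _ _ al gt2_jet gt4_jet src_jet srcE h_pc).
exact: (phi_formula_strong_solution _ _ al (lam_gt0 i) (c_neq0 i) gt2_jet gt4_jet
  src_jet srcE h_pc).
Qed.
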